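(* Let $\mathsf{M}=(\mathbf{X},\mathbf{A},\{\mathbf{A}(x)\}_{x\in\mathbf{X}},Q,\eta,r)$ be a Markov control model satisfying the measurability conditions, with $\mathbf{A}$ compact and bounded measurable reward function $r:\mathbf{X}\times\mathbf{A}\to\mathbb{R}^d$, $d\ge1$, and suppose that $\mathsf{M}$ is uniformly $\Delta$-absorbing. Then the set $\mathbb{F}_{d+1}$ of finite mixtures of $d+1$ deterministic stationary policies is a sufficient family of policies, that is, $\mathcal{R}(\mathbb{F}_{d+1})=\mathcal{R}(\mathbf{\Pi})$.
   Context: Model. A control model $\mathsf{M}=(\mathbf{X},\mathbf{A},\{\mathbf{A}(x)\}_{x\in\mathbf{X}},Q,\eta,r)$ consists of: a measurable state space $(\mathbf{X},\mathfrak{X})$; a Borel space $\mathbf{A}$ (action space, with its Borel $\sigma$-algebra $\mathfrak{B}(\mathbf{A})$; standing assumption: $\mathbf{A}$ is compact); nonempty measurable sets $\mathbf{A}(x)\subseteq\mathbf{A}$ of admissible actions, with $\mathbf{K}=\{(x,a)\in\mathbf{X}\times\mathbf{A}:a\in\mathbf{A}(x)\}$; a stochastic kernel $Q$ on $\mathbf{X}$ given $(\mathbf{X}\times\mathbf{A},\mathfrak{X}\otimes\mathfrak{B}(\mathbf{A}))$; a probability measure $\eta$ on $\mathbf{X}$ (initial distribution); a bounded measurable function $r:\mathbf{X}\times\mathbf{A}\to\mathbb{R}^d$, $d\ge1$. It satisfies the measurability conditions if $\mathbf{K}\in\mathfrak{X}\otimes\mathfrak{B}(\mathbf{A})$ and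 there is a measurable function $\theta:\mathbf{X}\to\mathbf{A}$ with $\theta(x)\in\mathbf{A}(x)$ for all $x$. Policies. $\mathbf{H}_0=\mathbf{X}$ and $\mathbf{H}_n=\mathbf{H}_{n-1}\times\mathbf{A}\times\mathbf{X}$ for $n\ge1$, with product $\sigma$-algebras. A policy $\pi=\{\pi_n\}_{n\ge0}$ is a sequence of stochastic kernels $\pi_n$ on $\mathbf{A}$ given $\mathbf{H}_n$ with $\pi_n(\mathbf{A}(x_n)|h_n)=1$ for all $h_n=(x_0,a_0,\ldots,x_n)\in\mathbf{H}_n$; $\mathbf{\Pi}$ is the set of all policies. $\mathbb{S}$ is the set of randomized stationary policies: $\pi_n(\cdot|h_n)=\varphi(\cdot|x_n)$ for all $n$, for some stochastic kernel $\varphi$ on $\mathbf{A}$ given $\mathbf{X}$ with $\varphi(\mathbf{A}(x)|x)=1$ for all $x$. $\mathbb{D}$ is the set of deterministic stationary policies: $\pi_n(\cdot|h_n)=\delta_{\phi(x_n)}$ for all $n$, for some measurable $\phi:\mathbf{X}\to\mathbf{A}$ with $\phi(x)\in\mathbf{A}(x)$ for all $x$. For $\pi\in\mathbf{\Pi}$, $\mathbb{P}_\pi$ is the unique probability measure on $(\mathbf{X}\times\mathbf{A})^\infty$, with coordinate processes $(X_n),(A_n)$ and $H_n=(X_0,A_0,\ldots,X_n)$, such that $X_0\sim\eta$, $\mathbb{P}_\pi(A_n\in\cdot\mid H_n)=\pi_n(\cdot|H_n)$ and $\mathbb{P}_\pi(X_{n+1}\in\cdot\mid H_n,A_n)=Q(\cdot|X_n,A_n)$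 for all $n$; $\mathbb{E}_\pi$ is the expectation under $\mathbb{P}_\pi$. Absorbing models. For $\Delta\in\mathfrak{X}$, let $T_\Delta=\min\{n\ge0:X_n\in\Delta\}$ ($+\infty$ if there is no such $n$). $\mathsf{M}$ is $\Delta$-absorbing if $Q(\Delta|x,a)=1$ and $r(x,a)=0$ for all $(x,a)\in\Delta\times\mathbf{A}$, and $\mathbb{E}_\pi[T_\Delta]<\infty$ for all $\pi\in\mathbf{\Pi}$. It is uniformly $\Delta$-absorbing if in addition $\lim_{n\to\infty}\sup_{\pi\in\mathbf{\Pi}}\sum_{t=n}^\infty\mathbb{P}_\pi\{T_\Delta>t\}=0$. Occupancy measures. For $\pi\in\mathbf{\Pi}$, $\mu_\pi(\Gamma)=\mathbb{E}_\pi\big[\sum_{t=0}^\infty \mathbf{1}_{\{T_\Delta>t\}}\mathbf{1}_{\{(X_t,A_t)\in\Gamma\}}\big]$ for $\Gamma\in\mathfrak{X}\otimes\mathfrak{B}(\mathbf{A})$. Finite mixtures. For $n\ge1$, $\mathbb{F}_n$ is the set of $\gamma\in\mathbb{S}$ for which there exist real numbers $\alpha_1,\ldots,\alpha_n\ge0$ with $\sum_j\alpha_j=1$, and $\gamma_1,\ldots,\gamma_n\in\mathbb{D}$ with $\mu_\gamma=\sum_{j=1}^n\alpha_j\mu_{\gamma_j}$. Performance. $\mathcal{R}(\pi)=\mathbb{E}_\pi\big[\sum_{t=0}^\infty r(X_t,A_t)\big]\in\mathbb{R}^d$ for $\pi\in\mathbf{\Pi}$; for $\mathbf{\Lambda}\subseteq\mathbf{\Pi}$,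 $\mathcal{R}(\mathbf{\Lambda})=\{\mathcal{R}(\pi):\pi\in\mathbf{\Lambda}\}$. *)

(* Defs.v *)
From HB Require Import structures.
From mathcomp Require Import all_boot all_order all_algebra.
From mathcomp Require Import all_classical all_reals all_analysis.

Set Implicit Arguments.
Unset Strict Implicit.
Unset Printing Implicit Defensive.

Import Order.TTheory GRing.Theory Num.Theory.
Import numFieldNormedType.Exports.

Local Open Scope classical_set_scope.
Local Open Scope ring_scope.

Notation borel T := (g_sigma_algebraType (@open T)).

(* [T] is homeomorphic to a Borel subset of a complete separable metric space. *)
Definition borel_space (R : realType) (T : topologicalType) : Prop :=
  exists (E : metricType R) (f : T -> E),
    [/\ forall F : set_system E, ProperFilter F -> cauchy F ->
          exists l : E, F --> l,
        exists S : set E, countable S /\ dense S,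
        injective f,
        forall U : set T, open U <-> exists V : set E, open V /\ U = f @^-1` V
      & <<s @open E >> (range f)].

Record control_model (R : realType) (dX : measure_display)
    (X : measurableType dX) (A : ptopologicalType) (d : nat) := ControlModel {
  adm : X -> set (borel A) ;
  adm_measurable : forall x, measurable (adm x) ;
  adm_nonempty : forall x, adm x !=set0 ;
  trans : R.-pker (X * borel A)%type ~> X ;
  init : probability X R ;
  rew : X * borel A -> 'rV[R]_d ;
  rew_measurable : forall i : 'I_d,
    measurable_fun [set: X * borel A] (fun z => rew z ord0 i) ;
  rew_bounded : exists C : R, forall z i, `|rew z ord0 i| <= C }.

Section histories.
Context (dX : measure_display) (X : measurableType dX) (A : ptopologicalType).

Fixpoint hist_display (n : nat) : measure_display :=
  if n is m.+1 then
    ((hist_display m, sigma_display (@open A)).-prod, dX).-prod%mdisp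
  else dX.

Fixpoint hist (n : nat) : measurableType (hist_display n) :=
  match n return measurableType (hist_display n) with
  | 0 => X
  | m.+1 => (hist m * borel A * X)%type : measurableType _
  end.

Definition last_state (n : nat) : hist n -> X :=
  match n return hist n -> X with
  | 0 => fun h => h
  | m.+1 => fun h => h.2
  end.

(* Trajectories (x_0, a_0), (x_1, a_1), ... with the product sigma-algebra. *)
Definition coordinate_cylinders : set (set (nat -> X * borel A)) :=
  [set E | exists (n : nat) (B : set (X * borel A)),
     measurable B /\ E = [set w | B (w n)]].

Definition trajectory : measurableType (sigma_display coordinate_cylinders) :=
  g_sigma_algebraType coordinate_cylinders.

Definition state (n : nat) (w : trajectory) : X := (w n).1.

Definition action (n : nat) (w : trajectory) : borel A := (w n).2.

Fixpoint history (n : nat) (w : trajectory) : hist n :=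
  match n return hist n with
  | 0 => state 0 w
  | m.+1 => (history m w, action m w, state m.+1 w)
  end.

Definition hitting_time (R : realType) (D : set X) (w : trajectory) : \bar R :=
  match pselect (exists n, state n w \in D) with
  | left H => (ex_minn H)%:R%:E
  | right _ => +oo%E
  end.

End histories.

Arguments state {dX X A} n w.
Arguments action {dX X A} n w.
Arguments history {dX X A} n w.

(* P(Z \in . | Y) = k(. | Y), almost surely *)
Definition conditional_law (R : realType) d0 d1 d2 (O : measurableType d0)
    (T : measurableType d1) (U : measurableType d2) (P : probability O R)
    (Y : O -> T) (Z : O -> U) (k : T -> set U -> \bar R) : Prop :=
  forall (B : set T) (C : set U), measurable B -> measurable C ->
    P (Y @^-1` B `&` Z @^-1` C) = (\int[P]_(w in Y @^-1` B) k (Y w) C)%E.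

Section model.
Context (R : realType) (dX : measure_display) (X : measurableType dX)
  (A : ptopologicalType) (d : nat).
Variable M : control_model R X A d.

Definition measurability_conditions : Prop :=
  measurable ([set z | adm M z.1 z.2] : set (X * borel A)) /\
  exists theta : X -> borel A,
    measurable_fun [set: X] theta /\ forall x, adm M x (theta x).

Record policy := Policy {
  pol : forall n, R.-pker (hist X A n) ~> borel A ;
  pol_adm : forall n (h : hist X A n), pol n h (adm M (last_state h)) = 1%E }.

Definition stationary : set policy :=
  [set p | exists phi : R.-pker X ~> borel A,
     (forall x, phi x (adm M x) = 1%E) /\
     forall n (h : hist X A n) (C : set (borel A)), measurable C ->
       pol p n h C = phi (last_state h) C].

Definition deterministic : set policy :=
  [set p | exists phi : X -> borel A,
     [/\ measurable_fun [set: X] phi,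
         forall x, adm M x (phi x)
       & forall n (h : hist X A n) (C : set (borel A)), measurable C ->
           pol p n h C = \d_(phi (last_state h)) C]].

Definition is_strategic (p : policy) (P : probability (trajectory X A) R) : Prop :=
  [/\ forall B : set X, measurable B -> P (state 0 @^-1` B) = init M B,
      forall n, conditional_law P (history n) (action n)
        (fun h => pol p n h)
    & forall n, conditional_law P
        (fun w => (history n w, action n w))
        (state n.+1)
        (fun ha : hist X A n * borel A => trans M (last_state ha.1, ha.2))].

(* The law P_p, by definite description: by the Ionescu-Tulcea theorem a
   probability measure satisfying [is_strategic p] exists and its values on
   measurable sets are unique, so the Dirac default is never used. *)
Definition strategic (p : policy) : probability (trajectory X A) R :=
  xget (\d_(point : trajectory X A) : probability (trajectory X A) R)
    [set P | is_strategic p P].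

Definition absorbing (D : set X) : Prop :=
  [/\ measurable D,
      forall x a, D x -> trans M (x, a) D = 1%E /\ rew M (x, a) = 0
    & forall p : policy, (\int[strategic p]_w hitting_time R D w < +oo)%E].

Definition uniformly_absorbing (D : set X) : Prop :=
  absorbing D /\
  (fun n : nat => ereal_sup
     [set (\sum_(n <= t <oo)
             strategic p [set w | (t%:R%:E < hitting_time R D w)%E])%E
        | p in [set: policy]]) @ \oo --> 0%E.

Definition occupancy (D : set X) (p : policy) (G : set (X * borel A)) :
    \bar R :=
  (\int[strategic p]_w \sum_(0 <= t <oo)
     (\1_[set w' | (t%:R%:E < hitting_time R D w')%E] w
      * \1_G (state t w, action t w))%:E)%E.

Definition finite_mixtures (D : set X) (n : nat) : set policy :=
  [set g | stationary g /\
     exists (alpha : 'I_n -> R) (gs : 'I_n -> policy),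
       [/\ forall j, 0 <= alpha j,
           \sum_(j < n) alpha j = 1,
           forall j, deterministic (gs j)
         & forall G : set (X * borel A), measurable G ->
             occupancy D g G
             = (\sum_(j < n) (alpha j)%:E * occupancy D (gs j) G)%E]].

(* In an absorbing model the series has almost surely finitely many nonzero
   terms and its sum is integrable, so [fine] only changes the type. *)
Definition performance (p : policy) : 'rV[R]_d :=
  \row_(i < d) fine (\int[strategic p]_w
    \sum_(0 <= t <oo) (rew M (state t w, action t w) ord0 i)%:E)%E.

End model.

Arguments finite_mixtures {R dX X A d} M D n.
Arguments performance {R dX X A d} M p.

(* Main.v *)
(** A convex combination of occupation measures is the occupation measure of a stationary
    policy: disintegrate it along its state marginal. By Caratheodory's theorem it thus
    suffices to show that the performance of every stationary policy gamma lies in the convex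
    hull of the performances of the deterministic stationary policies. This hull need not be
    closed; a vector outside it is separated from it lexicographically by finitely many linear
    functionals, that is, by finitely many scalar rewards.

    Conversely, for any finite list of scalar rewards some deterministic stationary policy is
    lexicographically at least as good as gamma. The action values under gamma average, over
    the actions drawn by gamma, to the value of gamma; hence the actions with lexicographically
    nonnegative advantage have positive probability at each state, and one of them can be
    selected measurably. The expected advantages along the selected policy sum up to its gain
    over gamma, because the value of gamma expected after n steps is at most a multiple of
    sup_pi \sum_(t >= n) P_pi(T > t), which tends to 0 by uniform absorption. *)

Require Import Defs.
From HB Require Import structures.
From mathcomp Require Import all_boot all_order all_algebra.
From mathcomp Require Import all_classical all_reals all_analysis.
From mathcomp Require Import measurable_realfun.
From mathcomp Require Import lra.
Import Order.TTheory GRing.Theory Num.Theory.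
Import numFieldNormedType.Exports.
Local Open Scope classical_set_scope.
Local Open Scope ring_scope.

Set Implicit Arguments.
Unset Strict Implicit.
Unset Printing Implicit Defensive.

(** * Kernels *)

(** The value of gamma may be infinite at some states: absorption bounds expected lifetimes only
    along the trajectories of policies. The advantage inequality is therefore asked of the selected
    action only where the expected life under gamma is finite. Almost surely no other state is
    visited, because following any policy up to time n and gamma afterwards is again a policy. The
    same switched policies turn the remaining life at time n into a tail of survival probabilities;
    they vary with n, which is why a supremum over all policies appears. To avoid differences of
    infinite values, each reward is split into its positive and negative parts, and sums of
    nonnegative terms are compared. Disintegration and selection are carried out for a real second
    coordinate and transferred to the action space by a measurable coding in [0, 1] with a
    measurable left inverse defined on the whole line. Selection rests on sections of positive mass
    under a kernel, which contain closed sets of positive mass chosen jointly measurably. The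
    strategic measures are given by a description, so nothing can be said of them before their
    existence is established. *)

Section mk_pker.
Context d d' (X : measurableType d) (Y : measurableType d') (R : realType).
Variable k : X -> {measure set Y -> \bar R}.
Hypothesis mk : forall U, measurable U -> measurable_fun [set: X] (k ^~ U).
Hypothesis k1 : forall x, k x setT = 1%E.

(** An alias of [k] that carries the two proofs among its arguments, so that the kernel instances
    can be attached to it. *)
Definition mk_pker_fun (_ : forall U, measurable U -> measurable_fun [set: X] (k ^~ U))
  (_ : forall x, k x setT = 1%E) : X -> {measure set Y -> \bar R} := k.

HB.instance Definition _ := isKernel.Build _ _ _ _ _ (mk_pker_fun mk k1) mk.
HB.instance Definition _ :=
  Kernel_isProbability.Build _ _ _ _ _ (mk_pker_fun mk k1) k1.

Definition mk_pker : R.-pker X ~> Y := mk_pker_fun mk k1.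

End mk_pker.

Section ge0_ind.
Local Open Scope ereal_scope.
Context d (T : measurableType d) (R : realType).
Import HBNNSimple.

(** The functional monotone class principle: a nonnegative measurable function is an increasing
    limit of simple functions. It serves to prove identities between integrals. *)
Lemma ge0_fun_ind (P : (T -> \bar R) -> Prop) :
  (forall A, measurable A -> P (fun x => (\1_A x)%:E)) ->
  (forall f g, (forall x, 0 <= f x) -> measurable_fun setT f ->
     (forall x, 0 <= g x) -> measurable_fun setT g ->
     P f -> P g -> P (fun x => f x + g x)) ->
  (forall (r : R) f, (0 <= r)%R -> (forall x, 0 <= f x) -> measurable_fun setT f ->
     P f -> P (fun x => r%:E * f x)) ->
  (forall f : nat -> T -> \bar R, (forall n x, 0 <= f n x) ->
     (forall n, measurable_fun setT (f n)) ->
     (forall x, nondecreasing_seq (f ^~ x)) ->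
     (forall n, P (f n)) -> P (fun x => limn (f ^~ x))) ->
  forall f, (forall x, 0 <= f x) -> measurable_fun setT f -> P f.
Proof.
move=> P1 Padd Pscale Plim f f0 mf.
pose f_ := nnsfun_approx measurableT mf.
have -> : f = fun x => limn (fun n => (f_ n x)%:E).
  by apply/funext => x; apply/esym/cvg_lim => //; exact: cvg_nnsfun_approx.
apply: Plim.
- by move=> n x; rewrite lee_fin.
- by move=> n; exact/measurable_EFinP.
- by move=> x a b ab; rewrite lee_fin; exact/lefP/nd_nnsfun_approx.
move=> n; set g := f_ n.
have -> : (fun x => (g x)%:E) = fun x =>
    \sum_(y <- finmap.enum_fset (fset_set (range g))) (y%:E * (\1_(g @^-1` [set y]) x)%:E).
  apply/funext => x; rewrite fimfunE fsbig_finite//= -sumEFin.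
  by apply: eq_bigr => y _; rewrite EFinM.
have : forall y, y \in finmap.enum_fset (fset_set (range g)) -> (0 <= y)%R.
  by move=> y; rewrite in_fset_set// inE => -[x _ <-].
elim: (finmap.enum_fset _) => [_|y s IH hs].
  (* No clause of the principle gives the zero function directly; it is reached as a zero multiple
     of an indicator. *)
  rewrite [X in P X](_ : _ = fun x => 0%:E * (\1_set0 x)%:E); last first.
    by apply/funext => x; rewrite big_nil mul0e.
  by apply: Pscale => //; [exact/measurable_EFinP|exact: P1].
have y0 : (0 <= y)%R by apply: hs; rewrite mem_head.
rewrite [X in P X](_ : _ = fun x => y%:E * (\1_(g @^-1` [set y]) x)%:E +
   \sum_(y <- s) (y%:E * (\1_(g @^-1` [set y]) x)%:E)); last first.
  by apply/funext => x; rewrite big_cons.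
have hs' : forall y, y \in s -> (0 <= y)%R.
  by move=> z zs; apply: hs; rewrite in_cons zs orbT.
have mi z : measurable_fun setT (fun x => (\1_(g @^-1` [set z]) x : R)%:E).
  by apply/measurable_EFinP; exact: measurable_indic.
apply: Padd => //.
- by move=> x; rewrite mule_ge0// lee_fin.
- by apply: measurable_funeM.
- move=> x; rewrite big_seq; apply: sume_ge0 => z zs.
  by rewrite mule_ge0// lee_fin // hs'.
- by apply: emeasurable_sum => z; apply: measurable_funeM.
- by apply: Pscale => //; apply: P1.
- exact: IH.
Qed.

End ge0_ind.

Lemma measure_as_integral d (T : measurableType d) (R : realType)
    (m : {measure set T -> \bar R}) A : measurable A ->
  m A = (\int[m]_x (\1_A x)%:E)%E.
Proof. by move=> mA; rewrite integral_indic// setIT. Qed.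

Section mbind.
Local Open Scope ereal_scope.
Context d d' (T : measurableType d) (U : measurableType d') (R : realType).
Variables (m : {measure set T -> \bar R}) (k : R.-ker T ~> U).

Definition mbind (A : set U) : \bar R := \int[m]_t k t A.

Let mbind0 : mbind set0 = 0.
Proof. by rewrite /mbind integral0_eq. Qed.

Let mbind_ge0 A : 0 <= mbind A.
Proof. by apply: integral_ge0 => t _; exact: measure_ge0. Qed.

Let mbind_sigma : semi_sigma_additive mbind.
Proof.
move=> F mF tF mUF.
have -> : mbind (\bigcup_n F n) = \int[m]_t \sum_(0 <= n <oo) k t (F n).
  by apply: eq_integral => t _; rewrite measure_semi_bigcup.
rewrite integral_nneseries//; last by move=> n; exact: measurable_kernel.
by apply: is_cvg_nneseries => n _ _; exact: mbind_ge0.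
Qed.

HB.instance Definition _ := isMeasure.Build _ _ _ mbind mbind0 mbind_ge0 mbind_sigma.

Lemma integral_mbind (f : U -> \bar R) : (forall x, 0 <= f x) ->
  measurable_fun setT f -> \int[mbind]_x f x = \int[m]_t \int[k t]_x f x.
Proof.
have mint (g : U -> \bar R) : (forall x, 0 <= g x) -> measurable_fun setT g ->
    measurable_fun setT (fun t => \int[k t]_x g x).
  by move=> g0 mg; apply: measurable_fun_integral_kernel => // V mV;
    exact: measurable_kernel.
have ige0 (g : U -> \bar R) t : (forall x, 0 <= g x) -> 0 <= \int[k t]_x g x.
  by move=> g0; exact: integral_ge0.
move: f; apply: ge0_fun_ind.
- move=> A mA; rewrite integral_indic// setIT.
  by apply: eq_integral => t _; rewrite integral_indic// setIT.
- move=> f g f0 mf g0 mg ihf ihg; rewrite ge0_integralD// ihf ihg.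
  rewrite -ge0_integralD//; do ?[by move=> *; exact: ige0|exact: mint].
  by apply: eq_integral => t _; rewrite ge0_integralD.
- move=> r f r0 f0 mf ih; rewrite ge0_integralZl// ih.
  rewrite -ge0_integralZl//; do ?[by move=> *; exact: ige0|exact: mint].
  by apply: eq_integral => t _; rewrite ge0_integralZl.
- move=> f f0 mf ndf ih.
  rewrite monotone_convergence//.
  have -> : (fun n => \int[mbind]_x f n x) = fun n => \int[m]_t \int[k t]_x f n x.
    by apply/funext => n.
  rewrite -monotone_convergence//.
  + by apply: eq_integral => t _; rewrite monotone_convergence//.
  + by move=> n; exact: mint.
  + by move=> n t _; exact: ige0.
  + by move=> t _ a b ab; apply: ge0_le_integral => // x _; exact: ndf.
Qed.

End mbind.

Lemma pker_le1 d d' (T : measurableType d) (U : measurableType d') (R : realType)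
    (k : R.-pker T ~> U) t A : measurable A -> (k t A <= 1)%E.
Proof. by move=> mA; rewrite -[leRHS](@prob_kernel _ _ _ _ _ k t) le_measure ?inE. Qed.

Lemma pker_lty d d' (T : measurableType d) (U : measurableType d') (R : realType)
    (k : R.-pker T ~> U) t A : measurable A -> (k t A < +oo)%E.
Proof. by move=> mA; apply: le_lt_trans (pker_le1 k t mA) (ltry _). Qed.

Section mpush.
Local Open Scope ereal_scope.
Context d d' (T : measurableType d) (U : measurableType d') (R : realType).

Definition mpush (m : {measure set T -> \bar R}) (f : T -> U)
    (mf : measurable_fun [set: T] f) : {measure set U -> \bar R} :=
  measure_function_pushforward__canonical__measure_function_Measure m mf.

Lemma mpushE m f mf A : @mpush m f mf A = m (f @^-1` A).
Proof. by []. Qed.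

Lemma integral_mpush m f mf (g : U -> \bar R) : (forall x, 0 <= g x) ->
  measurable_fun setT g -> \int[@mpush m f mf]_x g x = \int[m]_x g (f x).
Proof. by move=> g0 mg; rewrite (@ge0_integral_pushforward _ _ _ _ _ _ mf). Qed.

End mpush.

Section kgraph.
Local Open Scope ereal_scope.
Context d d' (T : measurableType d) (U : measurableType d') (R : realType).
Variable k : R.-pker T ~> U.

(** The law of [(t, u)] for [u] drawn from [k t]. Keeping the starting point makes [mbind m kgraph]
    the joint law with first marginal [m] and conditional law [k]. *)
Definition kgraph_fun (t : T) : {measure set (T * U) -> \bar R} :=
  mpush (k t) (pair1_measurable t).

Let mkg A : measurable A -> measurable_fun [set: T] (kgraph_fun ^~ A).
Proof.
move=> mA; rewrite [X in measurable_fun _ X](_ : _ = fun t => k t (xsection A t)); last first.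
  by apply/funext => t; rewrite xsectionE.
by apply: measurable_fun_xsection_finite_kernel => //; rewrite inE.
Qed.

Let kg1 t : kgraph_fun t setT = 1.
Proof. by rewrite /kgraph_fun mpushE preimage_setT prob_kernel. Qed.

Definition kgraph : R.-pker T ~> (T * U)%type := mk_pker mkg kg1.

Lemma integral_kgraph t (f : T * U -> \bar R) : (forall x, 0 <= f x) ->
  measurable_fun setT f -> \int[kgraph t]_x f x = \int[k t]_u f (t, u).
Proof. by move=> f0 mf; rewrite integral_mpush. Qed.

Lemma kgraphE t A : kgraph t A = k t [set u | A (t, u)].
Proof. by []. Qed.

Lemma mbind_kgraph_rect (m : {measure set T -> \bar R}) B C : measurable B ->
  mbind m kgraph (B `*` C) = \int[m]_(t in B) k t C.
Proof.
move=> mB; rewrite [RHS]integral_mkcond /mbind; apply: eq_integral => t _.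
rewrite kgraphE patchE; case: ifPn => tB.
  by congr (k t _); apply/seteqP; split => u /=; [case|rewrite inE in tB].
rewrite [X in k _ X](_ : _ = set0) ?measure0//.
by apply/seteqP; split => u //= [Bt _]; move: tB; rewrite notin_setE.
Qed.

End kgraph.

Section kcomp_fun.
Local Open Scope ereal_scope.
Context d0 d d' (T0 : measurableType d0) (T : measurableType d)
  (U : measurableType d') (R : realType).
Variables (k : R.-pker T ~> U) (f : T0 -> T).
Hypothesis mf : measurable_fun setT f.

Let mkf A : measurable A -> measurable_fun [set: T0] ((fun t => k (f t)) ^~ A).
Proof. by move=> mA; exact: (measurableT_comp (measurable_kernel k A mA) mf). Qed.

Let kf1 t : k (f t) setT = 1.
Proof. exact: prob_kernel. Qed.

Definition kreindex : R.-pker T0 ~> U := mk_pker mkf kf1.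

End kcomp_fun.

Section kbind.
Local Open Scope ereal_scope.
Context d0 d d' (T0 : measurableType d0) (T : measurableType d)
  (U : measurableType d') (R : realType).
Variables (k1 : R.-pker T0 ~> T) (k2 : R.-pker T ~> U).

Let kb (t : T0) : {measure set U -> \bar R} := mbind (k1 t) k2.

Let mkb A : measurable A -> measurable_fun [set: T0] (kb ^~ A).
Proof.
move=> mA; apply: measurable_fun_integral_kernel => // [V mV|].
  exact: measurable_kernel.
exact: measurable_kernel.
Qed.

Let kb1 t : kb t setT = 1.
Proof.
rewrite /kb/= /mbind (eq_integral (cst 1)); last by move=> x _; rewrite prob_kernel.
by rewrite integral_cst// mul1e prob_kernel.
Qed.

Definition kbind : R.-pker T0 ~> U := mk_pker mkb kb1.

Lemma integral_kbind t (f : U -> \bar R) : (forall x, 0 <= f x) ->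
  measurable_fun setT f -> \int[kbind t]_x f x = \int[k1 t]_y \int[k2 y]_x f x.
Proof. exact: integral_mbind. Qed.

End kbind.

Section prod_unique.
Local Open Scope ereal_scope.
Context d d' (T : measurableType d) (U : measurableType d') (R : realType).

Lemma eq_measure_rect (m1 m2 : {measure set (T * U) -> \bar R}) :
  m1 setT < +oo ->
  (forall A B, measurable A -> measurable B -> m1 (A `*` B) = m2 (A `*` B)) ->
  forall C, measurable C -> m1 C = m2 C.
Proof.
move=> fin1 m12 C mC.
apply: (measure_unique [set C | exists A B, [/\ measurable A, measurable B & C = A `*` B]]
  (fun=> setT)) => //.
- rewrite measurable_prod_measurableType; congr (<<s _ >>).
  apply/seteqP; split => [_ [A mA [B mB <-]]|_ [A [B [mA mB ->]]]]; first by exists A, B.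
  by exists A => //; exists B.
- move=> _ _ [A [B [mA mB ->]]] [A' [B' [mA' mB' ->]]].
  exists (A `&` A'), (B `&` B'); split; [exact: measurableI..|].
  by rewrite setXI.
- by move=> _; exists setT, setT; rewrite setXTT.
- by rewrite bigcup_const.
- by move=> _ [A [B [mA mB ->]]]; exact: m12.
Qed.

Lemma eq_integral_measure dS (S : measurableType dS)
    (m1 m2 : {measure set S -> \bar R}) (f : S -> \bar R) :
  (forall A, measurable A -> m1 A = m2 A) ->
  \int[m1]_x f x = \int[m2]_x f x.
Proof. by move=> m12; apply: eq_measure_integral => A mA _; exact: m12. Qed.

(** By definition [conditional_law] states that the law of [(Y, Z)] and the composition of the law
    of [Y] with [k] agree on rectangles; hence they agree as measures. *)
Lemma integral_conditional_law dO (O : measurableType dO) (P : probability O R)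
    (Y : O -> T) (Z : O -> U) (k : R.-pker T ~> U) (F : T * U -> \bar R) :
  measurable_fun setT Y -> measurable_fun setT Z ->
  conditional_law P Y Z (fun t => k t) ->
  (forall x, 0 <= F x) -> measurable_fun setT F ->
  \int[P]_w F (Y w, Z w) = \int[P]_w \int[k (Y w)]_z F (Y w, z).
Proof.
move=> mY mZ cYZ F0 mF.
have mYZ : measurable_fun setT (fun w => (Y w, Z w)) by exact/measurable_fun_pair.
rewrite -(integral_mpush P mYZ)//.
rewrite (@eq_integral_measure _ _ _ (mbind P (kreindex (kgraph k) mY))); last first.
  apply: eq_measure_rect => [|A B mA mB].
    by rewrite mpushE preimage_setT (le_lt_trans (probability_le1 P measurableT))// ltry.
  transitivity (P (Y @^-1` A `&` Z @^-1` B)) => //.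
  rewrite cYZ//= integral_mkcond /mbind; apply: eq_integral => w _ /=.
  rewrite [RHS]kgraphE patchE; case: ifPn => wA.
    congr (k _ _); apply/seteqP; split => u /=; first by rewrite inE in wA.
    by case.
  rewrite [X in k _ X](_ : _ = set0) ?measure0//.
  by apply/seteqP; split => u //= [Aw _]; move: wA; rewrite notin_setE.
rewrite integral_mbind//; apply: eq_integral => w _.
exact: integral_kgraph.
Qed.

End prod_unique.

(** * Existence of the strategic measures *)

(** An opaque display that keeps the algebra of cylinders apart from other measurable structures. *)
Definition cyl_display : measure_display. Proof. by []. Qed.

Section cyl_type.
Context (Om : pointedType) (disp : nat -> measure_display)
  (S : forall n, measurableType (disp n)).

(** A copy of [Om] tagged by [h], on which the algebra of cylinders of [h] can be declared
    canonical. *)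
Definition cyl_type (h : forall n, Om -> S n) : Type := Om.

Variable h : forall n, Om -> S n.
HB.instance Definition _ := Pointed.copy (cyl_type h) Om.

End cyl_type.

Section ionescu_tulcea.
Local Open Scope ereal_scope.
Context (R : realType) (Om : pointedType) (disp : nat -> measure_display)
  (S : forall n, measurableType (disp n)) (h : forall n, Om -> S n)
  (pr : forall n, S n.+1 -> S n).
Hypothesis mpr : forall n, measurable_fun setT (@pr n).
Hypothesis pr_h : forall n w, pr (h n.+1 w) = h n w.
Hypothesis h_lim : forall s : forall n, S n, (forall n, pr (s n.+1) = s n) ->
  exists w, forall n, h n w = s n.
Hypothesis h_surj : forall n s, exists w, h n w = s.
Variables (k : forall n, R.-pker S n ~> S n.+1) (mu0 : {measure set (S 0%N) -> \bar R}).
Hypothesis mu01 : mu0 setT = 1.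
(* [k n s] lives on the fibre of [pr] over [s]; fibres need not be measurable, hence
   this wording. *)
Hypothesis k_fiber : forall n s (f : S n.+1 -> \bar R), (forall x, 0 <= f x) ->
  measurable_fun setT f -> 0 < \int[k n s]_x f x -> exists2 x, pr x = s & 0 < f x.

Fixpoint it_marginal (n : nat) : {measure set (S n) -> \bar R} :=
  match n return {measure set (S n) -> \bar R} with
  | 0%N => mu0
  | m.+1 => mbind (it_marginal m) (k m)
  end.
Local Notation P := it_marginal.

(** By [k_fiber], the preimage of a set that avoids [s] is null; this is applied to [B] or to its
    complement. *)
Let k_pr n s B : measurable B -> k n s (@pr n @^-1` B) = (\1_B s)%:E.
Proof.
move=> mB.
have mpB C : measurable C -> measurable (@pr n @^-1` C).
  by move=> mC; rewrite -[X in measurable X]setTI; exact: mpr.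
have kC (C : set (S n)) : measurable C -> ~ C s -> k n s (@pr n @^-1` C) = 0.
  move=> mC nC; apply/eqP; rewrite eq_le measure_ge0 andbT leNgt; apply/negP => k0.
  have [] := @k_fiber n s (fun x => (\1_(@pr n @^-1` C) x)%:E).
  - by move=> x; rewrite lee_fin.
  - by apply/measurable_EFinP; apply: measurable_indic; exact: mpB.
  - by rewrite integral_indic ?setIT//; exact: mpB.
  move=> x prx; rewrite indicE; case: (boolP (x \in _)); rewrite ?ltxx// inE /= prx.
  by move=> /nC.
rewrite indicE; case: (boolP (s \in B)); last first.
  by rewrite notin_setE => nB; rewrite kC.
rewrite inE => Bs.
have kU : k n s (@pr n @^-1` B `|` @pr n @^-1` (~` B)) =
    k n s (@pr n @^-1` B) + k n s (@pr n @^-1` (~` B)).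
  apply: measureU; [exact: mpB|exact/mpB/measurableC|].
  by rewrite -preimage_setI setICr preimage_set0.
move: kU; rewrite -preimage_setU setUv preimage_setT prob_kernel.
by rewrite (kC (~` B)) ?adde0//; exact: measurableC.
Qed.

Let P_pr n B : measurable B -> P n.+1 (@pr n @^-1` B) = P n B.
Proof.
move=> mB; rewrite /= /mbind (eq_integral (fun s => (\1_B s)%:E)).
  by rewrite integral_indic// setIT.
by move=> s _; rewrite k_pr.
Qed.

Let P1 n : P n setT = 1.
Proof. elim: n => [|n ih]; first exact: mu01. by rewrite -ih -(@P_pr n setT measurableT) preimage_setT. Qed.

Definition at_level n (E : set Om) := exists2 B, measurable B & E = h n @^-1` B.

Let levelS n E : at_level n E -> at_level n.+1 E.
Proof.
move=> [B mB ->]; exists (@pr n @^-1` B).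
  by rewrite -[X in measurable X]setTI; exact: mpr.
by rewrite -comp_preimage; apply/seteqP; split => w /=; rewrite pr_h.
Qed.

Let level_le n m E : (n <= m)%N -> at_level n E -> at_level m E.
Proof.
move=> nm; rewrite -(subnK nm); elim: (m - n)%N => // j ih Ee.
by rewrite addSn; apply: levelS; exact: ih.
Qed.

Let h_inj n : injective (fun B : set (S n) => h n @^-1` B).
Proof.
move=> A B AB; apply/seteqP; split => s; have [w <-] := h_surj s.
  by move=> Aw; have : (h n @^-1` A) w by []; rewrite AB.
by move=> Aw; have : (h n @^-1` B) w by []; rewrite -AB.
Qed.

Let P_level n m (A : set (S n)) (B : set (S m)) : (n <= m)%N ->
  measurable A -> measurable B -> h n @^-1` A = h m @^-1` B -> P n A = P m B.
Proof.
move=> nm; move: B; rewrite -(subnK nm); elim: (m - n)%N => [|j ih] B mA mB.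
  by move=> hAB; have -> : A = B := h_inj hAB.
have [C mC CE] : at_level (j + n) (h n @^-1` A).
  by apply: (@level_le n) => //; [exact: leq_addl|exists A].
move=> AB; rewrite (ih C)//; have -> : B = @pr (j + n) @^-1` C.
  apply/(@h_inj (j + n).+1); rewrite -[LHS]AB CE.
  by apply/seteqP; split => w /=; rewrite pr_h.
by rewrite -P_pr.
Qed.

(** A cylinder has representations at many levels. By [P_level] they all have the same mass, so the
    infimum is taken over a singleton. *)
Definition it_content (E : set Om) : \bar R :=
  ereal_inf [set x | exists n B, [/\ measurable B, E = h n @^-1` B & x = P n B]].

Let it_contentE n B : measurable B -> it_content (h n @^-1` B) = P n B.
Proof.
move=> mB; rewrite /it_content [X in ereal_inf X](_ : _ = [set P n B]) ?ereal_inf1//.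
apply/seteqP; split => [_ [m [C [mC hBC ->]]]|_ ->] /=; last by exists n, B.
by have [nm|/ltnW mn] := leqP n m; [apply/esym|]; apply: P_level.
Qed.

Local Notation Cyl := (cyl_type h).

Let cylinder : set (set Cyl) := [set E | exists n, at_level n E].

Let level2 E F : cylinder E -> cylinder F -> exists n, at_level n E /\ at_level n F.
Proof.
move=> [n nE] [m mF]; exists (maxn n m); split.
  by apply: level_le nE; exact: leq_maxl.
by apply: level_le mF; exact: leq_maxr.
Qed.

Let levelU n E F : at_level n E -> at_level n F -> at_level n (E `|` F).
Proof. by move=> [A mA ->] [B mB ->]; exists (A `|` B) => //; exact: measurableU. Qed.

Let levelI n E F : at_level n E -> at_level n F -> at_level n (E `&` F).
Proof. by move=> [A mA ->] [B mB ->]; exists (A `&` B) => //; exact: measurableI. Qed.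

Let cylinder0 : cylinder set0.
Proof. by exists 0%N; exists set0 => //; rewrite preimage_set0. Qed.

Let cylinderU : setU_closed cylinder.
Proof. by move=> A B /level2 h2 /h2[n [? ?]]; exists n; exact: levelU. Qed.

Let cylinderC : setC_closed cylinder.
Proof. by move=> A [n [B mB ->]]; exists n, (~` B) => //; exact: measurableC. Qed.

HB.instance Definition _ := @isAlgebraOfSets.Build cyl_display Cyl
  cylinder cylinder0 cylinderU cylinderC.

Section continuity.
Variable B : forall n, set (S n).
Arguments B n : clear implicits.
Hypothesis mB : forall n, measurable (B n).
Hypothesis ndB : forall n, B n.+1 `<=` @pr n @^-1` B n.
Variable e : R.
Hypothesis e0 : (0 < e)%R.
Hypothesis eB : forall n, e%:E <= P n (B n).

(* [c n m s] is the probability of being in [B (n + m)] at time [n + m] when in [s] at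
   time [n]. Its limit [L] in [m] has positive integral, is harmonic along [k], and so
   stays positive along some path, which then lies in every [B n]. *)
Let Fixpoint c (n m : nat) {struct m} : S n -> \bar R :=
  match m with
  | 0%N => fun s => (\1_(B n) s)%:E
  | j.+1 => fun s => \int[k n s]_x @c n.+1 j x
  end.

Arguments c n m : clear implicits.

Let c_ge0 m n s : 0 <= c n m s.
Proof.
elim: m n s => [|m ih] n s /=; first by rewrite lee_fin.
by apply: integral_ge0.
Qed.

Let mc m n : measurable_fun setT (c n m).
Proof.
elim: m n => [|m ih] n /=.
  by apply/measurable_EFinP; exact: measurable_indic.
by apply: measurable_fun_integral_kernel => // U mU; exact: measurable_kernel.
Qed.

Let c_decr m n s : c n m.+1 s <= c n m s.
Proof.
elim: m n s => [|m ih] n s; last first.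
  apply: ge0_le_integral => // [x _||x _].
  - exact: (c_ge0 m.+1).
  - exact: (mc m.+1).
  - exact: ih.
rewrite /= integral_indic// setIT -k_pr//; apply: le_measure; rewrite ?inE//; last exact: ndB.
by rewrite -[X in measurable X]setTI; exact: mpr.
Qed.

Let c_noninc n s : nonincreasing_seq (fun m => c n m s).
Proof. by apply/nonincreasing_seqP => m; exact: c_decr. Qed.

Let c_le1 n m s : c n m s <= 1.
Proof.
apply: (@le_trans _ _ (c n 0 s)); first exact: c_noninc.
by rewrite /= lee_fin indicE; case: (_ \in _).
Qed.

Let e_c m n : e%:E <= \int[P n]_s c n m s.
Proof.
elim: m n => [|m ih] n /=; first by rewrite integral_indic// setIT.
by rewrite -integral_mbind//; exact: ih.
Qed.

Let L n s := limn (fun m => c n m s).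

Arguments L n : clear implicits.

Let cvgL n s : c n ^~ s @ \oo --> L n s.
Proof. by apply: ereal_nonincreasing_is_cvgn; exact: c_noninc. Qed.

Let L_ge0 n s : 0 <= L n s.
Proof. by apply: lime_ge; [exact: cvgL|exact: nearW]. Qed.

Let mL n : measurable_fun setT (L n).
Proof. exact: (emeasurable_fun_cvg _ _ (fun m => @mc m n) (fun s _ => @cvgL n s)). Qed.

Let int_L n (m : {measure set (S n) -> \bar R}) : m setT = 1 ->
  \int[m]_s c n j s @[j --> \oo] --> \int[m]_s L n s.
Proof.
move=> m1; apply: (@dominated_cvg _ _ _ m setT measurableT _ _ (cst 1)) => //.
- by apply/integrableP; split => //; under eq_integral do rewrite abse1;
    rewrite integral_cst// m1 mul1e ltry.
- by move=> j s _; rewrite gee0_abs.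
Qed.

Let L_next n s : L n s = \int[k n s]_x L n.+1 x.
Proof.
have h2 : (fun m => c n m.+1 s) @ \oo --> L n s.
  by rewrite (cvg_shiftS (fun m => c n m s)); exact: cvgL.
have h3 : (fun m => c n m.+1 s) @ \oo --> \int[k n s]_x L n.+1 x.
  by apply: int_L; exact: prob_kernel.
by rewrite -(cvg_lim _ h2)// -(cvg_lim _ h3).
Qed.

Let start : exists s, 0 < L 0 s.
Proof.
have eL : e%:E <= \int[P 0]_s L 0 s.
  rewrite -(cvg_lim _ (int_L (P1 0)))//; apply: lime_ge.
    by apply/cvg_ex; eexists; exact: (int_L (P1 0)).
  by apply: nearW => j; exact: e_c.
apply: contrapT => /forallNP L0.
move: eL; rewrite integral0_eq ?lee_fin ?leNgt ?e0// => s _.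
by apply/eqP; rewrite eq_le L_ge0 leNgt andbT; apply/negP/L0.
Qed.

Let next n s : 0 < L n s -> exists2 x, pr x = s & 0 < L n.+1 x.
Proof. by rewrite L_next => /k_fiber; apply. Qed.

Lemma it_nonempty : exists w, forall n, B n (h n w).
Proof.
pose A n := {s : S n | 0 < L n s}.
pose a0 : A 0%N := let s := cid start in exist _ (sval s) (svalP s).
pose step n (a : A n) : A n.+1 :=
  let x := cid2 (next (svalP a)) in exist _ (s2val x) (s2valP' x).
pose a := fix a n : A n := match n return A n with 0%N => a0 | m.+1 => step m (a m) end.
have [w wa] : exists w, forall n, h n w = sval (a n).
  by apply: h_lim => n /=; case: cid2.
exists w => n; rewrite wa.
have : 0 < c n 0 (sval (a n)).
  apply: (lt_le_trans (svalP (a n))); apply: lime_le; first exact: cvgL.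
  by apply: nearW => m; exact: c_noninc.
by rewrite /= lte_fin indicE; case: (boolP (_ \in _)); rewrite ?ltxx// inE.
Qed.

End continuity.

Let content0 : it_content (set0 : set Cyl) = 0.
Proof. by rewrite -(preimage_set0 (h 0)) it_contentE. Qed.

Let content_ge0 (E : set Cyl) : 0 <= it_content E.
Proof. by apply: le_ereal_inf_tmp => _ [n [B [_ _ ->]]]. Qed.

Let content_le (E F : set Cyl) : measurable E -> measurable F -> E `<=` F ->
  it_content E <= it_content F.
Proof.
move=> mE mF EF; have [n [[A mA AE] [B mB BE]]] := level2 mE mF.
rewrite AE BE !it_contentE//; apply: le_measure; rewrite ?inE// => s As.
have [w ws] := h_surj s; subst s.
by have : F w by [apply: EF; rewrite AE]; rewrite BE.
Qed.

Let content_add (E F : set Cyl) : measurable E -> measurable F -> E `&` F = set0 ->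
  it_content (E `|` F) = it_content E + it_content F.
Proof.
move=> mE mF EF; have [n [[A mA AE] [B mB BE]]] := level2 mE mF.
rewrite AE BE -preimage_setU !it_contentE//; last exact: measurableU.
rewrite measureU//; apply: (@h_inj n); rewrite preimage_setI -AE -BE EF.
by rewrite preimage_set0.
Qed.

(** Otherwise all [E n] have content at least [e], and [it_nonempty] produces a point common to all
    of them. *)
Let content_continuous (E : nat -> set Cyl) : (forall n, measurable (E n)) ->
  (forall n, E n.+1 `<=` E n) -> \bigcap_n E n = set0 ->
  forall e : R, (0 < e)%R -> exists n, it_content (E n) < e%:E.
Proof.
move=> mE ndE E0 e e0; apply: contrapT => /forallNP Ee.
have {}Ee n : e%:E <= it_content (E n) by rewrite leNgt; apply/negP/Ee.
have /choice[N NE] n : exists N, at_level N (E n) by exact: mE.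
have ndE' i j : (i <= j)%N -> E j `<=` E i.
  move=> ij; rewrite -(subnK ij); elim: (j - i)%N => // l ih.
  by rewrite addSn; exact: (subset_trans (@ndE _)).
(* The level of [E i] is an arbitrary [N i]. At stage [j] only the sets of index and level at most
   [j] are intersected, so that [E' j] has level [j]; it still contains [E j], hence has content at
   least [e]. *)
pose E' (j : nat) : set Cyl := \big[setI/setT]_(i <- iota 0 j.+1 | (N i <= j)%N) E i.
have E'P j w : E' j w <-> forall i : nat, (i <= j)%N -> (N i <= j)%N -> E i w.
  rewrite /E' -bigcap_seq_cond; split => [H i ij Nij|H i].
    by apply: H; rewrite /mkset mem_iota ltnS ij Nij.
  by rewrite /mkset mem_iota ltnS => /andP[ij Nij]; exact: H.
have levE' j : at_level j (E' j).
  rewrite /E'; elim/big_ind : _ => [|? ?|i Nij]; last exact: level_le (NE i).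
    by exists setT => //; rewrite preimage_setT.
  exact: levelI.
have [B mBE] : exists B : forall j, set (S j),
    forall j, measurable (B j) /\ E' j = h j @^-1` B j.
  pose B j := let: ex := cid2 (levE' j) in s2val ex.
  by exists B => j; rewrite /B; case: cid2.
have [w wB] : exists w, forall n, B n (h n w).
  apply: (@it_nonempty B _ _ e) => //.
  - by move=> n; have [] := mBE n.
  - move=> n s Bs; have [w ws] := h_surj s; subst s.
    have : E' n.+1 w by have [_ ->] := mBE n.+1.
    move/E'P => Hw; rewrite /preimage/= pr_h.
    suff : E' n w by have [_ ->] := mBE n.
    by apply/E'P => i ij Nij; apply: Hw; exact: leqW.
  - move=> n; have [mBn En] := mBE n; rewrite -it_contentE// -En.
    apply: (le_trans (Ee n)); apply: content_le => //; first by exists n.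
    by move=> w Ew; apply/E'P => i ij _; exact: ndE' Ew.
suff : (\bigcap_n E n) w by rewrite E0.
move=> i _; have : E' (maxn i (N i)) w by have [_ ->] := mBE (maxn i (N i)).
by move/E'P; apply; [exact: leq_maxl|exact: leq_maxr].
Qed.

(** The remainders of the union after [n] terms decrease to the empty set, so their contents become
    arbitrarily small. *)
Let content_sigma : semi_sigma_additive (it_content : set Cyl -> \bar R).
Proof.
move=> F mF tF mUF.
pose G n := \big[setU/set0]_(i < n) F i.
have mG n : measurable (G n) by exact: bigsetU_measurable.
have cG n : it_content (G n) = \sum_(0 <= i < n) it_content (F i).
  elim: n => [|n ih]; first by rewrite /G big_ord0 big_geq// content0.
  have -> : G n.+1 = G n `|` F n by rewrite /G big_ord_recr.
  rewrite content_add//; last first.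
    rewrite /G -bigcup_mkord; apply/seteqP; split => // w [[i /= ni Fi] Fn].
    have ie : i = n by apply: tF => //; exists w.
    by rewrite ie ltnn in ni.
  by rewrite big_nat_recr//= -ih.
pose E n := (\bigcup_n F n) `\` G n.
have mE n : measurable (E n) by exact: measurableD.
have GU n : G n `<=` \bigcup_n F n.
  by rewrite /G -bigcup_mkord; apply: bigcup_sub => i _; exact: bigcup_sup.
have cE n : it_content (\bigcup_n F n) = it_content (G n) + it_content (E n).
  rewrite -content_add//; last by apply/seteqP; split => // w [? []].
  by rewrite /E setDUK.
have ndE n : E n.+1 `<=` E n.
  by apply: setDS; rewrite /G big_ord_recr/=; exact: subsetUl.
have E0 : \bigcap_n E n = set0.
  apply/seteqP; split => // w Ew; have [[i _ Fi] _] := Ew 0%N Logic.I.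
  have [_] := Ew i.+1 Logic.I; apply.
  by rewrite /G big_ord_recr/=; right.
have cvF := @is_cvg_nneseries R (it_content \o F) predT 0%N (fun n _ _ => content_ge0 (F n)).
suff <- : \sum_(0 <= i <oo) it_content (F i) = it_content (\bigcup_n F n) by exact: cvF.
apply/eqP; rewrite eq_le; apply/andP; split.
  by apply: lime_le => //; apply: nearW => n; rewrite -cG; exact: content_le.
apply/lee_addgt0Pr => e e0.
have [n En] := content_continuous mE ndE E0 e0.
rewrite (cE n); apply: leeD; last exact: ltW.
rewrite cG. have := (@nneseries_lim_ge R (it_content \o F) predT 0%N n (fun n _ _ => content_ge0 (F n))); exact.
Qed.

HB.instance Definition _ := isMeasure.Build _ _ _
  (it_content : set Cyl -> \bar R) content0 content_ge0 content_sigma.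

(** The countably additive content of cylinders has a Caratheodory extension. The family [G] may
    generate a smaller sigma-algebra than the cylinders do, hence the transport along the
    identity. *)
Theorem ionescu_tulcea (G : set (set Om)) : (forall E, G E -> exists n, at_level n E) ->
  exists P : {measure set (g_sigma_algebraType G) -> \bar R},
    forall n B, measurable B -> P (h n @^-1` B) = it_marginal n B.
Proof.
move=> G_level; pose Om' := g_sigma_algebraType (@measurable _ Cyl).
have mid : measurable_fun [set: Om'] (id : Om' -> g_sigma_algebraType G).
  apply: (measurability (G : set (set (g_sigma_algebraType G)))) => //.
  by move=> _ [E GE <-]; rewrite setTI; apply: sub_sigma_algebra; exact: G_level.
exists (mpush (measure_extension (it_content : {measure set Cyl -> \bar R})) mid) => n B mB.
rewrite mpushE -it_contentE//.
apply: (measurable_mu_extE (it_content : {measure set Cyl -> \bar R})).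
by exists n, B.
Qed.

End ionescu_tulcea.

Section mk_probability.
Local Open Scope ereal_scope.
Context d (T : measurableType d) (R : realType).
Variables (m : {measure set T -> \bar R}) (m1 : m setT = 1).

Definition mk_probability_fun (_ : m setT = 1) : set T -> \bar R := m.

HB.instance Definition _ := Measure.on (mk_probability_fun m1).
HB.instance Definition _ := Measure_isProbability.Build _ _ _ (mk_probability_fun m1) m1.

Definition mk_probability : probability T R := mk_probability_fun m1.

End mk_probability.

Section trajectories.
Context (dX : measure_display) (X : measurableType dX) (A : ptopologicalType).
Local Notation Tr := (trajectory X A).

Lemma measurable_coordinate n : measurable_fun [set: Tr] (fun w : Tr => w n).
Proof.
move=> _ B mB; rewrite setTI; apply: sub_sigma_algebra.
by exists n, B.
Qed.

Lemma measurable_state n : measurable_fun [set: Tr] (state n).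
Proof. exact: (measurableT_comp measurable_fst (measurable_coordinate n)). Qed.

Lemma measurable_action n : measurable_fun [set: Tr] (action n).
Proof. exact: (measurableT_comp measurable_snd (measurable_coordinate n)). Qed.

Lemma measurable_history n : measurable_fun [set: Tr] (history n).
Proof.
elim: n => [|n ih] /=; first exact: measurable_state.
apply: measurable_fun_pair; last exact: measurable_state.
by apply: measurable_fun_pair => //; exact: measurable_action.
Qed.

Lemma measurable_last_state n : measurable_fun [set: hist X A n] (@last_state _ X A n).
Proof. by case: n => [|n] /=; [exact: measurable_id|exact: measurable_snd]. Qed.

Lemma last_state_history n w : last_state (@history _ X A n w) = state n w.
Proof. by case: n. Qed.

Lemma eq_history n (w w' : Tr) : (forall i, (i < n)%N -> w i = w' i) ->
  state n w = state n w' -> history n w = history n w'.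
Proof.
elim: n => [|n ih] /= ww' sww'; first exact: sww'.
rewrite ih; last 2 first.
- by move=> i ni; apply: ww'; exact: ltnW.
- by rewrite /state ww'.
by rewrite sww' /action ww'.
Qed.

Lemma history_surj n (s : hist X A n) : exists w, history n w = s.
Proof.
elim: n s => [x|n ih [[s a] x]] /=; first by exists (fun=> (x, point)).
have [w ws] := ih s.
pose w' i := if (i < n)%N then w i else if i == n then (state n w, a) else (x, a).
exists w'; rewrite /action /state /w' ltnn eqxx ltnNge leqnSn/= -[n.+1 == n]/(_) gtn_eqF//=.
rewrite -ws; congr (_, _, _); apply: eq_history => [i ->//|].
by rewrite /state ltnn eqxx.
Qed.

Lemma history_lim (s : forall n, hist X A n) : (forall n, (s n.+1).1.1 = s n) ->
  exists w, forall n, history n w = s n.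
Proof.
move=> hs; exists (fun n => (last_state (s n), (s n.+1).1.2)).
elim=> //= n ->; rewrite /action /state /=.
by rewrite -[in LHS](hs n); case: (s n.+1) => [[]].
Qed.

End trajectories.

Section strategic_exists.
Local Open Scope ereal_scope.
Context (R : realType) (dX : measure_display) (X : measurableType dX)
  (A : ptopologicalType) (d : nat).
Variables (M : control_model R X A d) (p : policy M).
Local Notation Tr := (trajectory X A).
Local Notation H := (hist X A).

Let state_action n (ha : H n * borel A) : X * borel A := (last_state ha.1, ha.2).

Let measurable_state_action n : measurable_fun setT (@state_action n).
Proof.
apply: measurable_fun_pair => //=.
exact: (measurableT_comp (@measurable_last_state _ X A n) measurable_fst).
Qed.

Definition transition_of n : R.-pker (H n * borel A)%type ~> X :=
  kreindex (trans M) (@measurable_state_action n).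

Let step n : R.-pker H n ~> H n.+1 := kbind (kgraph (pol p n)) (kgraph (transition_of n)).

Let integral_step n s (f : H n.+1 -> \bar R) : (forall x, 0 <= f x) ->
  measurable_fun setT f ->
  \int[step n s]_x f x =
  \int[pol p n s]_a \int[trans M (last_state s, a)]_x f (s, a, x).
Proof.
move=> f0 mf; rewrite integral_kbind// integral_kgraph//.
- by apply: eq_integral => a _; rewrite integral_kgraph.
- by move=> x; exact: integral_ge0.
- apply: measurable_fun_integral_kernel => // U mU.
  exact: measurable_kernel.
Qed.

Let prev n (s : H n.+1) : H n := s.1.1.

(** The histories are the stages of [ionescu_tulcea], and [prev] drops the last action and state. A
    step appends an action and a state to the history from which it starts, which gives the fibre
    condition. *)
Lemma strategic_exists : exists P, is_strategic p P.
Proof.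
have mprev n : measurable_fun setT (@prev n).
  exact: (measurableT_comp measurable_fst measurable_fst).
have fiber n s (f : H n.+1 -> \bar R) : (forall x, 0 <= f x) ->
    measurable_fun setT f -> 0 < \int[step n s]_x f x ->
    exists2 x, prev x = s & 0 < f x.
  move=> f0 mf; apply: contraPP => nf; rewrite integral_step//.
  rewrite integral0_eq ?ltxx// => a _; rewrite integral0_eq// => x _.
  apply/eqP; rewrite eq_le f0 andbT leNgt; apply/negP => fx; apply: nf.
  by exists (s, a, x).
have [P0 P0E] : exists P0 : {measure set Tr -> \bar R}, forall n B,
    measurable B -> P0 (@history _ X A n @^-1` B) = @it_marginal R _ H step (init M) n B.
  have := @ionescu_tulcea R (nat -> X * borel A)%type _ H (@history _ X A) prev mprev
    (fun=> fun=> erefl) (@history_lim _ X A) (@history_surj _ X A) step (init M)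
    (@probability_setT _ _ _ (init M)) fiber (@coordinate_cylinders _ X A).
  apply.
  move=> _ [n [B [mB ->]]].
  (* The action at time [n] is recorded only in the history of index [n.+1]. *)
  exists n.+1; exists [set s : H n.+1 | B (last_state s.1.1, s.1.2)].
    rewrite -[X in measurable X]setTI.
    have : measurable_fun setT (fun s : H n.+1 => @state_action n s.1).
      exact: (measurableT_comp (@measurable_state_action n) measurable_fst).
    exact.
  by apply/seteqP; split => w /=; rewrite last_state_history /state /action -surjective_pairing.
have PE1 : P0 setT = 1.
  rewrite -[1](@probability_setT _ _ _ (init M)).
  by rewrite -(P0E 0%N setT measurableT).
pose P : probability Tr R := mk_probability PE1.
have PE n B : measurable B -> P (history n @^-1` B) = @it_marginal R _ H step (init M) n B.
  exact: P0E.
have PI n (f : H n -> \bar R) : (forall x, 0 <= f x) -> measurable_fun setT f ->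
    \int[P]_w f (history n w) = \int[@it_marginal R _ H step (init M) n]_s f s.
  move=> f0 mf; rewrite -(integral_mpush P (@measurable_history _ X A n))//.
  by apply: eq_integral_measure => B mB; exact: (PE n B mB).
have c1 n : conditional_law P (history n) (action n) (fun h => pol p n h).
  move=> B C mB mC.
  pose D : set (H n.+1) := [set s | B s.1.1 /\ C s.1.2].
  have mD : measurable D.
    have -> : D = (B `*` C) `*` setT by apply/seteqP; split => -[[s a] x] => [[/= ? ?]|[[/= ? ?] _]].
    by apply: measurableX => //; exact: measurableX.
  transitivity (P (history n.+1 @^-1` D)); first by congr (P _).
  rewrite PE//= /mbind [RHS]integral_mkcond -PI//; last exact: measurable_kernel.
  apply: eq_integral => w _; rewrite patchE.
  rewrite [LHS]measure_as_integral// integral_step//; last exact/measurable_EFinP/measurable_indic.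
  case: ifPn => [|]; rewrite ?notin_setE ?inE => Bw.
    rewrite [RHS]measure_as_integral//; apply: eq_integral => a _.
    rewrite (eq_integral (cst (\1_C a)%:E)).
      by rewrite integral_cst// prob_kernel mule1.
    by move=> x _; rewrite /D !indicE /=; congr ((_ : bool)%:R%:E); apply/idP/idP;
      rewrite !inE/=; tauto.
  rewrite integral0_eq// => a _; rewrite integral0_eq// => x _.
  by rewrite indicE memNset//= => -[].
exists P; split => //.
- by move=> B mB; rewrite -[LHS]/(P (history 0 @^-1` B)) PE.
- move=> n B C mB mC.
  transitivity (P (history n.+1 @^-1` (B `*` C))); first by congr (P _).
  have mBC := measurableX mB mC.
  rewrite PE//= /mbind [RHS]integral_mkcond.
  pose F : H n * borel A -> \bar R := (fun ha => trans M (last_state ha.1, ha.2) C) \_ B.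
  have mF : measurable_fun setT F.
    apply/measurable_restrict => //; rewrite ?setTI//.
    apply: measurable_funTS; exact: (measurable_kernel (transition_of n)).
  have F0 x : 0 <= F x by rewrite /F patchE; case: ifP.
  transitivity (\int[P]_w F (history n w, action n w)); last first.
    by apply: eq_integral => w _; rewrite /F !patchE; congr (if _ then _ else _);
      apply/idP/idP; rewrite !inE.
  rewrite (integral_conditional_law _ _ (c1 n))//; last 2 first.
  - exact: measurable_history.
  - exact: measurable_action.
  rewrite -PI//; last exact: measurable_kernel.
  apply: eq_integral => w _.
  rewrite [LHS]measure_as_integral// integral_step//; last exact/measurable_EFinP/measurable_indic.
  apply: eq_integral => a _; rewrite /F patchE; case: ifPn => [|]; rewrite ?notin_setE ?inE => Bw.
    rewrite [RHS]measure_as_integral//; apply: eq_integral => x _.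
    by rewrite !indicE; congr ((_ : bool)%:R%:E); apply/idP/idP; rewrite !inE/=; tauto.
  rewrite integral0_eq// => x _; by rewrite indicE memNset//= => -[].
Qed.

Lemma strategicP : is_strategic p (strategic p).
Proof. exact: (xgetPex _ strategic_exists). Qed.

End strategic_exists.

(** * Convex sets in finite dimension *)

Section lexicographic_separation.
Context (R : realType).

Fixpoint lexge (s : seq R) : bool :=
  if s is x :: s' then (0 < x) || ((x == 0) && lexge s') else true.

Definition convex_set n (C : set 'rV[R]_n) := forall u v (t : R),
  C u -> C v -> 0 <= t -> t <= 1 -> C (t *: u + (1 - t) *: v).

Section total_cone.
Variables (n : nat) (K : set 'rV[R]_n.+1).
Hypothesis K0 : K 0.
Hypothesis KD : forall u v, K u -> K v -> K (u + v).
Hypothesis KZ : forall (t : R) u, 0 <= t -> K u -> K (t *: u).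
Hypothesis Kpointed : forall u, K u -> K (- u) -> u = 0.
Hypothesis Ktotal : forall u, K u \/ K (- u).

(* [unit_e] is an order unit, and [c u] is the largest [q] with [q *: unit_e] below [u]:
   it is linear and nonnegative on [K]. *)
Let sg (i : 'I_n.+1) : R := if pselect (K (delta_mx 0 i)) then 1 else -1.

Let Ksg i : K (sg i *: delta_mx 0 i).
Proof.
rewrite /sg; case: pselect => [Ki|nK] /=; first by rewrite scale1r.
by rewrite scaleN1r; case: (Ktotal (delta_mx 0 i)).
Qed.

Let sgK i : sg i * sg i = 1.
Proof. by rewrite /sg; case: pselect => /= Ki; rewrite ?mulr1// mulN1r opprK. Qed.

Let Ksum (I : Type) (r : seq I) (P : pred I) (F : I -> 'rV[R]_n.+1) :
  (forall i, P i -> K (F i)) -> K (\sum_(i <- r | P i) F i).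
Proof. by move=> KF; elim/big_ind : _. Qed.

Let unit_e : 'rV[R]_n.+1 := \sum_i sg i *: delta_mx 0 i.

Let Ke : K unit_e. Proof. by apply: Ksum => i _; exact: Ksg. Qed.

Let e_neq0 : unit_e != 0.
Proof.
apply/eqP => /rowP /(_ ord0); rewrite summxE (bigD1 ord0)//= !mxE !eqxx mulr1 big1.
  by rewrite addr0 => s0; have := sgK ord0; rewrite s0 mulr0 => /esym/eqP; rewrite oner_eq0.
by move=> i i0; rewrite !mxE (eq_sym ord0) (negbTE i0) andbF mulr0.
Qed.

Let bounded_by_e u : exists Q : R, K (Q *: unit_e - u).
Proof.
exists (\sum_i `|u ord0 i|); rewrite scaler_sumr [X in _ - X](row_sum_delta u) -sumrB.
apply: Ksum => i _.
have -> : u ord0 i *: delta_mx 0 i = (u ord0 i * sg i) *: (sg i *: delta_mx 0 i) :> 'rV[R]_n.+1.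
  by rewrite scalerA -mulrA sgK mulr1.
rewrite -scalerBl; apply: KZ (Ksg i); rewrite subr_ge0.
apply: (@le_trans _ _ `|u ord0 i|); last first.
  by rewrite (bigD1 i)//= lerDl sumr_ge0.
rewrite /sg; case: pselect => /= Ki; rewrite ?mulr1 ?mulrN1 ?ler_norm//.
by rewrite -normrN ler_norm.
Qed.

Let cut u : set R := [set q | K (u - q *: unit_e)].

Let cut_ub u Q : K (Q *: unit_e - u) -> ubound (cut u) Q.
Proof.
move=> KQ q /= Kq; rewrite leNgt; apply/negP => Qq.
have := KD KQ Kq; rewrite addrA subrK -scalerBl => KQq.
have q0 : 0 < q - Q by rewrite subr_gt0.
have : K (- unit_e).
  rewrite -[- _]scale1r -(mulVf (lt0r_neq0 q0)) -scalerA; apply: KZ.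
    by rewrite invr_ge0 ltW.
  by rewrite scalerN -scaleNr opprB.
by move=> /(Kpointed Ke) /eqP; rewrite (negbTE e_neq0).
Qed.

Let has_sup_cut u : has_sup (cut u).
Proof.
split; last by have [Q KQ] := bounded_by_e u; exists Q; exact: cut_ub.
have [Q KQ] := bounded_by_e (- u); exists (- Q); rewrite /cut/= scaleNr opprK addrC.
by rewrite opprK in KQ.
Qed.

Let c u : R := sup (cut u).

Let lt_c u q : q < c u -> K (u - q *: unit_e).
Proof.
move=> /(sup_gt (has_sup_cut u).1)[q' Kq' qq'].
have -> : u - q *: unit_e = (u - q' *: unit_e) + (q' - q) *: unit_e.
  by rewrite scalerBl addrA subrK.
by apply: KD => //; apply: KZ => //; rewrite subr_ge0 ltW.
Qed.

Let gt_c u q : c u < q -> K (q *: unit_e - u).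
Proof.
move=> cq; have [Kq|] := Ktotal (u - q *: unit_e); last by rewrite opprB.
by move: cq; rewrite ltNge ub_le_sup//; exact: (has_sup_cut u).2.
Qed.

Let le_c u q : K (u - q *: unit_e) -> q <= c u.
Proof. by move=> Kq; apply: ub_le_sup => //; exact: (has_sup_cut u).2. Qed.

Let ge_c u q : K (q *: unit_e - u) -> c u <= q.
Proof. by move=> Kq; apply: ge_sup; [exact: (has_sup_cut u).1|exact: cut_ub]. Qed.

Let cD u v : c (u + v) = c u + c v.
Proof.
apply/eqP; rewrite eq_le; apply/andP; split.
  apply/ler_addgt0Pr => e e0; have e20 : 0 < e / 2 by rewrite divr_gt0.
  rewrite [e]splitr addrACA; apply: ge_c; rewrite scalerDl opprD addrACA.
  by apply: KD; apply: gt_c; rewrite ltrDl.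
apply/ler_addgt0Pr => e e0; have e20 : 0 < e / 2 by rewrite divr_gt0.
rewrite -lerBlDr [e]splitr opprD addrACA; apply: le_c; rewrite scalerDl opprD addrACA.
by apply: KD; apply: lt_c; rewrite gtrBl.
Qed.

Let cZ_ge0 t u : 0 <= t -> c (t *: u) = t * c u.
Proof.
rewrite le_eqVlt => /predU1P[<-|t0].
  rewrite mul0r scale0r; have := cD 0 0; rewrite addr0 => /eqP.
  by rewrite -subr_eq0 opprD addrA subrr sub0r oppr_eq0 => /eqP.
apply/eqP; rewrite eq_le; apply/andP; split; apply/ler_addgt0Pr => e e0;
  have et0 : 0 < e / t by rewrite divr_gt0.
  have -> : t * c u + e = t * (c u + e / t) by rewrite mulrDr mulrCA divff ?gt_eqF// mulr1.
  apply: ge_c; rewrite -scalerA -scalerBr; apply: KZ; first exact: ltW.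
  by apply: gt_c; rewrite ltrDl.
rewrite -lerBlDr.
have -> : t * c u - e = t * (c u - e / t) by rewrite mulrBr mulrCA divff ?gt_eqF// mulr1.
apply: le_c; rewrite -scalerA -scalerBr; apply: KZ; first exact: ltW.
by apply: lt_c; rewrite gtrBl.
Qed.

Let cN u : c (- u) = - c u.
Proof.
by apply/eqP; rewrite -addr_eq0 -cD addNr -(scale0r 0) cZ_ge0// mul0r.
Qed.

Let cZ t u : c (t *: u) = t * c u.
Proof.
have [t0|t0] := leP 0 t; first exact: cZ_ge0.
rewrite -[t]opprK scaleNr cN cZ_ge0 ?mulNr// oppr_ge0; exact: ltW.
Qed.

Lemma total_cone_functional : exists2 f : 'cV[R]_n.+1, f != 0 &
  forall u, K u -> 0 <= (u *m f) 0 0.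
Proof.
pose f : 'cV[R]_n.+1 := \col_i c (delta_mx 0 i).
have fE u : (u *m f) 0 0 = c u.
  rewrite [in RHS](row_sum_delta u) mxE (eq_bigr (fun i => c (u 0 i *: delta_mx 0 i))).
    have c0 : c 0 = 0 by rewrite -(scale0r 0) cZ mul0r.
    by rewrite (big_morph c cD c0).
  by move=> i _; rewrite mxE cZ.
exists f; last by move=> u Ku; rewrite fE; apply: le_c; rewrite scale0r subr0.
apply/eqP => f0; have := fE unit_e; rewrite f0 mulmx0 mxE => /esym/eqP.
rewrite gt_eqF// (lt_le_trans ltr01)//.
by apply: le_c; rewrite scale1r subrr.
Qed.

End total_cone.

(* [C] need not be closed, so that one functional does not suffice. If a line meets the cone
   spanned by [C] only at the origin, project along it; otherwise this cone is total, hence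
   in a half-space [0 <= f], and it remains to separate the part of [C] in the kernel of [f]. *)
Lemma lexicographic_separation n (C : set 'rV[R]_n) : convex_set C -> ~ C 0 ->
  exists cs : seq 'cV[R]_n, forall u, C u -> ~~ lexge [seq (u *m c) 0 0 | c <- cs].
Proof.
move: C; have [N nN] := ubnP n; elim: N n nN => // N IH [|n] nN C convC C0.
  by exists [::] => u Cu; exfalso; apply: C0; rewrite -(thinmx0 u).
pose cone : set 'rV[R]_n.+1 := [set w | exists t u, [/\ 0 < t, C u & w = t *: u]].
have [[w [w0 wK wNK]]|allK] :=
    pselect (exists w, [/\ w != 0, ~ cone w & ~ cone (- w)]).
  (* The kernel of multiplication by [Q] is the line of [w], so that [Q] projects along this line
     onto one dimension less. *)
  pose Q := col_base (cokermx w).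
  have rkQ : (\rank (cokermx w) < N)%N.
    by rewrite mxrank_coker rank_rV w0 subn1.
  pose C' : set 'rV[R]_(\rank (cokermx w)) := [set u *m Q | u in C].
  have kerQ u : u *m Q = 0 -> exists s, u = s *: w.
    move=> uQ; apply/sub_rVP; rewrite submxE -(mulmx_base (cokermx w)) mulmxA.
    by rewrite uQ mul0mx.
  have convC' : convex_set C'.
    move=> _ _ t [u Cu <-] [v Cv <-] t0 t1; exists (t *: u + (1 - t) *: v).
      exact: convC.
    by rewrite mulmxDl -!scalemxAl.
  have C'0 : ~ C' 0.
    move=> [u Cu /kerQ[s us]]; have [s0|s0|s0] := ltgtP s 0.
    - apply: wNK; exists (- s^-1), u; split; [by rewrite oppr_gt0 invr_lt0|by []|].
      by rewrite us scaleNr scalerA mulVf ?lt_eqF// scale1r.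
    - apply: wK; exists s^-1, u; split; [by rewrite invr_gt0|by []|].
      by rewrite us scalerA mulVf ?gt_eqF// scale1r.
    - by apply: C0; move: Cu; rewrite us s0 scale0r.
  have [cs csP] := IH _ rkQ _ convC' C'0.
  exists [seq Q *m c | c <- cs] => u Cu; rewrite -map_comp.
  rewrite (eq_map (g := fun c => (u *m Q *m c) 0 0)); last by move=> c /=; rewrite mulmxA.
  by apply: csP; exists u.
(* The strict multiples in [cone] leave out the origin, which has to be added. *)
pose K : set 'rV[R]_n.+1 := [set w | w = 0 \/ cone w].
have coneD u v : cone u -> cone v -> cone (u + v).
  move=> [s [x [s0 Cx ->]]] [t [y [t0 Cy ->]]]; have st0 := addr_gt0 s0 t0.
  exists (s + t), ((s / (s + t)) *: x + (1 - s / (s + t)) *: y); split => //.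
    apply: convC => //; first by rewrite divr_ge0// ltW.
    by rewrite ler_pdivrMr// mul1r lerDl ltW.
  have -> : 1 - s / (s + t) = t / (s + t).
    by apply/eqP; rewrite subr_eq -mulrDl addrC divff// gt_eqF.
  by rewrite scalerDr !scalerA ![(s + t) * _]mulrC !divfK// gt_eqF.
have cone0 : ~ cone 0.
  move=> [t [u [t0 Cu /esym/eqP]]]; rewrite scaler_eq0 gt_eqF//= => /eqP u0.
  by apply: C0; rewrite -u0.
have [f f0 fK] : exists2 f : 'cV[R]_n.+1, f != 0 & forall u, K u -> 0 <= (u *m f) 0 0.
  apply: total_cone_functional.
  - by left.
  - move=> u v [->|Ku] [->|Kv]; rewrite ?add0r ?addr0.
    + by left.
    + by right.
    + by right.
    + by right; exact: coneD.
  - move=> t u; rewrite le_eqVlt => /predU1P[<- _|t0 [->|[s [x [s0 Cx ->]]]]].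
    + by left; rewrite scale0r.
    + by left; rewrite scaler0.
    + by right; exists (t * s), x; split; [exact: mulr_gt0| |rewrite scalerA].
  - move=> u [//|Ku] [/eqP|Ku']; first by rewrite oppr_eq0 => /eqP.
    by exfalso; apply: cone0; rewrite -(subrr u); exact: coneD.
  - move=> u; have [->|u0] := eqVneq u 0; first by left; left.
    have [Ku|nKu] := pselect (cone u); first by left; right.
    right; right; apply: contrapT => nKu'; apply: allK; by exists u.
(* Coordinates on the kernel of [f]; the dimension drops because [f] is nonzero. *)
pose B := row_base (kermx f).
have rkB : (\rank (kermx f) < N)%N.
  by rewrite mxrank_ker -mxrank_tr rank_rV -[_ == 0]trmx_eq0 trmxK f0 subn1.
pose C' : set 'rV[R]_(\rank (kermx f)) := [set y | C (y *m B)].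
have convC' : convex_set C'.
  by move=> u v t Cu Cv t0 t1; rewrite /C'/= mulmxDl -!scalemxAl; exact: convC.
have C'0 : ~ C' 0 by rewrite /C'/= mul0mx.
have [cs csP] := IH _ rkB _ convC' C'0.
(* On [C] the leading functional [- f] is at most 0. Where it is negative the comparison is already
   decided; where it vanishes [u] lies in the kernel and the functionals found there decide. *)
exists (- f :: [seq pinvmx B *m c | c <- cs]) => u Cu /=.
have nE : (u *m - f) 0 0 = - (u *m f) 0 0 by rewrite mulmxN mxE.
have Ku : K u by right; exists 1, u; split => //; rewrite scale1r.
have uf := fK u Ku; rewrite nE oppr_gt0 oppr_eq0 ltNge uf/= negb_and; case: eqP => //= uf0.
have uB : (u <= B)%MS.
  rewrite eq_row_base; apply/sub_kermxP; apply/matrixP => i j.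
  by rewrite !ord1 uf0 mxE.
rewrite -map_comp (eq_map (g := fun c => (u *m pinvmx B *m c) 0 0)).
  by apply: csP; rewrite /C'/= mulmxKpV.
by move=> c /=; rewrite mulmxA.
Qed.

End lexicographic_separation.

Section convex_hull.
Context (R : realType) (d : nat) (T : Type) (J : T -> 'rV[R]_d).

Definition convex_comb n (v : 'rV[R]_d) (x : 'I_n -> T) (a : 'I_n -> R) :=
  [/\ forall i, 0 <= a i, \sum_i a i = 1 & v = \sum_i a i *: J (x i)].

Definition hull (D : set T) : set 'rV[R]_d :=
  [set v | exists n (x : 'I_n -> T) a, (forall i, D (x i)) /\ convex_comb v x a].

Lemma convex_hull (D : set T) : convex_set (hull D).
Proof.
move=> _ _ t [n [x [a [Dx [a0 a1 ->]]]]] [m [y [b [Dy [b0 b1 ->]]]]] t0 t1.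
exists (n + m)%N, (fun i => match fintype.split i with inl j => x j | inr j => y j end),
  (fun i => match fintype.split i with inl j => t * a j | inr j => (1 - t) * b j end).
have E1 (V : zmodType) (F : 'I_n -> V) (G : 'I_m -> V) :
    \sum_(i < n + m) match fintype.split i with inl j => F j | inr j => G j end =
    \sum_i F i + \sum_j G j.
  rewrite big_split_ord /=; congr (_ + _); apply: eq_bigr => i _.
    by rewrite (unsplitK (inl i)).
  by rewrite (unsplitK (inr i)).
split; first by move=> i; case: fintype.split.
split.
- by move=> i; case: fintype.split => j; rewrite mulr_ge0// subr_ge0.
- by rewrite E1 -!mulr_sumr a1 b1 !mulr1 addrCA subrr addr0.
- transitivity (\sum_(i < n + m) match fintype.split i with
    inl j => (t * a j) *: J (x j) | inr j => ((1 - t) * b j) *: J (y j) end).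
    by rewrite E1 !scaler_sumr; congr (_ + _); apply: eq_bigr => i _; rewrite scalerA.
  by apply: eq_bigr => i _; case: (fintype.split i).
Qed.

(** More than [d.+1] points are affinely dependent: a row [l] annihilates the vectors [J (x i)]
    extended by 1. Subtracting from [a] the largest multiple of [l] that keeps the weights
    nonnegative makes one weight vanish. *)
Let caratheodory_reduce n (v : 'rV[R]_d) (x : 'I_n.+1 -> T) a : (d.+1 < n.+1)%N ->
  convex_comb v x a -> exists (f : 'I_n -> 'I_n.+1) b, convex_comb v (x \o f) b.
Proof.
move=> dn [a0 a1 va].
pose U : 'M[R]_(n.+1, d + 1) := \matrix_i row_mx (J (x i)) (1%:M).
have : kermx U != 0.
  rewrite -mxrank_eq0 mxrank_ker -lt0n subn_gt0 (leq_ltn_trans (rank_leq_col _))//.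
  by rewrite addn1.
move=> /rowV0Pn[l /sub_kermxP lU l0].
have lUE : \sum_i l 0 i *: row_mx (J (x i)) (1%:M : 'M[R]_1) = 0.
  transitivity (l *m U) => //; rewrite mulmx_sum_row.
  by apply: eq_bigr => i _; rewrite rowK.
have l1 : \sum_i l 0 i = 0.
  move/(congr1 rsubmx): lUE; rewrite linear_sum/= linear0 => /matrixP/(_ 0 0).
  rewrite summxE [X in _ = X]mxE => h; rewrite -[RHS]h; apply: eq_bigr => i _.
  by rewrite linearZ/= row_mxKr !mxE eqxx mulr1.
have lJ : \sum_i l 0 i *: J (x i) = 0.
  move/(congr1 lsubmx): lUE; rewrite linear_sum/= linear0 => h; rewrite -[RHS]h.
  by apply: eq_bigr => i _; rewrite linearZ/= row_mxKl.
have [i1 li1] : exists i, 0 < l 0 i.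
  apply: contrapT => /forallNP l_le0; move/eqP: l0; apply; apply/rowP => i.
  have {}l_le0 j : 0 <= - l 0 j by rewrite oppr_ge0 leNgt; apply/negP/l_le0.
  have /eqP : \sum_j - l 0 j = 0 by rewrite sumrN l1 oppr0.
  rewrite psumr_eq0// => /allP /(_ i); rewrite mem_index_enum => /(_ isT)/= /eqP/eqP.
  by rewrite oppr_eq0 mxE => /eqP.
have [i0 li0 imin] := @arg_minP _ _ _ i1 (fun i => 0 < l 0 i) (fun i => a i / l 0 i) li1.
pose s := a i0 / l 0 i0.
have s0 : 0 <= s by rewrite divr_ge0// ltW.
pose b i := a i - s * l 0 i.
have b0 i : 0 <= b i.
  rewrite subr_ge0; have [li|li] := ltP 0 (l 0 i).
    by rewrite -ler_pdivlMr//; exact: imin.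
  by rewrite (le_trans _ (a0 i))// mulr_ge0_le0.
have bi0 : b i0 = 0 by rewrite /b /s divfK ?subrr// gt_eqF.
exists (lift i0), (b \o lift i0); split.
- by move=> i /=.
- have : \sum_i b i = 1 by rewrite sumrB a1 -mulr_sumr l1 mulr0 subr0.
  by rewrite (bigD1_ord i0)//= bi0 add0r.
- have : \sum_i b i *: J (x i) = v.
    rewrite va; under eq_bigr do rewrite scalerBl -scalerA.
    by rewrite sumrB -scaler_sumr lJ scaler0 subr0.
  by rewrite (bigD1_ord i0)//= bi0 scale0r add0r => <-.
Qed.

Lemma caratheodory (D : set T) v : hull D v ->
  exists (x : 'I_d.+1 -> T) a, (forall i, D (x i)) /\ convex_comb v x a.
Proof.
move=> [n]; elim: n => [|n IH] [x [a [Dx va]]].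
  by have [_ + _] := va; rewrite big_ord0 => /esym/eqP; rewrite oner_eq0.
have [dn|nd] := ltnP d.+1 n.+1.
  have [f [b vb]] := caratheodory_reduce dn va.
  by apply: IH; exists (x \o f), b; split => // i; exact: Dx.
have [a0 a1 vE] := va.
(* With at most [d.+1] points the family is padded by copies of the point of index 0 with weight
   0. *)
pose b (i : 'I_d.+1) : R := if insub (i : nat) is Some j then a j else 0.
pose y (i : 'I_d.+1) : T := if insub (i : nat) is Some j then x j else x ord0.
have E (V : zmodType) (F : 'I_n.+1 -> V) :
    \sum_(i < d.+1) (if insub (i : nat) is Some j then F j else 0) = \sum_j F j.
  pose G (k : nat) : V := if insub k is Some j then F j else 0.
  rewrite (eq_bigr (fun j : 'I_n.+1 => G j)); last by move=> j _; rewrite /G valK.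
  rewrite (big_ord_widen _ G nd) [RHS]big_mkcond; apply: eq_bigr => i _.
  by case: ifPn => //; rewrite /G; case: insubP => // u ->.
exists y, b; split; first by move=> i; rewrite /y; case: insub.
split.
- by move=> i; rewrite /b; case: insub.
- by rewrite /b E.
- rewrite vE -E; apply: eq_bigr => i _; rewrite /b /y; case: insub => //=.
  by rewrite scale0r.
Qed.

End convex_hull.

(** * Compact Borel spaces, disintegration and measurable selection *)

Section ternary_code.
Context (R : realType).

(* [code b] is the sum of the [b j / 3 ^ (j + 1)]; the remainder left by the digits is at
   most [1 / 2], so that each digit is read off by comparison with [1 / 3]. *)
Fixpoint code_approx (n : nat) (b : nat -> bool) : R :=
  if n is m.+1 then ((b 0%N)%:R + code_approx m (b \o succn)) / 3 else 0.

Definition code (b : nat -> bool) : R := limn (code_approx ^~ b).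

Fixpoint code_digit (n : nat) (y : R) : bool :=
  if n is m.+1 then code_digit m (3 * y - (3^-1 <= y)%R%:R) else (3^-1 <= y)%R.

Lemma code_approx_bound n b : 0 <= code_approx n b <= 2^-1.
Proof.
elim: n b => [|n ih] b /=; first by rewrite lexx invr_ge0 ler0n.
have /andP[c0 c1] := ih (b \o succn); move: c0 c1; set c := code_approx _ _ => c0 c1.
by case: (b 0%N) => /=; lra.
Qed.

Lemma code_approx_nondecreasing b : nondecreasing_seq (code_approx ^~ b).
Proof.
apply/nondecreasing_seqP => n; elim: n b => [|n ih] b.
  by have /andP[] := code_approx_bound 1 b.
rewrite [leLHS]/= [leRHS]/=; have := ih (b \o succn).
by rewrite ler_pM2r ?invr_gt0// lerD2l.
Qed.

Lemma cvg_code b : code_approx ^~ b @ \oo --> code b.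
Proof.
apply: nondecreasing_is_cvgn; first exact: code_approx_nondecreasing.
by exists 2^-1 => _ [n _ <-]; have /andP[] := code_approx_bound n b.
Qed.

Lemma code_bound b : 0 <= code b <= 2^-1.
Proof.
apply/andP; split.
  apply: limr_ge; first exact: cvg_code.
  by apply: nearW => n; have /andP[] := code_approx_bound n b.
apply: limr_le; first exact: cvg_code.
by apply: nearW => n; have /andP[] := code_approx_bound n b.
Qed.

Lemma codeS b : code b = ((b 0%N)%:R + code (b \o succn)) / 3.
Proof.
rewrite [LHS]/code; apply/cvg_lim => //; rewrite -(cvg_shiftS (code_approx ^~ b)) /=.
by apply: cvgMl; apply: cvgD; [exact: cvg_cst|exact: cvg_code].
Qed.

Lemma codeK b n : code_digit n (code b) = b n.
Proof.
elim: n b => [|n ih] b /=; have E := codeS b; have /andP[c0 c1] := code_bound (b \o succn).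
  by case: (b 0%N) E => /= E; [|apply: negbTE; rewrite -ltNge]; lra.
have -> : (3^-1 <= code b) = b 0%N.
  by case: (b 0%N) E => /= E; [|apply: negbTE; rewrite -ltNge]; lra.
by rewrite E mulrC divfK// addrC addKr ih.
Qed.

Lemma measurable_natr_bool d (T : measurableType d) (b : T -> bool) :
  measurable_fun setT b -> measurable_fun setT (fun t => (b t)%:R : R).
Proof. by move=> mb; apply: (measurableT_comp (f := fun x : bool => x%:R : R)). Qed.

Lemma measurable_code d (T : measurableType d) (b : T -> nat -> bool) :
  (forall j, measurable_fun setT (b ^~ j)) -> measurable_fun setT (code \o b).
Proof.
move=> mb; apply: (measurable_fun_cvg (h := fun n t => code_approx n (b t))).
  move=> n; elim: n b mb => [|n ih] b mb /=; first exact: measurable_cst.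
  apply: measurable_funM; last exact: measurable_cst.
  apply: measurable_funD; last by apply: (ih (fun t j => b t j.+1)) => j; exact: mb.
  by apply: measurable_natr_bool; exact: mb.
by move=> t _; exact: cvg_code.
Qed.

Lemma measurable_code_digit n : measurable_fun setT (code_digit n).
Proof.
elim: n => [|n ih] /=.
  by apply: measurable_fun_ler; [exact: measurable_cst|exact: measurable_id].
apply: (measurableT_comp ih); apply: measurable_funB.
  by apply: measurable_funM; [exact: measurable_cst|exact: measurable_id].
apply: measurable_natr_bool.
by apply: measurable_fun_ler; [exact: measurable_cst|exact: measurable_id].
Qed.

End ternary_code.
Arguments code_digit {R} n y.

Lemma compact_bigcap_nonempty (T : topologicalType) (F : nat -> set T) :
  compact [set: T] -> (forall n, closed (F n)) -> (forall n, F n.+1 `<=` F n) ->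
  (forall n, F n !=set0) -> \bigcap_n F n !=set0.
Proof.
move=> cT cF ndF F0.
have {}ndF i j : (i <= j)%N -> F j `<=` F i.
  move=> ij; rewrite -(subnK ij); elim: (j - i)%N => // l ih.
  by rewrite addSn; exact: (subset_trans (@ndF _)).
have /choice[x xF] : forall n, exists x, F n x by [].
have [p [_ clp]] := cT (x @ \oo) _ filterT; exists p => n _.
apply: cF; rewrite clusterE in clp; apply: (clp (F n)).
by exists n => // m /= nm; apply: ndF nm _ _.
Qed.

Section borel_retract.
Context (R : realType) (A : ptopologicalType).

(** The members of level [n] are the preimages of the closed balls of radius [1 / n.+1] about a
    dense sequence. In the third item the level must not depend on the member, so that any member of
    that level which contains [a] may serve. *)
Lemma borel_space_covers : borel_space R A -> exists C : nat -> nat -> set A,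
  [/\ forall k n, closed (C k n),
      forall n a, exists k, C k n a,
      forall a (U : set A), open U -> U a -> exists n, forall k, C k n a -> C k n `<=` U
    & forall a b : A, a <> b -> exists U : set A, [/\ open U, U a & ~ U b]].
Proof.
move=> [E [f [_ [S [cS dS]] finj openf _]]].
have fcont (V : set E) : open V -> open (f @^-1` V) by move=> oV; apply/openf; exists V.
have [e eS] : exists e : nat -> E, S `<=` range e.
  have /pfcard_geP[->|[h]] := cS; first by exists (fun=> f point).
  by exists h => y /(@surj _ _ _ _ h)[n _ <-]; exists n.
have dense_e n (x : E) : exists k, mdist (e k) x < n.+1%:R^-1.
  have n0 : 0 < n.+1%:R^-1 :> R by rewrite invr_gt0 ltr0n.
  have [|y [/interior_subset xy Sy]] := dS (ball x n.+1%:R^-1)° _ (@open_interior _ _).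
    by exists x; apply: nbhsx_ballx.
  have [k _ ek] := eS _ Sy; exists k; rewrite ek metric_sym.
  by move: xy; rewrite ballEmdist.
have openball (x : E) r : open [set y | r < mdist x y].
  rewrite openE => y /= ry; apply/nbhs_ballP; exists (mdist x y - r) => /=.
    by rewrite subr_gt0.
  move=> z; rewrite ballEmdist /= => yz; rewrite -(ltrD2r (mdist y z)).
  rewrite (@lt_le_trans _ _ (mdist x y)) ?[mdist y z]metric_sym ?metric_triangle//.
  by rewrite -ltrBrDl [mdist z y]metric_sym.
exists (fun k n => [set a | mdist (e k) (f a) <= n.+1%:R^-1]); split.
- move=> k n; rewrite -[X in closed X]setCK; apply: open_closedC.
  rewrite [X in open X](_ : _ = f @^-1` [set y | n.+1%:R^-1 < mdist (e k) y]); first exact: fcont.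
  by apply/seteqP; split => a /=; rewrite ltNge => /negP.
- by move=> n a; have [k ka] := dense_e n (f a); exists k; exact: ltW.
- move=> a U /openf[V [oV ->]] /= Va.
  have /nbhs_ballP[r /= r0 rV] : nbhs (f a) V by exact: open_nbhs_nbhs.
  (* Two points of one member are both within [r / 2] of its centre, hence closer than [r] to each
     other. *)
  have [n nr] : exists n, n.+1%:R^-1 < r / 2.
    have r20 : 0 < r / 2 by rewrite divr_gt0.
    by have [n _ /(_ _ (leqnn n))] := near_infty_natSinv_lt (PosNum r20); exists n.
  exists n => k ka b kb; apply: rV; rewrite ballEmdist /=.
  rewrite (le_lt_trans (metric_triangle _ (e k) _))// [r]splitr ltrD//.
    by rewrite metric_sym (le_lt_trans ka).
  exact: le_lt_trans nr.
- move=> a b ab; exists (f @^-1` [set y | 0 < mdist (f b) y]); split.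
  + exact/fcont/openball.
  + by rewrite /= mdist_gt0; apply/eqP => /finj /esym.
  + by rewrite /= mdistxx ltxx.
Qed.

(** Such a set is a finite Boolean combination of the conditions that a given digit be 1; the
    induction distinguishes the two values of the last relevant digit. *)
Lemma measurable_finite_digits m (P : (nat -> bool) -> Prop) :
  (forall b b', (forall j, (j < m)%N -> b j = b' j) -> P b -> P b') ->
  measurable [set y : R | P (code_digit ^~ y)].
Proof.
elim: m P => [|m ih] P Pm.
  have [Pt|nPt] := pselect (P (fun=> true)).
    rewrite [X in measurable X](_ : _ = setT)//; apply/seteqP; split => // y _.
    by apply: Pm Pt => j; rewrite ltn0.
  rewrite [X in measurable X](_ : _ = set0)//; apply/seteqP; split => // y Py.
  by apply: nPt; apply: Pm Py => j; rewrite ltn0.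
pose P' (c : bool) b := P (fun j => if j == m then c else b j).
have mP' c : measurable [set y : R | P' c (code_digit ^~ y)].
  apply: ih => b b' bb'; apply: Pm => j; rewrite ltnS leq_eqVlt.
  by case: eqP => //= _; exact: bb'.
have mD : measurable [set y : R | code_digit m y].
  rewrite -[X in measurable X]setTI.
  exact: (@measurable_code_digit R m measurableT [set true]).
rewrite [X in measurable X](_ : _ =
   ([set y : R | code_digit m y] `&` [set y : R | P' true (code_digit ^~ y)]) `|`
   (~` [set y : R | code_digit m y] `&` [set y : R | P' false (code_digit ^~ y)])).
  by apply: measurableU; apply: measurableI => //; exact: measurableC.
apply/seteqP; split => y /=.
  move=> Py; case: (boolP (code_digit m y)) => dm; [left|right]; split => //.
  - by apply: Pm Py => j _; case: eqP => // ->.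
  - by apply: Pm Py => j _; case: eqP => // ->; exact/negbTE.
move=> [[dm]|[/negP/negbTE dm]]; apply: Pm => j _; by case: eqP => // ->.
Qed.

(* A point is coded by the members of a countable closed cover that contain it. By compactness
   the sequences whose members have a common point form a countable intersection of
   conditions on finitely many digits, which makes decoding measurable. *)
Lemma borel_retract : borel_space R A -> compact [set: A] ->
  exists (s : borel A -> R) (g : R -> borel A),
    [/\ measurable_fun setT s, measurable_fun setT g, cancel s g
      & forall a, 0 <= s a <= 1].
Proof.
move=> /borel_space_covers[C [closedC coverC smallC sepC]] cptA.
pose C' (j : nat) : set A := if @unpickle (nat * nat)%type j is Some kn then C kn.1 kn.2 else setT.
have C'E (k n : nat) : C' (pickle (k, n)) = C k n by rewrite /C' pickleK.
have closedC' j : closed (C' j) by rewrite /C'; case: unpickle => // ; exact: closedT.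
have mC' j : measurable (C' j : set (borel A)).
  rewrite -[X in measurable X]setCK; apply: measurableC; apply: sub_sigma_algebra.
  exact: closed_openC.
pose bits (a : A) j := `[< C' j a >].
pose F (b : nat -> bool) m : set A := [set a | forall j, (j < m)%N -> b j -> C' j a].
(* The first clause selects a member at every level, so that at most one point is common to the
   selected members; by the second clause and compactness there is at least one. *)
pose good (b : nat -> bool) := (forall n : nat, exists k : nat, b (pickle (k, n))) /\
  forall m, F b m !=set0.
have closedF b m : closed (F b m).
  rewrite [X in closed X](_ : _ = \bigcap_(j in [set j | (j < m)%N /\ b j]) C' j).
    by apply: closed_bigI.
  apply/seteqP; split => [a Fa j [jm bj]|a Fa j jm bj]; first exact: Fa.
  by apply: Fa.
have ndF b m : F b m.+1 `<=` F b m by move=> a Fa j jm; apply: Fa; exact: ltnW.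
have goodF b : good b -> \bigcap_m F b m !=set0.
  by move=> [_ b0]; exact: compact_bigcap_nonempty.
have uniqF b x y : good b -> (\bigcap_m F b m) x -> (\bigcap_m F b m) y -> x = y.
  move=> [bn _] Fx Fy; apply: contrapT => /sepC[U [oU Ux nUy]].
  have [n nU] := smallC _ _ oU Ux; have [k bk] := bn n.
  have CF z : (\bigcap_m F b m) z -> C k n z.
    by move=> /(_ (pickle (k, n)).+1 Logic.I) /(_ _ (ltnSn _) bk); rewrite C'E.
  by apply: nUy; apply: (nU k (CF _ Fx)); exact: CF.
pose g (y : R) : borel A :=
  if pselect (good (code_digit ^~ y)) is left h then sval (cid (goodF _ h)) else point.
have gE y : good (code_digit ^~ y) -> (\bigcap_m F (code_digit ^~ y) m) (g y).
  by rewrite /g; case: pselect => // h _; case: cid.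
have mgood : measurable [set y : R | good (code_digit ^~ y)].
  rewrite [X in measurable X](_ : _ =
    (\bigcap_(n in [set: nat]) \bigcup_(k in [set: nat]) [set y : R | code_digit (pickle (k, n)) y]) `&`
    \bigcap_m [set y : R | F (code_digit ^~ y) m !=set0]).
    apply: measurableI; apply: bigcapT_measurable => n; last first.
      apply: (@measurable_finite_digits n (fun b => F b n !=set0)) => b b' bb' [a Fa].
      by exists a => j jn; rewrite -bb'//; exact: Fa.
    apply: bigcupT_measurable => k; rewrite -[X in measurable X]setTI.
    exact: (@measurable_code_digit R _ measurableT [set true]).
  apply/seteqP; split => y /=.
    by move=> [h1 h2]; split => [n _|m _]; [have [k bk] := h1 n; exists k|exact: h2].
  by move=> [h1 h2]; split => [n|m]; [have [k _ bk] := h1 n Logic.I; exists k|exact: h2].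
exists (fun a => code R (bits a)), g; split.
- apply: measurable_code => j; apply: (measurable_fun_bool true).
  rewrite setTI [X in measurable X](_ : _ = C' j)//.
  by apply/seteqP; split => a /=; rewrite /bits; [move/asboolP|move=> ?; apply/asboolP].
- apply: (@measurability _ _ _ _ setT g (@open A)) => //.
  move=> _ [U oU <-]; rewrite setTI.
  (* By compactness the decoded point of a good sequence lies in the open set [U] exactly when some
     finite stage [F _ m] already does. Other sequences are decoded to [point]. *)
  pose H m := [set y : R | F (code_digit ^~ y) m `<=` U].
  have mH m : measurable (H m).
    apply: (@measurable_finite_digits m (fun b => F b m `<=` U)) => b b' bb' FU a Fa.
    by apply: FU => j jm; rewrite bb'//; exact: Fa.
  rewrite [X in measurable X](_ : _ =
    ([set y : R | good (code_digit ^~ y)] `&` \bigcup_m H m) `|`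
    (~` [set y : R | good (code_digit ^~ y)] `&` [set _ | U point])).
    apply: measurableU; apply: measurableI => //.
    + exact: bigcupT_measurable.
    + exact: measurableC.
    + have [Up|nUp] := pselect (U point).
        by rewrite [X in measurable X](_ : _ = setT)//; apply/seteqP; split.
      by rewrite [X in measurable X](_ : _ = set0)//; apply/seteqP; split => // ? /nUp.
  apply/seteqP; split => y /=.
    have [gy|ngy] := pselect (good (code_digit ^~ y)); last first.
      by rewrite /g; case: pselect => // _ Up; right.
    move=> Ugy; left; split => //; apply: contrapT => nH.
    have [| | |a aU] := @compact_bigcap_nonempty A (fun m => F (code_digit ^~ y) m `&` ~` U) cptA.
    + by move=> m; apply: closedI => //; exact: open_closedC.
    + by move=> m; apply: setSI; exact: ndF.
    + move=> m; apply: contrapT => /forallNP Fm; apply: nH; exists m => // a Fa.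
      by apply: contrapT => nUa; apply: (Fm a).
    have [_ nUa] := aU 0%N Logic.I; apply: nUa.
    rewrite (uniqF _ a (g y) gy)//; last exact: gE.
    by move=> m _; have [] := aU m Logic.I.
  move=> [[gy [m _ HU]]|[ngy Up]]; first by apply: HU; exact: gE.
  by rewrite /g; case: pselect.
- move=> a.
  have bE : (fun j => code_digit j (code R (bits a))) = bits a.
    by apply/funext => j; rewrite codeK.
  have Fa : (\bigcap_m F (bits a) m) a by move=> m _ j _ /asboolP.
  have ga : good (bits a).
    split; last by move=> m; exists a; exact: Fa.
    by move=> n; have [k ka] := coverC n a; exists k; apply/asboolP; rewrite C'E.
  have := gE (code R (bits a)); rewrite bE => /(_ ga) gFa.
  exact: (uniqF _ _ _ ga gFa Fa).
- move=> a; have /andP[-> c1] := code_bound R (bits a).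
  by rewrite (le_trans c1)// invf_le1// ler1n.
Qed.

End borel_retract.

(** * Disintegration of finite measures *)

Section mk_finite_measure.
Local Open Scope ereal_scope.
Context d (T : measurableType d) (R : realType).
Variables (m : {measure set T -> \bar R}) (moo : m setT < +oo).

Definition mk_finite_fun (_ : m setT < +oo) : set T -> \bar R := m.

Let m_fin : fin_num_fun (mk_finite_fun moo).
Proof. by apply: lty_fin_num_fun. Qed.

HB.instance Definition _ := Measure.on (mk_finite_fun moo).
HB.instance Definition _ := Measure_isFinite.Build _ _ _ (mk_finite_fun moo) m_fin.

Definition mk_finite : {finite_measure set T -> \bar R} := mk_finite_fun moo.

End mk_finite_measure.

Lemma setX_setUr (T U : Type) (B : set T) (C D : set U) :
  B `*` (C `|` D) = (B `*` C) `|` (B `*` D).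
Proof.
apply/seteqP; split => [[x y] /= [Bx []]|[x y] [] [/= Bx]].
- by left.
- by right.
- by split => //; left.
- by split => //; right.
Qed.

Section fiber_densities.
Local Open Scope ereal_scope.
Context d d' (X : measurableType d) (Y : measurableType d') (R : realType).
Variable mu : {measure set (X * Y) -> \bar R}.
Hypothesis muoo : mu setT < +oo.

Let m : {measure set X -> \bar R} := mpush mu measurable_fst.

Let mE B : m B = mu (B `*` setT).
Proof. by congr (mu _); apply/seteqP; split => [[x y]|[x y] []]. Qed.

(** For fixed [C], the function [f C] is a Radon-Nikodym derivative, with respect to the first
    marginal, of the measure that sends [B] to the mass of the rectangle of [B] and [C].
    Monotonicity and the bound 1 hold only outside null sets that depend on the sets compared. *)
Lemma fiber_densities : exists f : set Y -> X -> \bar R,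
  [/\ forall C x, measurable C -> 0 <= f C x,
      forall C, measurable C -> m.-integrable setT (f C),
      forall C B, measurable C -> measurable B ->
        mu (B `*` C) = \int[m]_(x in B) f C x,
      forall C D, measurable C -> measurable D -> C `<=` D ->
        {ae m, forall x, f C x <= f D x}
    & forall C, measurable C -> {ae m, forall x, f C x <= 1}].
Proof.
have moo : m setT < +oo by rewrite mE setXTT.
have dens C : exists f : X -> \bar R, measurable C ->
    [/\ forall x, 0 <= f x, m.-integrable setT f &
      forall B, measurable B -> mu (B `*` C) = \int[m]_(x in B) f x].
  have [mC|nC] := pselect (measurable C); last by exists (fun=> 0) => /nC.
  have mTC : measurable ([set: X] `*` C) by exact: measurableX.
  pose nu : {measure set X -> \bar R} := mpush (mrestr mu mTC) measurable_fst.
  have nuE B : nu B = mu (B `*` C).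
    by congr (mu _); apply/seteqP; split => [[x y] [? []]|[x y] []].
  have nuoo : nu setT < +oo.
    by apply: le_lt_trans muoo; rewrite nuE le_measure ?inE.
  have nu_m : mk_finite nuoo `<< mk_finite moo.
    apply/null_content_dominatesP => B mB mB0.
    apply/eqP; rewrite -measure_le0 -[leRHS]mB0 [leLHS]nuE [leRHS]mE.
    by apply: le_measure; rewrite ?inE; [exact: measurableX..|move=> [x y] []].
  have [f [f0 fi fE]] := radon_nikodym_finite nu_m.
  by exists f => _; split => // B mB; rewrite -nuE; exact: fE.
have {dens} [f fP] := choice dens.
have fadd C D : measurable C -> measurable D -> C `<=` D ->
    {ae m, forall x, f C x <= f D x}.
  move=> mC mD CD; have mDC : measurable (D `\` C) by exact: measurableD.
  have [fC0 fCi fCE] := fP _ mC; have [fD0 fDi fDE] := fP _ mD.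
  have [fE0 fEi fEE] := fP _ mDC.
  have mfC := measurable_int _ fCi; have mfE := measurable_int _ fEi.
  have : ae_eq m setT (f D) (fun x => f C x + f (D `\` C) x).
    apply: integral_ae_eq => //; first exact: emeasurable_funD.
    move=> B _ mB; rewrite ge0_integralD//; last 2 first.
    - exact: measurable_funTS.
    - exact: measurable_funTS.
    rewrite -fCE// -fEE// -fDE// -measureU//; last 3 first.
    - exact: measurableX.
    - exact: measurableX.
    - by apply/seteqP; split => // -[x y] [[_ Cy] [_ []]].
    by rewrite -setX_setUr setDUK.
  apply: filterS => x -> //; by rewrite leeDl.
exists f; split => //.
- by move=> C x /fP[].
- by move=> C /fP[].
- by move=> C B /fP[_ _]; exact.
- move=> C mC; have : {ae m, forall x, f C x <= f setT x} by exact: fadd.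
  have [fT0 fTi fTE] := fP _ measurableT.
  have : ae_eq m setT (f setT) (cst 1).
    apply: integral_ae_eq => // B _ mB.
    by rewrite -fTE// integral_cst// mul1e mE.
  by apply: filterS2 => x -> //.
Qed.

End fiber_densities.

Section disintegration_real.
Local Open Scope ereal_scope.
Context d (X : measurableType d) (R : realType).
Variable mu : {measure set (X * R) -> \bar R}.
Hypothesis muoo : mu setT < +oo.
Hypothesis mu01 : mu (setT `*` ~` `[0%R, 1%R]) = 0.

Let m : {measure set X -> \bar R} := mpush mu measurable_fst.

(** Lebesgue measure lives on the copy [measurableTypeR R]; the identity carries it to [R]. *)
Let mid : measurable_fun [set: measurableTypeR R] (id : measurableTypeR R -> R).
Proof. by move=> _ B mB; rewrite setTI. Qed.

Let lam : {measure set R -> \bar R} :=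
  mpush (mrestr (@lebesgue_measure R) (measurable_itv (`[0%R, 1%R] : interval R))) mid.

Let lam1 : lam setT = 1.
Proof.
transitivity (@lebesgue_measure R [set` `[0%R, 1%R]]).
  by congr (lebesgue_measure _); apply/seteqP; split => [t []|t].
by rewrite lebesgue_measure_itv/= lte_fin ltr01 -EFinB subr0.
Qed.

Let lam_le (c : \bar R) : 0 <= c -> c <= 1 -> lam [set t | t%:E <= c] = c.
Proof.
move=> c0 c1; have cf : c \is a fin_num.
  by rewrite ge0_fin_numE// (le_lt_trans c1)// ltry.
transitivity (@lebesgue_measure R [set` `[0%R, fine c]]); last first.
  rewrite lebesgue_measure_itv/= lte_fin; case: ltP => [c'|c'].
    by rewrite -EFinB subr0 fineK.
  by apply/esym/eqP; rewrite eq_le c0 andbT -(fineK cf) lee_fin.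
congr (lebesgue_measure _).
have tcE t : (t%:E <= c) = (t <= fine c)%R by rewrite -lee_fin fineK.
apply/seteqP; split => t; rewrite /setI/= !in_itv/= tcE.
  by move=> [-> /andP[->]].
move=> /andP[t0 tc]; rewrite tc t0; split => //; rewrite (le_trans tc)//.
by rewrite -lee_fin fineK.
Qed.

(* The densities [f q] of the rays at rational points are distribution functions only almost
   everywhere; the law of their generalized inverse [h (x, t)], for [t] uniform on [0, 1], is
   a probability measure for every [x]. *)
Lemma disintegration_real : exists k : R.-pker X ~> R, forall B C,
  measurable B -> measurable C -> mu (B `*` C) = \int[m]_(x in B) k x C.
Proof.
have [f0 [f_ge0 f_int fE f_mono f_le1]] := fiber_densities muoo.
pose ray (q : rat) : set R := [set` `]-oo, (ratr q : R)]].
have mray q : measurable (ray q) by exact: measurable_itv.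
pose f q := f0 (ray q).
have mf q : measurable_fun setT (f q) by exact: measurable_int (f_int _ (mray q)).
(* Negative rationals are excluded and all rationals from 1 on are included. So the infimum exists
   and lies in [0, 1] even where the densities misbehave. *)
pose E (z : X * R) : set R := [set ratr q | q in
  [set q : rat | (0 <= q)%R /\ (z.2%:E <= f q z.1 \/ (1 <= q)%R)]].
pose h (z : X * R) : R := inf (E z).
have E1 z : E z 1%R by exists 1%R => //=; [split => //; right|rewrite rmorph1].
have lbE z : lbound (E z) 0%R by move=> _ [q [q0 _] <-]; rewrite ler0q.
have hasE z : has_inf (E z) by split; [exists 1%R|exists 0%R; exact: lbE].
have hlt z y : (h z < y)%R <-> exists2 e, E z e & (e < y)%R.
  split; first by move=> /(inf_lt (hasE z).1)[e]; exists e.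
  by move=> [e Ee]; apply: le_lt_trans; apply: ge_inf => //; exact: (hasE z).2.
have mh : measurable_fun setT h.
  apply: (measurability _ (RGenInftyO.measurableE R)).
  move=> _ [_ [y ->] <-]; rewrite setTI.
  pose Q (q : rat) : set (X * R) := [set z | [/\ (0 <= q)%R, (ratr q < y)%R
     & (z.2%:E <= f q z.1) \/ (1 <= q)%R]].
  rewrite [X in measurable X](_ : _ = \bigcup_(q in [set: rat]) Q q).
    apply: bigcupT_measurable_rat => q.
    have [q0|q0] := boolP (0 <= q)%R; last first.
      by rewrite (_ : Q q = set0)//; apply/seteqP; split => // z [] ; rewrite (negbTE q0).
    have [qy|qy] := boolP (ratr q < y)%R; last first.
      by rewrite (_ : Q q = set0)//; apply/seteqP; split => // z []; rewrite (negbTE qy).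
    have [q1|q1] := boolP (1 <= q)%R.
      by rewrite (_ : Q q = setT)//; apply/seteqP; split => // z _; split => //; right.
    rewrite (_ : Q q = setT `&` [set z | z.2%:E <= f q z.1]).
      apply: measurable_lee => //.
        by apply/measurable_EFinP; exact: measurable_snd.
      exact: (measurableT_comp (mf q) measurable_fst).
    by rewrite setTI; apply/seteqP; split => z; [case=> _ _ [|]//; rewrite (negbTE q1)|split => //; left].
  apply/seteqP; split => z /=; rewrite in_itv/=.
    by move=> /hlt[_ [q [q0 qz] <-] qy]; exists q.
  by move=> [q _ [q0 qy qz]]; apply/hlt; exists (ratr q) => //; exists q.
have mlam U : measurable U -> measurable_fun [set: X] ((fun _ : X => lam) ^~ U).
  by move=> mU; exact: measurable_cst.
pose kl : R.-pker X ~> R := mk_pker mlam (fun=> lam1).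
pose k0 (x : X) : {measure set R -> \bar R} := mpush (kgraph kl x) mh.
have mk0 U : measurable U -> measurable_fun [set: X] (k0 ^~ U).
  move=> mU; apply: (measurable_kernel (kgraph kl)).
  by rewrite -[X in measurable X]setTI; exact: (mh measurableT U mU).
have k01 x : k0 x setT = 1 by rewrite /k0 mpushE preimage_setT prob_kernel.
pose k : R.-pker X ~> R := mk_pker mk0 k01.
have kE x C : k x C = lam [set t | C (h (x, t))] by [].
have mkC C : measurable C -> measurable_fun setT (k ^~ C) by exact: measurable_kernel.
exists k => B C mB mC.
have mI y : measurable [set` `]-oo, (y : R)[] by exact: measurable_itv.
have mEB : m B = mu (B `*` setT).
  by congr (mu _); apply/seteqP; split => [[x t]|[x t] []].
have intk C' : measurable C' -> \int[m]_(x in B) k x C' <= m B.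
  move=> mC'; rewrite -[leRHS]mul1e -integral_cst//.
  apply: ge0_le_integral => //; first by apply: measurable_funTS; exact: mkC.
  by move=> x _; rewrite -[leRHS](k01 x); apply: le_measure; rewrite ?inE.
(* For [q] nonnegative, [t <= f q x] makes [h (x, t)] at most [q], hence less than [y]. For [q]
   negative the ray is null, because [mu] lives on [0, 1]. *)
have low q y : (ratr q < y)%R -> mu (B `*` ray q) <= \int[m]_(x in B) k x [set` `]-oo, y[].
  move=> qy; have [q0|q0] := ltP q 0%R.
    rewrite (_ : mu _ = 0); first exact: integral_ge0.
    apply: subset_measure0 mu01; [exact: measurableX|..].
      by apply: measurableX => //; exact: measurableC.
    move=> [x t] [_]; rewrite /ray/= in_itv/= => tq; split => //.
    rewrite /setC/= in_itv/= => /andP[t0 _]; by have := le_trans t0 tq; rewrite ler0q leNgt q0.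
  rewrite fE//; apply: ae_ge0_le_integral => //.
  - by move=> x _; exact: f_ge0.
  - by apply: measurable_funTS; exact: mf.
  - by apply: measurable_funTS; exact: mkC.
  - have := f_le1 _ (mray q); apply: filterS => x fx1 _.
    rewrite -[leLHS](lam_le (f_ge0 _ x (mray q)) fx1) kE.
    apply: le_measure; rewrite ?inE.
    + rewrite -[X in measurable X]setTI; apply: measurable_lee => //; exact/measurable_EFinP.
    + rewrite -[X in measurable X]setTI.
      exact: (measurableT_comp mh (pair1_measurable x)).
    + move=> t tq; rewrite /= in_itv/=; apply/hlt; exists (ratr q) => //.
      by exists q => //; split => //; left.
(* If [h (x, t) < y] then [t <= f p x] for some rational [p] below [q], and [f p x <= f q x] for
   almost every [x]. *)
have up q y : (y <= ratr q)%R -> \int[m]_(x in B) k x [set` `]-oo, y[] <= mu (B `*` ray q).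
  move=> yq; have [q1|q1] := leP 1%R q.
    apply: (le_trans (intk _ (mI y))); rewrite mEB.
    have -> : B `*` setT = (B `*` ray q) `|` (B `*` ~` ray q) by rewrite -setX_setUr setUv.
    have mrc : measurable (B `*` ~` ray q) by apply: measurableX => //; exact: measurableC.
    have mr : measurable (B `*` ray q) by exact: measurableX.
    rewrite (le_trans (measureU2 mu mr mrc))// [X in _ + X](_ : _ = 0) ?adde0//.
    apply: subset_measure0 mu01 => //; first by apply: measurableX => //; exact: measurableC.
    move=> [x t] [_]; rewrite /ray/setC/= in_itv/= => tq; split => //.
    rewrite /setC/= in_itv/= => /andP[_ t1]; apply: tq; rewrite (le_trans t1)//.
    by rewrite -(rmorph1 (ratr : rat -> R)) ler_rat.
  rewrite fE//; apply: ae_ge0_le_integral => //.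
  - by apply: measurable_funTS; exact: mkC.
  - by move=> x _; exact: f_ge0.
  - by apply: measurable_funTS; exact: mf.
  (* Enumerating the rationals collects the exceptional sets of monotonicity into a single null
     set. *)
  pose qn (n : nat) : rat := odflt 0%R (unpickle n).
  have : {ae m, forall x n, (qn n <= q)%R -> f (qn n) x <= f q x}.
    apply: ae_foralln => n; have [qnq|qnq] := boolP (qn n <= q)%R; last first.
      by apply: aeW => x.
    have : {ae m, forall x, f (qn n) x <= f q x}.
      by apply: f_mono => // t; rewrite /ray/= !in_itv/= => /le_trans; apply; rewrite ler_rat.
    by apply: filterS.
  have := f_le1 _ (mray q); apply: filterS2 => x fx1 fx _.
  rewrite -[leRHS](lam_le (f_ge0 _ x (mray q)) fx1) kE.
  apply: le_measure; rewrite ?inE.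
  + rewrite -[X in measurable X]setTI.
    exact: (measurableT_comp mh (pair1_measurable x)).
  + rewrite -[X in measurable X]setTI; apply: measurable_lee => //; exact/measurable_EFinP.
  + move=> t; rewrite /= in_itv/= => /hlt[_ [p [p0 pt] <-] py].
    have pq : (p <= q)%R by rewrite -(ler_rat R) (le_trans (ltW py)).
    have [/= tp|] := pt; last by rewrite leNgt (le_lt_trans pq q1).
    by apply: (le_trans tp); have := fx (pickle p); rewrite /qn pickleK; exact.
have mBC C' : measurable C' -> measurable (B `*` C') by exact: measurableX.
pose m1 : {measure set R -> \bar R} :=
  mpush (mrestr (mbind m (kgraph k)) (measurableX mB (@measurableT _ R))) measurable_snd.
have m1E C' : m1 C' = \int[m]_(x in B) k x C'.
  rewrite -mbind_kgraph_rect//.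
  by congr (mbind _ _ _); apply/seteqP; split => [[x t] [? []]|[x t] []].
pose m2 : {measure set R -> \bar R} := mpush (mrestr mu (measurableX mB (@measurableT _ R))) measurable_snd.
have m2E C' : m2 C' = mu (B `*` C').
  by congr (mu _); apply/seteqP; split => [[x t] [? []]|[x t] []].
rewrite -m1E -m2E.
apply: (@measure_unique _ R _ (@RGenInftyO.G R) (fun n => [set` `]-oo, n%:R[]) (RGenInftyO.measurableE R)).
- move=> _ _ [x ->] [y ->]; exists (Num.min x y).
  by apply/seteqP; split => t /=; rewrite !in_itv/= lt_min; [case=> -> ->|move=> /andP].
- by move=> n; exists n%:R.
- apply/seteqP; split => // t _; exists (Num.bound `|t|) => //=.
  by rewrite in_itv/= (le_lt_trans (ler_norm t))// archi_boundP.
- move=> _ [y ->].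
  (* Along rationals increasing to [y] the open half-lines exhaust the one at [y]. Each of the two
     masses is then a limit of masses that [low] or [up] bounds by the other. *)
  have [q [qy1 qy2 qS]] : exists q : nat -> rat, [/\ forall n, (ratr (q n) < y)%R,
      forall n, (y - n.+1%:R^-1 < ratr (q n))%R & forall n, (ratr (q n) < ratr (q n.+1) :> R)%R].
    have ex n : exists q : rat, (y - n.+1%:R^-1 < ratr q < y - n.+2%:R^-1)%R.
      have : (y - n.+1%:R^-1 < y - n.+2%:R^-1)%R.
        by rewrite ltrD2l ltrN2 ltf_pV2 ?posrE ?ltr0n// ltr_nat.
      by move=> /rat_in_itvoo[q]; rewrite in_itv/=; exists q.
    have [q qP] := choice ex; exists q; split => n; have /andP[q1 q2] := qP n => //.
      by rewrite (lt_trans q2)// gtrBl invr_gt0 ltr0n.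
    by have /andP[q3 _] := qP n.+1; exact: lt_trans q2 q3.
  have UE : [set` `]-oo, y[] = \bigcup_n [set` `]-oo, (ratr (q n) : R)[].
    apply/seteqP; split => t /=; rewrite in_itv/=.
      move=> ty; have [n _ /(_ _ (leqnn n))/= nty] := near_infty_natSinv_lt (PosNum (etrans (subr_gt0 _ _) ty)).
      exists n => //=; rewrite in_itv/=; apply: lt_trans (qy2 n).
      by move: nty; rewrite /= ltrBrDr addrC -ltrBrDr.
    by move=> [n _ /=]; rewrite in_itv/= => /lt_trans; exact.
  have nd : nondecreasing_seq (fun n => [set` `]-oo, (ratr (q n) : R)[]).
    apply/nondecreasing_seqP => n; apply/subsetPset => t /=; rewrite !in_itv/= => /lt_trans; exact.
  have cv (mm : {measure set R -> \bar R}) : mm [set` `]-oo, (ratr (q n) : R)[] @[n --> \oo] --> mm [set` `]-oo, y[].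
    by rewrite UE; apply: nondecreasing_cvg_mu => //; exact: bigcup_measurable.
  apply/eqP; rewrite eq_le; apply/andP; split.
    rewrite -(cvg_lim _ (cv m2))//; apply: lime_le; first by apply/cvg_ex; eexists; exact: cv.
    apply: nearW => n; rewrite m1E m2E.
    apply: (@le_trans _ _ (mu (B `*` ray (q n)))); last by exact: low.
    apply: le_measure; rewrite ?inE; [exact: mBC|exact: mBC|].
    by move=> [x t] [Bx /=]; rewrite /ray/= !in_itv/= => /ltW.
  rewrite -(cvg_lim _ (cv m1))//; apply: lime_le; first by apply/cvg_ex; eexists; exact: cv.
  apply: nearW => n; rewrite m1E m2E.
  apply: (@le_trans _ _ (mu (B `*` ray (q n)))); first exact: up.
  apply: le_measure; rewrite ?inE; [exact: mBC|exact: mBC|].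
  by move=> [x t] [Bx]; rewrite /ray/= in_itv/= => tq; split => //=; rewrite in_itv/= (le_lt_trans tq).
- move=> n; rewrite m2E; apply: le_lt_trans muoo.
  by apply: le_measure; rewrite ?inE; [exact: mBC|exact: measurableT|].
- exact: mC.
Qed.

End disintegration_real.

Section kernel_push.
Local Open Scope ereal_scope.
Context d d1 d2 (X : measurableType d) (Y : measurableType d1) (Z : measurableType d2)
  (R : realType).
Variables (k : R.-pker X ~> Y) (f : Y -> Z).
Hypothesis mf : measurable_fun setT f.

Let kp (x : X) : {measure set Z -> \bar R} := mpush (k x) mf.

Let mkp U : measurable U -> measurable_fun [set: X] (kp ^~ U).
Proof.
move=> mU; apply: (measurable_kernel k).
by rewrite -[X in measurable X]setTI; exact: (mf measurableT).
Qed.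

Let kp1 x : kp x setT = 1.
Proof. by rewrite /kp mpushE preimage_setT prob_kernel. Qed.

Definition kpush : R.-pker X ~> Z := mk_pker mkp kp1.

Lemma kpushE x U : kpush x U = k x (f @^-1` U).
Proof. by []. Qed.

End kernel_push.

(** The coding [s] carries [mu] to a measure on [X * R] that lives on [0, 1] in the second
    coordinate; the decoding [g] carries the resulting kernel back, and [g] undoes [s] on
    rectangles. *)
Lemma disintegration (R : realType) d (X : measurableType d) (A : ptopologicalType)
    (mu : {measure set (X * borel A) -> \bar R}) :
  borel_space R A -> compact [set: A] -> (mu setT < +oo)%E ->
  exists k : R.-pker X ~> borel A, forall C, measurable C ->
    mu C = mbind (mpush mu measurable_fst) (kgraph k) C.
Proof.
move=> bA cA muoo.
have [s [g [ms mg sgK s01]]] := borel_retract bA cA.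
have msX : measurable_fun setT (fun z : X * borel A => (z.1, s z.2)).
  by apply: measurable_fun_pair => //; exact: (measurableT_comp ms measurable_snd).
have [||k kE] := @disintegration_real _ X R (mpush mu msX).
- by rewrite mpushE preimage_setT.
- rewrite mpushE [X in mu X](_ : _ = set0) ?measure0//.
  apply/seteqP; split => // -[x a] [_]; rewrite /setC/= in_itv/=; apply.
  exact: s01.
exists (kpush k mg); apply: eq_measure_rect => // B C mB mC.
transitivity (\int[mpush mu measurable_fst]_(x in B) kpush k mg x C)%E; last first.
  by apply/esym; exact: mbind_kgraph_rect.
transitivity (mpush mu msX (B `*` (g @^-1` C))).
  rewrite mpushE; congr (mu _); apply/seteqP; split => -[x a] /=; rewrite sgK//.
by apply: kE => //; rewrite -[X in measurable X]setTI; exact: mg.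
Qed.

(** * Inner approximation by closed sections and measurable selection *)

Section inner_approximation.
Local Open Scope ereal_scope.
Context d (X : measurableType d) (R : realType) (k : R.-pker X ~> R).

(** Inner regularity with a parameter: the approximating set is jointly measurable and its error is
    prescribed at every single [x], not merely on average. The error may be any positive measurable
    function, so that it can be divided among countably many sets. *)
Definition inner_approx (B : set (X * R)) := forall e : X -> R,
  measurable_fun setT e -> (forall x, (0 < e x)%R) ->
  exists K, [/\ measurable K, K `<=` B, forall x, closed [set y : R | K (x, y)]
    & forall x, kgraph k x (B `\` K) <= (e x)%:E].

Let eps n (e : X -> R) (x : X) : R := (e x / (2 ^ n.+1)%:R)%R.

Let eps_gt0 n e : (forall x, (0 < e x)%R) -> forall x, (0 < eps n e x)%R.
Proof. by move=> e0 x; rewrite divr_gt0// ltr0n expn_gt0. Qed.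

Let measurable_eps n e : measurable_fun setT e -> measurable_fun setT (eps n e).
Proof. by move=> me; apply: measurable_funM => //; exact: measurable_cst. Qed.

Let sum_le_eps (x : X) (D : nat -> set (X * R)) (E : set (X * R)) e :
  (forall x, (0 < e x)%R) -> (forall n, measurable (D n)) -> measurable E ->
  (forall n, kgraph k x (D n) <= (eps n e x)%:E) -> E `<=` \bigcup_n D n ->
  kgraph k x E <= (e x)%:E.
Proof.
move=> e0 mD mE De ED.
apply: (@le_trans _ _ (\sum_(0 <= n <oo) kgraph k x (D n))).
  exact: measure_sigma_subadditive.
apply: le_trans (epsilon_trick0 predT (ltW (e0 x))).
exact: lee_nneseries.
Qed.

Lemma inner_approx_closed (B : set (X * R)) :
  measurable B -> (forall x, closed [set y : R | B (x, y)]) ->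
  inner_approx B.
Proof.
move=> mB cB e me e0; exists B; split => // x.
by rewrite setDv measure0 lee_fin ltW.
Qed.

Lemma inner_approx_bigcap (B : nat -> set (X * R)) : (forall n, measurable (B n)) ->
  (forall n, inner_approx (B n)) -> inner_approx (\bigcap_n B n).
Proof.
move=> mB aB e me e0.
have /choice[K KP] n := aB n _ (measurable_eps n me) (eps_gt0 n e0).
have mK n : measurable (K n) by case: (KP n).
exists (\bigcap_n K n); split.
- exact: bigcapT_measurable.
- by move=> z Kz n _; have [_ KB _ _] := KP n; apply: KB; exact: Kz.
- move=> x; rewrite [X in closed X](_ : _ = \bigcap_n [set y : R | K n (x, y)]) //.
  by apply: closed_bigI => n _; case: (KP n).
- move=> x; apply: (@sum_le_eps x (fun n => B n `\` K n) _ e e0).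
  + by move=> n; exact: measurableD.
  + by apply: measurableD; exact: bigcapT_measurable.
  + by move=> n; case: (KP n).
  + move=> z [Bz nKz]; have [n nK] : exists n, ~ K n z.
      by apply: contrapT => /forallNP H; apply: nKz => n _; apply: contrapT; exact: H.
    by exists n => //; split => //; exact: Bz.
Qed.

(** An infinite union of closed sections need not be closed. It is truncated at the first index
    where the remaining mass at [x] is small enough; this index depends measurably on [x], and each
    section becomes a finite union. *)
Lemma inner_approx_bigcup (B : nat -> set (X * R)) : (forall n, measurable (B n)) ->
  (forall n, inner_approx (B n)) -> inner_approx (\bigcup_n B n).
Proof.
move=> mB aB e me e0.
(* The pieces together lose at most half of the error; the strict inequality that remains makes some
   truncation succeed. *)
pose e2 x := (e x / 2)%R.
have me2 : measurable_fun setT e2 by apply: measurable_funM => //; exact: measurable_cst.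
have e20 x : (0 < e2 x)%R by rewrite divr_gt0.
have /choice[K KP] n := aB n _ (measurable_eps n me2) (eps_gt0 n e20).
have mK n : measurable (K n) by case: (KP n).
pose L N := \bigcup_(i < N) K i.
have mL N : measurable (L N) by apply: bigcup_measurable.
pose D N := (\bigcup_n B n) `\` L N.
have mUB : measurable (\bigcup_n B n) by exact: bigcupT_measurable.
have mD N : measurable (D N) by exact: measurableD.
pose ok N x := kgraph k x (D N) <= (e x)%:E.
have mok N : measurable [set x | ok N x].
  rewrite -[X in measurable X]setTI; apply: measurable_lee => //.
    exact: measurable_kernel.
  exact/measurable_EFinP.
have exok x : exists N, ok N x.
  have cvD : kgraph k x (D N) @[N --> \oo] --> kgraph k x (\bigcap_N D N).
    apply: nonincreasing_cvg_mu => //.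
    - exact: pker_lty.
    - exact: bigcapT_measurable.
    - apply/nonincreasing_seqP => N; apply/subsetPset => z [Bz nL]; split => //.
      by move=> [i /= iN Ki]; apply: nL; exists i => //=; exact: ltnW.
  have De : kgraph k x (\bigcap_N D N) < (e x)%:E.
    apply: (@le_lt_trans _ _ (e2 x)%:E); last by rewrite lte_fin /e2 ltr_pdivrMr// ltr_pMr// ltr1n.
    apply: (@sum_le_eps x (fun n => B n `\` K n) _ e2 e20).
    + by move=> n; exact: measurableD.
    + exact: bigcapT_measurable.
    + by move=> n; case: (KP n).
    + move=> z Dz; have [[n _ Bn] _] := Dz 0%N Logic.I; exists n => //; split => // Kn.
      by have [_] := Dz n.+1 Logic.I; apply; exists n => /=.
  apply: contrapT => /forallNP nok.
  move: De; apply/negP; rewrite -leNgt -(cvg_lim _ cvD)//; apply: lime_ge.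
    by apply/cvg_ex; eexists; exact: cvD.
  by apply: nearW => N; rewrite leNgt; apply/negP => /ltW; exact: nok.
pose first N : set X := [set x | ok N x] `\` \bigcup_(i < N) [set x | ok i x].
have mfirst N : measurable (first N).
  by apply: measurableD => //; apply: bigcup_measurable.
have exfirst x : exists N, first N x.
  have [N okN Nmin] := ex_minnP (exok x); exists N; split => // -[i /= iN oki].
  by have := Nmin _ oki; rewrite leqNgt iN.
have first_inj x N N' : first N x -> first N' x -> N = N'.
  move=> [okN nN] [okN' nN']; case: (ltngtP N N') => // h; exfalso.
    by apply: nN'; exists N.
  by apply: nN; exists N'.
pose K' := \bigcup_N ((first N `*` setT) `&` L N).
have K'E N x y : first N x -> K' (x, y) <-> L N (x, y).
  move=> fN; split=> [[N' _ [[/= fN' _]]]|LN]; first by rewrite (first_inj _ _ _ fN fN').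
  by exists N.
exists K'; split.
- by apply: bigcupT_measurable => N; apply: measurableI => //; exact: measurableX.
- by move=> z [N _ [_ [i _ Kz]]]; exists i => //; have [_ KB _ _] := KP i; exact: KB.
- move=> x; have [N fN] := exfirst x.
  rewrite [X in closed X](_ : _ = \bigcup_(i < N) [set y : R | K i (x, y)]).
    by apply: closed_bigcup => [|i _]; [exact: finite_II|case: (KP i)].
  by apply/seteqP; split => y /=; [move/(K'E _ _ _ fN) => -[i iN Ky]|move=> [i iN Ky]; apply/(K'E _ _ _ fN)]; exists i.
- move=> x; have [N fN] := exfirst x; have [okN _] := fN.
  apply: le_trans okN; rewrite !kgraphE le_eqVlt; apply/orP; left; apply/eqP.
  congr (k x _); apply/seteqP; split => y /= [By nK]; split => // Ky; apply: nK.
    exact/(K'E _ _ _ fN).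
  exact/(K'E _ _ _ fN).
Qed.

(** Requiring the approximation of the complement as well makes this class closed under complements,
    which [inner_approx] alone does not give. *)
Let G : set (set (X * R)) :=
  [set B | [/\ measurable B, inner_approx B & inner_approx (~` B)]].

Let G_C B : G B -> G (~` B).
Proof. by move=> [mB aB aCB]; split => //; [exact: measurableC|rewrite setCK]. Qed.

Let G_U B : (forall n : nat, G (B n)) -> G (\bigcup_n B n).
Proof.
move=> GB; split.
- by apply: bigcupT_measurable => n; case: (GB n).
- by apply: inner_approx_bigcup => n; case: (GB n).
- rewrite setC_bigcup; apply: inner_approx_bigcap => n; have [mB _ aCB] := GB n => //.
  exact: measurableC.
Qed.

Let G_0 : G set0.
Proof.
split => //; first by apply: inner_approx_closed => // x; exact: closed0.
rewrite setC0; apply: inner_approx_closed => // x; exact: closedT.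
Qed.

Let G_I B C : G B -> G C -> G (B `&` C).
Proof.
move=> GB GC; rewrite -[_ `&` _]setCK setCI; apply: G_C.
by rewrite -bigcup2E; apply: G_U => -[|[|n]] /=; [exact: G_C|exact: G_C|exact: G_0].
Qed.

Let G_left (B : set X) : measurable B -> G (B `*` setT).
Proof.
have aB (C : set X) : measurable C -> inner_approx (C `*` setT).
  move=> mC; apply: inner_approx_closed => [|x]; first exact: measurableX.
  have [Cx|nCx] := pselect (C x).
    by rewrite [X in closed X](_ : _ = setT); [exact: closedT|apply/seteqP; split].
  rewrite [X in closed X](_ : _ = set0); first exact: closed0.
  by apply/seteqP; split => // y [/nCx].
move=> mB; split; [exact: measurableX|exact: aB|].
rewrite [X in inner_approx X](_ : _ = (~` B) `*` setT); first by apply: aB; exact: measurableC.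
by apply/seteqP; split => [[x y] nB|[x y] [/= nB _] []//]; split => // Bx; apply: nB.
Qed.

Let G_ray (t : R) : G (setT `*` [set` `]t, +oo[]).
Proof.
have aI (i : interval R) : closed [set` i] -> inner_approx (setT `*` [set` i]).
  move=> ci; apply: inner_approx_closed => [|x].
    by apply: measurableX => //; exact: measurable_itv.
  by rewrite [X in closed X](_ : _ = [set` i])//; apply/seteqP; split => y //= [].
split.
- by apply: measurableX => //; exact: measurable_itv.
- rewrite [X in inner_approx X](_ : _ =
      \bigcup_(n in [set: nat]) ([set: X] `*` [set` `[(t + n.+1%:R^-1)%R, +oo[])).
    apply: inner_approx_bigcup => n; last by apply: aI; exact: rray_closed.
    by apply: measurableX => //; exact: measurable_itv.
  apply/seteqP; split => [[x y] [_ /=]|[x y] [n _ [_ /=]]]; rewrite !in_itv/= !andbT.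
    move=> ty; have ty0 : (0 < y - t)%R by rewrite subr_gt0.
    have [n _ /(_ _ (leqnn n))/= nty] := near_infty_natSinv_lt (PosNum ty0).
    exists n => //; split => //=; rewrite in_itv/= andbT.
    by move: nty; rewrite /= ltrBrDl => /ltW.
  move=> ny; split => //; rewrite (lt_le_trans _ ny)//.
  by rewrite ltrDl invr_gt0 ltr0n.
- rewrite [X in inner_approx X](_ : _ = setT `*` [set` `]-oo, t]]).
    by apply: aI; exact: lray_closed.
  apply/seteqP; split => [[x y] nB|[x y] [_ /=]].
    by split => //=; rewrite in_itv/= leNgt; apply/negP => ty; apply: nB; split => //=; rewrite in_itv/= ty.
  by rewrite in_itv/= => yt [_ /=]; rewrite in_itv/= andbT ltNge yt.
Qed.

Lemma inner_approx_measurable B : measurable B -> inner_approx B.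
Proof.
suff : measurable `<=` G by move=> mG /mG[].
rewrite measurable_prod_measurableType; apply: smallest_sub.
  split.
  - exact: G_0.
  - by move=> C GC; rewrite setTD; exact: G_C.
  - exact: G_U.
move=> _ [C mC [D mD <-]].
have -> : C `*` D = (C `*` setT) `&` (setT `*` D).
  by apply/seteqP; split => -[x y] /=; [case|case=> [[? _] [_ ?]]].
apply: G_I; first exact: G_left.
suff : @measurable _ R `<=` [set D | G (setT `*` D)] by apply.
have -> : @measurable _ R = <<s @RGenOInfty.G R >> := RGenOInfty.measurableE R.
apply: smallest_sub.
  split.
  - by rewrite /= setX0; exact: G_0.
  - move=> E GE /=; rewrite setTD.
    have -> : [set: X] `*` ~` E = ~` ([set: X] `*` E); last exact: G_C.
    by apply/seteqP; split => [[x y] [_ /= nE] [_]//|[x y] nE]; split => //= Ey; apply: nE.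
  - move=> F GF /=; rewrite setX_bigcupr; exact: G_U.
by move=> _ [t ->]; exact: G_ray.
Qed.

End inner_approximation.

Section selection_real.
Local Open Scope ereal_scope.
Context d (X : measurableType d) (R : realType) (k : R.-pker X ~> R).

(* Inside [B] there is a [K] with closed sections that still have positive measure; [f x] is
   the infimum of the support of [k x] restricted to the section of [K]. *)
Lemma positive_selection_real (B : set (X * R)) : measurable B ->
  B `<=` setT `*` [set` `[0%R, +oo[] -> (forall x, 0 < kgraph k x B) ->
  exists2 f : X -> R, measurable_fun setT f & forall x, B (x, f x).
Proof.
move=> mB B0 kB.
have kfin x C : measurable C -> kgraph k x C \is a fin_num.
  by move=> mC; rewrite ge0_fin_numE//; exact: pker_lty.
(* A loss of at most half of the mass leaves [K] with positive mass at every [x]. *)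
pose e x := (fine (kgraph k x B) / 2)%R.
have [||K [mK KB cK Ke]] := @inner_approx_measurable _ X R k B mB e.
- apply: measurable_funM; last exact: measurable_cst.
  by apply: (measurableT_comp (fine_measurable measurableT)); exact: measurable_kernel.
- by move=> x; rewrite divr_gt0// fine_gt0// kB pker_lty.
have kK x : 0 < kgraph k x K.
  rewrite lt0e measure_ge0 andbT; apply/eqP => k0.
  have : kgraph k x B <= (e x)%:E.
    rewrite (le_trans _ (Ke x))// -[leRHS]add0e -k0.
    rewrite -measureU//; first by rewrite setDUK.
    - exact: measurableD.
    - by apply/seteqP; split => // z [? []].
  rewrite -(fineK (kfin x B mB)) lee_fin leNgt => /negP; apply.
  by rewrite /e ltr_pdivrMr// ltr_pMr ?ltr1n// fine_gt0// kB pker_lty.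
pose S (t : R) := K `&` (setT `*` [set` `]-oo, t]]).
have mS t : measurable (S t).
  by apply: measurableI => //; apply: measurableX => //; exact: measurable_itv.
pose E x : set R := [set ratr q | q in [set q : rat | 0 < kgraph k x (S (ratr q))]].
have SS s t : (s <= t)%R -> S s `<=` S t.
  move=> st [x y] [Ky [_ /= ys]]; split => //; split => //=.
  by move: ys; rewrite !in_itv/= => /le_trans; apply.
have E0 x : E x !=set0.
  apply: contrapT => nE; have := kK x; rewrite lt_neqAle => /andP[/eqP + _]; apply.
  have -> : K = \bigcup_n S n%:R.
    apply/seteqP; split => [[x' y] Ky|z [n _ []]//].
    exists (Num.bound `|y|) => //; split => //; split => //=.
    by rewrite in_itv/= ltW// (le_lt_trans (ler_norm y))// archi_boundP.
  apply/esym/eqP; rewrite -measure_le0.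
  apply: (@le_trans _ _ (\sum_(0 <= n <oo) kgraph k x (S n%:R))).
    by apply: measure_sigma_subadditive => //; exact: bigcupT_measurable.
  rewrite eseries0// => n _ _; apply/eqP; rewrite -measure_le0 leNgt; apply/negP => h.
  by apply: nE; exists n%:R; exists n%:R => //=; rewrite ratr_nat.
have lbE x : lbound (E x) 0%R.
  move=> _ [q /= kq <-]; rewrite leNgt; apply/negP => q0.
  move: kq; rewrite [X in kgraph k x X](_ : _ = set0) ?measure0 ?ltxx//.
  apply/seteqP; split => // -[x' y] [Ky [_ /=]]; rewrite in_itv/= => yq.
  have [_ /=] := B0 _ (KB _ Ky); rewrite in_itv/= andbT leNgt.
  by rewrite (le_lt_trans yq).
have hasE x : has_inf (E x) by split => //; exists 0%R; exact: lbE.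
pose f x := inf (E x).
have flt x t : (f x < t)%R <-> exists2 s, E x s & (s < t)%R.
  split; first by move=> /(inf_lt (hasE x).1)[s]; exists s.
  by move=> [s Es]; apply: le_lt_trans; apply: ge_inf => //; exact: (hasE x).2.
exists f.
  apply: (measurability _ (RGenInftyO.measurableE R)).
  move=> _ [_ [t ->] <-]; rewrite setTI.
  rewrite [X in measurable X](_ : _ = \bigcup_(q in [set: rat])
      [set x | (ratr q < t)%R /\ 0 < kgraph k x (S (ratr q))]).
    apply: bigcupT_measurable_rat => q.
    have [qt|qt] := boolP (ratr q < t)%R; last first.
      rewrite [X in measurable X](_ : _ = set0)//.
      by apply/seteqP; split => // x [].
    rewrite [X in measurable X](_ : _ = setT `&` [set x | 0 < kgraph k x (S (ratr q))]).
      apply: measurable_lte => //; exact: measurable_kernel.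
    by rewrite setTI; apply/seteqP; split => x //= [].
  apply/seteqP; split => x /=; rewrite in_itv/=.
    by move=> /flt[_ [q /= kq <-] qt]; exists q.
  by move=> [q _ [qt kq]]; apply/flt; exists (ratr q) => //; exists q.
(* Since the section of [K] is closed, it suffices that every ball about [f x] meets it. The mass up
   to a rational [p] just below [f x] is zero and up to a rational [q] just above it is positive, so
   the section has points between the two. *)
move=> x; apply: KB; apply: (cK x) => U /nbhs_ballP[r /= r0 rU].
have [s [q /= kq <-] qr] : exists2 s, E x s & (s < f x + r)%R by apply/flt; rewrite ltrDl.
have [p] : exists p : rat, (f x - r < ratr p < f x)%R.
  have : (f x - r < f x)%R by rewrite gtrBl.
  by move=> /rat_in_itvoo[p]; rewrite in_itv/=; exists p.
move=> /andP[rp pf].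
have kp : kgraph k x (S (ratr p)) = 0.
  apply/eqP; rewrite -measure_le0 leNgt; apply/negP => h.
  have /flt : exists2 s, E x s & (s < f x)%R by exists (ratr p) => //; exists p.
  by rewrite ltxx.
apply: contrapT => KU; move: kq; apply/negP; rewrite -leNgt -kp.
rewrite !kgraphE; have msec (C : set (X * R)) : measurable C -> measurable [set y : R | C (x, y)].
  move=> mC; rewrite -[X in measurable X]setTI.
  exact: (@pair1_measurable _ _ X R x measurableT C mC).
apply: le_measure; rewrite ?inE; [exact: msec|exact: msec|].
move=> y [Ky [_ /=]]; rewrite in_itv/= => yq; split => //; split => //=.
rewrite in_itv/= leNgt; apply/negP => py; apply: KU; exists y; split => //.
apply: rU; rewrite /ball/= ltr_distlC; apply/andP; split.
  exact: lt_trans py.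
exact: le_lt_trans qr.
Qed.

End selection_real.

Lemma positive_selection (R : realType) d (X : measurableType d) (A : ptopologicalType)
    (k : R.-pker X ~> borel A) (B : set (X * borel A)) :
  borel_space R A -> compact [set: A] -> measurable B ->
  (forall x, 0 < k x [set a | B (x, a)])%E ->
  exists2 f : X -> borel A, measurable_fun setT f & forall x, B (x, f x).
Proof.
move=> bA cA mB kB; have [s [g [ms mg sgK s01]]] := borel_retract bA cA.
(* The selection on the line takes infima and needs sections bounded below; no mass is lost, because
   [s] takes values in [0, 1]. *)
pose B' : set (X * R) := [set z | B (z.1, g z.2)] `&` (setT `*` [set` `[0, +oo[]).
have mB' : measurable B'.
  apply: measurableI; last by apply: measurableX => //; exact: measurable_itv.
  have mgX : measurable_fun setT (fun z : X * R => (z.1, g z.2)).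
    by apply: measurable_fun_pair => //; exact: (measurableT_comp mg measurable_snd).
  by rewrite -[X in measurable X]setTI; exact: mgX.
have [||f mf fB] := @positive_selection_real _ X R (kpush k ms) B' mB'.
- by move=> z [].
- move=> x; rewrite kgraphE kpushE [X in k x X](_ : _ = [set a | B (x, a)])//.
  apply/seteqP; split => [a []|a Ba]; first by rewrite /= sgK.
  by split; rewrite /= ?sgK//; split => //=; rewrite in_itv/= andbT; case/andP: (s01 a).
by exists (g \o f); [exact: (measurableT_comp mg mf)|move=> x; case: (fB x)].
Qed.

(** * Controlled chains and occupation measures *)

Section expectations.
Local Open Scope ereal_scope.
Context (R : realType) (dX : measure_display) (X : measurableType dX)
  (A : ptopologicalType) (d : nat).
Variable M : control_model R X A d.
Local Notation Tr := (trajectory X A).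
Local Notation H := (hist X A).

Definition expected_next (F : X -> \bar R) (z : X * borel A) : \bar R :=
  \int[trans M z]_y F y.

Lemma expected_next_ge0 F z : (forall x, 0 <= F x) -> 0 <= expected_next F z.
Proof. by move=> F0; exact: integral_ge0. Qed.

Lemma measurable_expected_next F : (forall x, 0 <= F x) -> measurable_fun setT F ->
  measurable_fun setT (expected_next F).
Proof.
by move=> F0 mF; apply: measurable_fun_integral_kernel => // U mU; exact: measurable_kernel.
Qed.

Definition state_action n (w : Tr) : X * borel A := (state n w, action n w).

Lemma measurable_state_action n : measurable_fun setT (state_action n).
Proof. by apply: measurable_fun_pair; [exact: measurable_state|exact: measurable_action]. Qed.

Section one_policy.
Variable p : policy M.

Lemma integral_init (F : X -> \bar R) : (forall x, 0 <= F x) -> measurable_fun setT F ->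
  \int[strategic p]_w F (state 0 w) = \int[init M]_x F x.
Proof.
move=> F0 mF; rewrite -(integral_mpush (strategic p) (@measurable_state _ X A 0))//.
by apply: eq_integral_measure => B mB; have [+ _ _] := strategicP p; exact.
Qed.

Lemma integral_action n (F : H n * borel A -> \bar R) : (forall x, 0 <= F x) ->
  measurable_fun setT F ->
  \int[strategic p]_w F (history n w, action n w) =
  \int[strategic p]_w \int[pol p n (history n w)]_a F (history n w, a).
Proof.
have [_ c1 _] := strategicP p.
apply: (integral_conditional_law _ _ (c1 n)).
- exact: measurable_history.
- exact: measurable_action.
Qed.

Lemma integral_transition n (F : H n.+1 -> \bar R) : (forall x, 0 <= F x) ->
  measurable_fun setT F ->
  \int[strategic p]_w F (history n.+1 w) =
  \int[strategic p]_w
    \int[trans M (state_action n w)]_x F (history n w, action n w, x).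
Proof.
have [_ _ c2] := strategicP p => F0 mF.
transitivity (\int[strategic p]_w
  \int[transition_of M n (history n w, action n w)]_x F (history n w, action n w, x)).
  apply: (integral_conditional_law (k := transition_of M n) _ _ (c2 n)) => //.
  - by apply: measurable_fun_pair; [exact: measurable_history|exact: measurable_action].
  - exact: measurable_state.
by apply: eq_integral => w _; rewrite /state_action -last_state_history.
Qed.

Lemma integral_next n (F : X -> \bar R) : (forall x, 0 <= F x) -> measurable_fun setT F ->
  \int[strategic p]_w F (state n.+1 w) =
  \int[strategic p]_w expected_next F (state_action n w).
Proof.
move=> F0 mF; pose Fl (h : H n.+1) := F (last_state h).
transitivity (\int[strategic p]_w Fl (history n.+1 w)) => //.
have mFl : measurable_fun setT Fl.
  exact: (measurableT_comp mF (@measurable_last_state _ X A n.+1)).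
by rewrite integral_transition//; move=> h; exact: F0.
Qed.

End one_policy.

(** The history of index [n] involves only the actions before time [n]. This compares a policy with
    the one that departs from it at time [n]. *)
Lemma integral_history_unique (p q : policy M) n :
  (forall i (h : H i) C, (i < n)%N -> measurable C -> pol p i h C = pol q i h C) ->
  forall F : H n -> \bar R, (forall x, 0 <= F x) -> measurable_fun setT F ->
  \int[strategic p]_w F (history n w) = \int[strategic q]_w F (history n w).
Proof.
elim: n => [|n ih] pq F F0 mF; first by rewrite !integral_init.
rewrite !integral_transition//.
pose G (ha : H n * borel A) := \int[trans M (last_state ha.1, ha.2)]_x F (ha, x).
have G0 ha : 0 <= G ha by exact: integral_ge0.
have mG : measurable_fun setT G.
  by apply: (@measurable_fun_integral_finite_kernel _ _ _ _ _ F (transition_of M n)).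
have E (r : policy M) : \int[strategic r]_w \int[trans M (state_action n w)]_x F (history n w, action n w, x) =
    \int[strategic r]_w \int[pol r n (history n w)]_a G (history n w, a).
  rewrite -(@integral_action r n G)//; apply: eq_integral => w _.
  by rewrite /G /state_action /= last_state_history.
rewrite !E (ih _ (fun h => \int[pol p n h]_a G (h, a))).
- apply: eq_integral => w _; apply: eq_integral_measure => C mC; exact: pq.
- by move=> i h C i_n; apply: pq; exact: ltnW.
- by move=> h; exact: integral_ge0.
- exact: measurable_fun_integral_finite_kernel.
Qed.

Section stationary_kernel.
Variable k : R.-pker X ~> borel A.

Definition expected_action (G : X * borel A -> \bar R) (x : X) : \bar R :=
  \int[k x]_a G (x, a).

Lemma expected_action_ge0 G x : (forall z, 0 <= G z) -> 0 <= expected_action G x.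
Proof. by move=> G0; exact: integral_ge0. Qed.

Lemma measurable_expected_action G : (forall x, 0 <= G x) -> measurable_fun setT G ->
  measurable_fun setT (expected_action G).
Proof. by move=> G0 mG; exact: measurable_fun_integral_finite_kernel. Qed.

Definition chain_step (F : X -> \bar R) : X -> \bar R := expected_action (expected_next F).

Lemma chain_iter_ge0 n F x : (forall x, 0 <= F x) -> 0 <= iter n chain_step F x.
Proof.
move=> F0; elim: n x => //= n ih x.
by apply: expected_action_ge0 => z; exact: expected_next_ge0.
Qed.

Lemma measurable_chain_iter n F : (forall x, 0 <= F x) -> measurable_fun setT F ->
  measurable_fun setT (iter n chain_step F).
Proof.
move=> F0 mF; elim: n => //= n ih; apply: measurable_expected_action.
  by move=> z; apply: expected_next_ge0 => x; exact: chain_iter_ge0.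
by apply: measurable_expected_next => // x; exact: chain_iter_ge0.
Qed.

(** Covers stationary policies, with [s = 0], as well as policies that turn to [k] at time [s]. *)
Definition uses_kernel_from s (p : policy M) :=
  forall n (h : H n) C, (s <= n)%N -> measurable C -> pol p n h C = k (last_state h) C.

Lemma integral_kernel_action s p n (G : X * borel A -> \bar R) :
  uses_kernel_from s p -> (s <= n)%N -> (forall z, 0 <= G z) -> measurable_fun setT G ->
  \int[strategic p]_w G (state_action n w) = \int[strategic p]_w expected_action G (state n w).
Proof.
move=> ps sn G0 mG.
have := @integral_action p n (fun ha => G (last_state ha.1, ha.2)).
rewrite /= => E; transitivity (\int[strategic p]_w G (last_state (history n w), action n w)).
  by apply: eq_integral => w _; rewrite last_state_history.
rewrite E//.
- apply: eq_integral => w _; rewrite last_state_history /expected_action.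
  by apply: eq_integral_measure => C mC; rewrite ps// last_state_history.
- apply: (measurableT_comp mG); apply: measurable_fun_pair => //=.
  exact: (measurableT_comp (@measurable_last_state _ X A n) measurable_fst).
Qed.

Lemma integral_chain_iter s p n (F : X -> \bar R) : uses_kernel_from s p ->
  (forall x, 0 <= F x) -> measurable_fun setT F ->
  \int[strategic p]_w F (state (n + s) w) =
  \int[strategic p]_w iter n chain_step F (state s w).
Proof.
move=> ps; elim: n F => // n ih F F0 mF.
rewrite addSn integral_next// (integral_kernel_action ps) ?leq_addl//.
- rewrite ih//.
  + by rewrite -iterSr.
  + by move=> x; apply: expected_action_ge0 => z; exact: expected_next_ge0.
  + apply: measurable_expected_action; last exact: measurable_expected_next.
    by move=> z; exact: expected_next_ge0.
- by move=> z; exact: expected_next_ge0.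
- exact: measurable_expected_next.
Qed.

Hypothesis k_adm : forall x, k x (adm M x) = 1.

Let stationary_pol n : R.-pker H n ~> borel A :=
  kreindex k (@measurable_last_state _ X A n).

Definition stationary_policy : policy M :=
  Policy (pol := stationary_pol) (fun n h => k_adm (last_state h)).

Lemma stationary_policyP : stationary stationary_policy.
Proof. by exists k. Qed.

(** Switched policies make quantities computed with [k] from the state at time [s] of an arbitrary
    [p] into quantities of one policy, to which the absorption hypotheses apply. *)
Definition switch_pol (p : policy M) (s n : nat) : R.-pker H n ~> borel A :=
  if (n < s)%N then pol p n else stationary_pol n.

Lemma switch_pol_adm p s n (h : H n) : switch_pol p s n h (adm M (last_state h)) = 1.
Proof. by rewrite /switch_pol; case: ifP => _; [exact: pol_adm|exact: k_adm]. Qed.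

Definition switch_policy p s : policy M := Policy (pol := switch_pol p s) (@switch_pol_adm p s).

Lemma switch_policy_from p s : uses_kernel_from s (switch_policy p s).
Proof. by move=> n h C sn mC; rewrite /= /switch_pol ltnNge sn. Qed.

Lemma integral_switch_policy p s n (F : X -> \bar R) :
  (forall x, 0 <= F x) -> measurable_fun setT F ->
  \int[strategic (switch_policy p s)]_w F (state (n + s) w) =
  \int[strategic p]_w iter n chain_step F (state s w).
Proof.
move=> F0 mF; rewrite (integral_chain_iter n (@switch_policy_from p s))//.
have mL : measurable_fun setT (fun h : H s => iter n chain_step F (last_state h)).
  apply: (measurableT_comp _ (@measurable_last_state _ X A s)).
  exact: measurable_chain_iter.
have E (r : policy M) : \int[strategic r]_w iter n chain_step F (state s w) =
   \int[strategic r]_w iter n chain_step F (last_state (history s w)).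
  by apply: eq_integral => w _; rewrite last_state_history.
rewrite !E; apply: (integral_history_unique _ (F := fun h => iter n chain_step F (last_state h))) => //.
- by move=> i h C i_s mC; rewrite /= /switch_pol i_s.
- by move=> h; exact: chain_iter_ge0.
Qed.

Lemma stationary_policy_from : uses_kernel_from 0 stationary_policy.
Proof. by []. Qed.

End stationary_kernel.

End expectations.

Lemma nneseries_shift (R : realType) (f : nat -> \bar R) : (forall n, 0 <= f n)%E ->
  (\sum_(0 <= n <oo) f n = f 0%N + \sum_(0 <= n <oo) f n.+1)%E.
Proof.
move=> f0.
have cv : (fun n => \sum_(0 <= i < n) f i.+1)%E @ \oo --> (\sum_(0 <= n <oo) f n.+1)%E.
  by apply: is_cvg_nneseries => n _ _.
have cvD : (fun n => f 0%N + \sum_(0 <= i < n) f i.+1)%E @ \oo -->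
    (f 0%N + \sum_(0 <= n <oo) f n.+1)%E.
  apply: cvgeD => //; last exact: cvg_cst.
  by rewrite ge0_adde_def// inE// nneseries_ge0.
apply/cvg_lim => //; rewrite -(cvg_shiftS (fun n => \sum_(0 <= i < n) f i)%E).
by under eq_fun do rewrite big_nat_recl//.
Qed.

Lemma integral_mrestr d (T : measurableType d) (R : realType)
    (m : {measure set T -> \bar R}) (D : set T) (mD : measurable D) (f : T -> \bar R) :
  (forall x, 0 <= f x)%E -> measurable_fun setT f ->
  (\int[mrestr m mD]_x f x = \int[m]_x ((\1_D x)%:E * f x))%E.
Proof.
have m1 : measurable_fun setT (fun x => (\1_D x)%:E : \bar R).
  by apply/measurable_EFinP; exact: measurable_indic.
have D0 x : (0 <= (\1_D x)%:E :> \bar R)%E by rewrite lee_fin.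
move: f; apply: ge0_fun_ind.
- move=> A mA; rewrite -measure_as_integral// [LHS]/(m (A `&` D)).
  rewrite [LHS]measure_as_integral; last exact: measurableI.
  by apply: eq_integral => x _; rewrite setIC indicI.
- move=> f g f0 mf g0 mg ihf ihg; rewrite ge0_integralD// ihf ihg -ge0_integralD//.
  + by apply: eq_integral => x _; rewrite ge0_muleDr.
  + by move=> x _; rewrite mule_ge0.
  + exact: emeasurable_funM.
  + by move=> x _; rewrite mule_ge0.
  + exact: emeasurable_funM.
- move=> r f r0 f0 mf ih; rewrite ge0_integralZl// ih -ge0_integralZl//.
  + by apply: eq_integral => x _; rewrite muleCA.
  + exact: emeasurable_funM.
  + by move=> x _; rewrite mule_ge0.
- move=> f f0 mf ndf ih; rewrite monotone_convergence//.
  have -> : (fun n => \int[mrestr m mD]_x f n x)%E = fun n => (\int[m]_x ((\1_D x)%:E * f n x))%E.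
    by apply/funext => n; exact: ih.
  rewrite -monotone_convergence//.
  + apply: eq_integral => x _; rewrite -limeMl//.
    by apply: ereal_nondecreasing_is_cvgn; exact: ndf.
  + by move=> n; exact: emeasurable_funM.
  + by move=> n x _; rewrite mule_ge0.
  + by move=> x _ a b ab; rewrite lee_wpmul2l//; exact: ndf.
Qed.

Lemma pker_setC_eq0 d d' (T : measurableType d) (U : measurableType d') (R : realType)
    (k : R.-pker T ~> U) t A : measurable A -> k t A = 1%E -> k t (~` A) = 0%E.
Proof.
move=> mA kA; have mCA := measurableC mA.
have : k t (A `|` ~` A) = (k t A + k t (~` A))%E by apply: measureU => //; exact: setICr.
rewrite setUv prob_kernel kA -(fineK (_ : k t (~` A) \is a fin_num)).
  by rewrite -EFinD => -[] /eqP; rewrite addrC -subr_eq subrr => /eqP <-.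
by rewrite ge0_fin_numE// pker_lty.
Qed.

Section occupation.
Local Open Scope ereal_scope.
Context (R : realType) (dX : measure_display) (X : measurableType dX)
  (A : ptopologicalType) (d : nat).
Variable M : control_model R X A d.
Local Notation Tr := (trajectory X A).
Local Notation H := (hist X A).
Variable D : set X.
Hypothesis absD : absorbing M D.

Let mD : measurable D. Proof. by case: absD. Qed.

(** Depends on the present state only, whereas survival up to time [t] concerns all states so far.
    The two agree almost surely because [D] is absorbing. *)
Definition live (x : X) : \bar R := (\1_(~` D) x)%:E.

Lemma live_ge0 x : 0 <= live x. Proof. by rewrite lee_fin. Qed.

Lemma live_le1 x : live x <= 1.
Proof. by rewrite lee_fin indicE; case: (_ \in _). Qed.

Lemma liveD x : D x -> live x = 0.
Proof. by move=> Dx; rewrite /live indicE memNset//= => /(_ Dx). Qed.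

Lemma liveN x : ~ D x -> live x = 1.
Proof. by move=> nDx; rewrite /live indicE mem_set. Qed.

Lemma measurable_live : measurable_fun setT live.
Proof. by apply/measurable_EFinP; apply: measurable_indic; exact: measurableC. Qed.

Lemma expected_next_vanish F z : (forall x, 0 <= F x) -> measurable_fun setT F ->
  (forall x, D x -> F x = 0) -> D z.1 -> expected_next M F z = 0.
Proof.
move=> F0 mF FD Dz; rewrite /expected_next.
rewrite (@ge0_ae_eq_integral _ _ _ (trans M z) setT F (cst 0))// ?integral0//.
exists (~` D); split; first exact: measurableC.
  apply: pker_setC_eq0 => //; have [_ + _] := absD.
  by move=> /(_ z.1 z.2 Dz)[]; rewrite -surjective_pairing.
by move=> x /= nF Dx; apply: nF => _; exact: FD.
Qed.

Lemma integral_live_next p n (F : X -> \bar R) : (forall x, 0 <= F x) ->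
  measurable_fun setT F -> (forall x, D x -> F x = 0) ->
  \int[strategic p]_w F (state n.+1 w) =
  \int[strategic (M := M) p]_w (live (state n w) * expected_next M F (state_action n w)).
Proof.
move=> F0 mF FD; rewrite integral_next//; apply: eq_integral => w _.
have [Dw|nDw] := pselect (D (state n w)).
  by rewrite liveD// mul0e expected_next_vanish.
by rewrite liveN// mul1e.
Qed.

Lemma ae_absorbed (p : policy M) :
  {ae strategic p, forall w, forall t, D (state t w) -> D (state t.+1 w)}.
Proof.
apply: ae_foralln => t.
pose B : set (H t.+1) := [set h | D (last_state h.1.1) /\ ~ D h.2].
have mB : measurable B.
  have mf : measurable_fun [set: H t.+1] (fun h : H t.+1 => (last_state h.1.1, h.2) : (X * X)%type).
    apply: measurable_fun_pair => //.
    apply: (measurableT_comp (@measurable_last_state _ X A t)).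
    exact: (measurableT_comp measurable_fst measurable_fst).
  rewrite -[X in measurable X]setTI; apply: (mf measurableT (D `*` ~` D)).
  by apply: measurableX => //; exact: measurableC.
have mBw : measurable (history t.+1 @^-1` B).
  by rewrite -[X in measurable X]setTI; exact: (@measurable_history _ X A t.+1).
exists (history t.+1 @^-1` B); split => //; last first.
  move=> w /=; rewrite /B/= last_state_history => h; split; apply: contrapT => Dw; apply: h => // _.
  by apply: contrapT.
rewrite measure_as_integral//.
rewrite [LHS](_ : _ = \int[strategic p]_w (\1_B (history t.+1 w))%:E); last first.
  by apply: eq_integral => w _; rewrite !indicE; congr (_%:R%:E); congr nat_of_bool;
    apply/idP/idP; rewrite !inE.
rewrite (@integral_transition _ _ _ _ _ M p t (fun h => (\1_B h)%:E))//; last first.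
  by apply/measurable_EFinP; exact: measurable_indic.
rewrite integral0_eq// => w _.
have [Dw|nDw] := pselect (D (state t w)); last first.
  rewrite integral0_eq// => x _; rewrite indicE memNset//.
  by rewrite /B/= last_state_history => -[].
rewrite (eq_integral live).
  by apply: (@expected_next_vanish live (state_action t w)) => //;
    [exact: live_ge0|exact: measurable_live|exact: liveD].
move=> x _; rewrite indicE /live indicE; congr (_%:R%:E); congr nat_of_bool.
by apply/idP/idP; rewrite !inE /B/= last_state_history; [case|].
Qed.

Definition alive t : set Tr := [set w | t%:R%:E < hitting_time R D w].

Lemma aliveE t w : alive t w <-> forall s, (s <= t)%N -> ~ D (state s w).
Proof.
rewrite /alive/= /hitting_time; case: pselect => [ex|nex]; last first.
  by split => [_ s _ Ds|_]; [apply: nex; exists s; rewrite inE|exact: ltry].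
case: ex_minnP => m Dm minm; rewrite lte_fin ltr_nat; split => [tm s st Ds|h].
  have : (m <= s)%N by apply: minm; rewrite inE.
  by rewrite leqNgt (leq_ltn_trans st tm).
by rewrite ltnNge; apply/negP => mt; apply: (h m mt); rewrite inE in Dm.
Qed.

Lemma measurable_alive t : measurable (alive t).
Proof.
rewrite (_ : alive t = \bigcap_(s in [set s | (s <= t)%N]) (state s @^-1` (~` D))).
  apply: bigcap_measurable => [|s _]; first by exists 0%N.
  rewrite -[X in measurable X]setTI; apply: (@measurable_state _ X A s) => //.
  exact: measurableC.
by apply/seteqP; split => w /aliveE.
Qed.

Lemma ae_alive (p : policy M) :
  {ae strategic p, forall w, forall t, (\1_(alive t) w)%:E = live (state t w)}.
Proof.
have := ae_absorbed p; apply: filterS => w absw t.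
rewrite /live !indicE; congr (_%:R%:E); congr nat_of_bool; apply/idP/idP; rewrite !inE.
  by move=> /aliveE; exact.
move=> nDt; apply/aliveE => s st Ds; apply: nDt.
by rewrite -(subnK st); elim: (t - s)%N => // i ih; rewrite addSn; exact: absw.
Qed.

Lemma hitting_time_series w : hitting_time R D w = \sum_(0 <= t <oo) (\1_(alive t) w)%:E.
Proof.
have a1 t : alive t w -> (\1_(alive t) w)%:E = 1 :> \bar R.
  by move=> aw; rewrite indicE mem_set.
have [[m Dm]|nD] := pselect (exists m, D (state m w)).
  have /ex_minnP[n Dn minn] : exists n, state n w \in D by exists m; rewrite inE.
  have an t : alive t w <-> (t < n)%N.
    split=> [/aliveE h|tn]; first by rewrite ltnNge; apply/negP => /h; rewrite inE in Dn.
    by apply/aliveE => s st Ds; have := minn s; rewrite inE => /(_ Ds); rewrite leqNgt (leq_ltn_trans st).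
  have -> : hitting_time R D w = n%:R%:E.
    rewrite /hitting_time; case: pselect => [ex|[]]; last by exists n.
    case: ex_minnP => n' Dn' minn'; congr (_%:R%:E); apply/eqP.
    by rewrite eqn_leq minn//= minn'.
  rewrite (nneseries_split 0 n) ?add0n; last by move=> k _; rewrite lee_fin.
  rewrite [X in _ + X]eseries0; last first.
    by move=> i ni _; rewrite indicE memNset// => /an; rewrite ltnNge ni.
  rewrite adde0 (eq_big_nat _ _ (F2 := fun=> 1)); last first.
    by move=> i /andP[_ ni]; apply: a1; apply/an.
  by rewrite big_mkord sumEFin sumr_const card_ord.
have -> : hitting_time R D w = +oo.
  by rewrite /hitting_time; case: pselect => // ex; exfalso; apply: nD; case: ex => n; rewrite inE; exists n.
apply/esym/eq_infty => r; apply: (@le_trans _ _ (Num.bound `|r|)%:R%:E).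
  by rewrite lee_fin ltW// (le_lt_trans (ler_norm r))// archi_boundP.
rewrite (_ : _%:R%:E = \sum_(0 <= t < Num.bound `|r|) (\1_(alive t) w)%:E); last first.
  rewrite (eq_big_nat _ _ (F2 := fun=> 1)).
    by rewrite big_mkord sumEFin sumr_const card_ord.
  by move=> t _; apply: a1; apply/aliveE => s _ Ds; apply: nD; exists s.
by apply: nneseries_lim_ge => n _; rewrite lee_fin.
Qed.

Definition survival (p : policy M) : \bar R :=
  \sum_(0 <= t <oo) \int[strategic p]_w live (state t w).

Lemma measurable_live_state t : measurable_fun [set: Tr] (fun w => live (state t w)).
Proof. exact: (measurableT_comp measurable_live (@measurable_state _ X A t)). Qed.

Lemma integral_alive p t : \int[strategic (M := M) p]_w (\1_(alive t) w)%:E =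
  \int[strategic p]_w live (state t w).
Proof.
apply: ge0_ae_eq_integral => //.
- by apply/measurable_EFinP; apply: measurable_indic; exact: measurable_alive.
- exact: measurable_live_state.
- by move=> w _; exact: live_ge0.
- by have := ae_alive p; apply: filterS => w h _; exact: h.
Qed.

Lemma survivalE p : survival p = \int[strategic p]_w hitting_time R D w.
Proof.
under eq_integral do rewrite hitting_time_series.
rewrite integral_nneseries.
- by apply: eq_eseriesr => t _; rewrite integral_alive.
- exact: measurableT.
- by move=> t; apply/measurable_EFinP; apply: measurable_indic; exact: measurable_alive.
- by move=> t w _; rewrite lee_fin.
Qed.

Lemma survival_lty p : survival p < +oo.
Proof. by rewrite survivalE; have [_ _] := absD; exact. Qed.

Lemma strategic_alive p t : strategic p (alive t) = \int[strategic (M := M) p]_w live (state t w).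
Proof. by rewrite measure_as_integral ?integral_alive//; exact: measurable_alive. Qed.

Let live_set t : set Tr := [set w | ~ D (state t w)].

Let measurable_live_set t : measurable (live_set t).
Proof.
rewrite -[X in measurable X]setTI; apply: (@measurable_state _ X A t measurableT (~` D)).
exact: measurableC.
Qed.

(** The occupancy as a bundled measure, so that functions can be integrated against it: the sum over
    [t] of the laws of the state-action pair at time [t], restricted to states outside [D]. *)
Definition occupation (p : policy M) : {measure set (X * borel A) -> \bar R} :=
  mseries (fun t => mpush (mrestr (strategic p) (measurable_live_set t))
                          (@measurable_state_action _ X A t)) 0.

Lemma integral_occupation p (F : X * borel A -> \bar R) : (forall z, 0 <= F z) ->
  measurable_fun setT F ->
  \int[occupation p]_z F z =
  \sum_(0 <= t <oo) \int[strategic p]_w (live (state t w) * F (state_action t w)).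
Proof.
move=> F0 mF; rewrite /occupation ge0_integral_measure_series//.
apply: eq_eseriesr => t _; rewrite integral_mpush// integral_mrestr//.
exact: (measurableT_comp mF (@measurable_state_action _ X A t)).
Qed.

Lemma measurable_live_mul t (F : X * borel A -> \bar R) : measurable_fun setT F ->
  measurable_fun [set: Tr] (fun w => live (state t w) * F (state_action t w)).
Proof.
move=> mF; apply: emeasurable_funM; first exact: measurable_live_state.
exact: (measurableT_comp mF (@measurable_state_action _ X A t)).
Qed.

Lemma occupationE p G : measurable G -> occupancy D p G = occupation p G.
Proof.
move=> mG; rewrite measure_as_integral// integral_occupation//; last first.
  by apply/measurable_EFinP; exact: measurable_indic.
have mi : measurable_fun setT (fun z => (\1_G z)%:E : \bar R).
  by apply/measurable_EFinP; exact: measurable_indic.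
rewrite /occupancy integral_nneseries; last 3 first.
- exact: measurableT.
- move=> t; under eq_fun do rewrite EFinM; apply: emeasurable_funM.
    by apply/measurable_EFinP; apply: measurable_indic; exact: measurable_alive.
  exact: (measurableT_comp mi (@measurable_state_action _ X A t)).
- by move=> t w _; rewrite lee_fin mulr_ge0.
apply: eq_eseriesr => t _; apply: ge0_ae_eq_integral => //.
- under eq_fun do rewrite EFinM; apply: emeasurable_funM.
    by apply/measurable_EFinP; apply: measurable_indic; exact: measurable_alive.
  exact: (measurableT_comp mi (@measurable_state_action _ X A t)).
- exact: (measurable_live_mul t mi).
- by move=> w _; rewrite mule_ge0 ?live_ge0// lee_fin.
- have := ae_alive p; apply: filterS => w h _; rewrite EFinM; congr (_ * _).
  exact: h.
Qed.

Lemma integral_occupation_fst p (F : X -> \bar R) : (forall z, 0 <= F z) ->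
  measurable_fun setT F -> (forall x, D x -> F x = 0) ->
  \int[occupation p]_z F z.1 = \sum_(0 <= t <oo) \int[strategic p]_w F (state t w).
Proof.
move=> F0 mF FD; rewrite integral_occupation//; last first.
  exact: (measurableT_comp mF measurable_fst).
apply: eq_eseriesr => t _; apply: eq_integral => w _ /=.
have [Dw|nDw] := pselect (D (state t w)); first by rewrite liveD// mul0e FD.
by rewrite liveN// mul1e.
Qed.

Lemma occupation_total p : occupation p setT = survival p.
Proof.
rewrite measure_as_integral// integral_occupation//; last first.
  by apply/measurable_EFinP; exact: measurable_indic.
by apply: eq_eseriesr => t _; apply: eq_integral => w _; rewrite indicT mule1.
Qed.

(** Conservation of flow: the state at time 0 has law [init], and every later state is drawn from
    the transition at the preceding time. As [F] vanishes on [D], states already absorbed contribute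
    nothing. *)
Lemma occupation_balance p (F : X -> \bar R) : (forall z, 0 <= F z) ->
  measurable_fun setT F -> (forall x, D x -> F x = 0) ->
  \int[occupation p]_z F z.1 =
  \int[init M]_x F x + \int[occupation p]_z expected_next M F z.
Proof.
move=> F0 mF FD; rewrite integral_occupation_fst// nneseries_shift; last first.
  by move=> t; exact: integral_ge0.
rewrite integral_init//; congr (_ + _); rewrite integral_occupation//.
- by apply: eq_eseriesr => t _; exact: integral_live_next.
- by move=> z; exact: expected_next_ge0.
- exact: measurable_expected_next.
Qed.

End occupation.

(** * Stationary policies with the occupation measure of a mixture *)

Lemma nneseries_cvg0 (R : realType) (f : nat -> \bar R) : (forall n, 0 <= f n)%E ->
  (\sum_(0 <= n <oo) f n < +oo)%E -> f @ \oo --> 0%E.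
Proof.
move=> f0 foo; have tail := nneseries_tail_cvg foo (fun k _ => f0 k).
apply: (squeeze_cvge _ (cvg_cst 0%E) tail); apply: nearW => n; rewrite f0/=.
rewrite (@nneseries_split _ f n 1)//.
by rewrite addn1 big_nat1 leeDl// nneseries_ge0.
Qed.

Lemma pker_setC_eq1 d d' (T : measurableType d) (U : measurableType d') (R : realType)
    (k : R.-pker T ~> U) t A : measurable A -> k t A = 0%E -> k t (~` A) = 1%E.
Proof.
move=> mA kA; have mCA := measurableC mA.
have : k t (A `|` ~` A) = (k t A + k t (~` A))%E by apply: measureU => //; exact: setICr.
by rewrite setUv prob_kernel kA add0e.
Qed.

(** A disintegration respects the constraint [K] only almost everywhere, while a policy must respect
    it at every state. On the exceptional states, which form a measurable set, the kernel is
    replaced by the Dirac mass at [f]. *)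
Lemma kernel_correction (R : realType) d d' (X : measurableType d) (Y : measurableType d')
    (k0 : R.-pker X ~> Y) (K : set (X * Y)) (f : X -> Y) :
  measurable K -> measurable_fun setT f -> (forall x, K (x, f x)) ->
  exists2 k : R.-pker X ~> Y, (forall x, k x [set y | K (x, y)] = 1%E) &
    forall x, k0 x [set y | K (x, y)] = 1%E -> forall C, k x C = k0 x C.
Proof.
move=> mK mf Kf.
pose good x := k0 x [set y | K (x, y)] == 1%E.
pose k (x : X) : {measure set Y -> \bar R} := if good x then k0 x else \d_(f x).
have mgood : measurable_fun setT good.
  apply: (measurable_fun_bool true); rewrite setTI.
  rewrite [X in measurable X](_ : _ = (fun x => kgraph k0 x K) @^-1` [set 1%E]).
    rewrite -[X in measurable X]setTI.
    exact: (measurable_kernel (kgraph k0) K mK measurableT _ (emeasurable_set1 _)).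
  by apply/seteqP; split => x /= => [/eqP|/eqP].
have mk U : measurable U -> measurable_fun [set: X] (k ^~ U).
  move=> mU; rewrite (_ : k ^~ U = fun x => if good x then k0 x U else (\1_U (f x))%:E).
    apply: measurable_fun_ifT => //; first exact: measurable_kernel.
    by apply/measurable_EFinP; exact: (measurableT_comp (measurable_indic mU) mf).
  by apply/funext => x; rewrite /k; case: ifP.
have k1 x : k x setT = 1%E.
  by rewrite /k; case: ifP => _; [exact: prob_kernel|exact: diracT].
exists (mk_pker mk k1) => x /=; rewrite /mk_pker_fun /k.
  by case: ifPn => [/eqP//|_]; rewrite /= diracE mem_set.
by move=> kK C; rewrite /good kK eqxx.
Qed.

Section stationarization.
Local Open Scope ereal_scope.
Context (R : realType) (dX : measure_display) (X : measurableType dX)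
  (A : ptopologicalType) (d : nat).
Variable M : control_model R X A d.
Variable D : set X.
Hypothesis absD : absorbing M D.
Hypothesis bA : borel_space R A.
Hypothesis cA : compact [set: A].
Hypothesis mM : measurability_conditions M.

Local Notation H := (hist X A).
Local Notation live := (@live R _ X D).
Let mlive : measurable_fun setT live. Proof. exact: (measurable_live absD). Qed.

Section kernel.
Variable k : R.-pker X ~> borel A.
Local Notation step := (chain_step M k).

Lemma chain_step_vanish F x : (forall x, 0 <= F x) -> measurable_fun setT F ->
  (forall x, D x -> F x = 0) -> D x -> step F x = 0.
Proof.
move=> F0 mF FD Dx; rewrite /chain_step /expected_action integral0_eq// => a _.
exact: (expected_next_vanish absD).
Qed.

Lemma chain_iter_vanish n F x : (forall x, 0 <= F x) -> measurable_fun setT F ->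
  (forall x, D x -> F x = 0) -> D x -> iter n step F x = 0.
Proof.
move=> F0 mF FD; elim: n x => [|n ih] x Dx; first exact: FD.
rewrite iterS; apply: chain_step_vanish => //.
- by move=> y; exact: chain_iter_ge0.
- exact: measurable_chain_iter.
Qed.

Lemma chain_step_le F G x : (forall x, 0 <= F x) -> measurable_fun setT F ->
  measurable_fun setT G -> (forall x, F x <= G x) -> step F x <= step G x.
Proof.
move=> F0 mF mG FG; have G0 y : 0 <= G y by exact: le_trans (FG y).
have mn H : (forall y, 0 <= H y) -> measurable_fun setT H ->
    measurable_fun setT (fun a => expected_next M H (x, a)).
  by move=> H0 mH; exact: (measurableT_comp (measurable_expected_next M H0 mH)
    (@pair1_measurable _ _ _ _ x)).
apply: ge0_le_integral => //.
- by move=> a _; exact: expected_next_ge0.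
- exact: mn.
- exact: mn.
- by move=> a _; apply: ge0_le_integral.
Qed.

Lemma chain_iter_le n F G x : (forall x, 0 <= F x) -> measurable_fun setT F ->
  measurable_fun setT G -> (forall x, F x <= G x) -> iter n step F x <= iter n step G x.
Proof.
move=> F0 mF mG FG; have G0 y : 0 <= G y by exact: le_trans (FG y).
elim: n x => [//|n ih] x; rewrite !iterS; apply: chain_step_le => //.
- by move=> y; exact: chain_iter_ge0.
- exact: measurable_chain_iter.
- exact: measurable_chain_iter.
Qed.

Lemma chain_step_live_le x : step live x <= live x.
Proof.
have [Dx|nDx] := pselect (D x).
  rewrite (liveD R Dx) (chain_step_vanish _ mlive _ Dx)//; first exact: live_ge0.
  exact: liveD.
rewrite (liveN R nDx); apply: (@le_trans _ _ (\int[k x]__ 1)); last first.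
  by rewrite integral_cst// mul1e prob_kernel.
have mn : measurable_fun setT (fun a => expected_next M live (x, a)).
  exact: (measurableT_comp (measurable_expected_next M (@live_ge0 R _ X D) mlive)
    (@pair1_measurable _ _ _ _ x)).
apply: ge0_le_integral => //.
- by move=> a _; apply: expected_next_ge0; exact: live_ge0.
- move=> a _; apply: (@le_trans _ _ (\int[trans M (x, a)]__ 1)).
    apply: ge0_le_integral => //; first by move=> y _; exact: live_ge0.
    by move=> y _; exact: live_le1.
  by rewrite integral_cst// mul1e prob_kernel.
Qed.

Lemma chain_iter_live_le n x : iter n step live x <= live x.
Proof.
elim: n x => [//|n ih] x; rewrite iterSr.
apply: le_trans (ih x); apply: chain_iter_le => //.
- by move=> y; apply: (chain_iter_ge0 M k 1); exact: live_ge0.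
- apply: (measurable_chain_iter M k 1) => //; exact: live_ge0.
- exact: chain_step_live_le.
Qed.

(** The expected time to absorption from [x] under [k]. It may be infinite at some states; what is
    known is its integrability under the law of the state of any policy at any time. *)
Definition expected_life (x : X) : \bar R := \sum_(0 <= n <oo) iter n step live x.

Lemma expected_life_ge0 x : 0 <= expected_life x.
Proof. by apply: nneseries_ge0 => n _ _; apply: chain_iter_ge0; exact: live_ge0. Qed.

Lemma measurable_expected_life : measurable_fun setT expected_life.
Proof.
apply: ge0_emeasurable_sum => n *; first by apply: chain_iter_ge0; exact: live_ge0.
by apply: measurable_chain_iter => //; exact: live_ge0.
Qed.

Hypothesis k_adm : forall x, k x (adm M x) = 1.

(** The life remaining at time [s], if [k] is used from then on, is a tail of the survival series of
    the switched policy. *)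
Lemma integral_expected_life (p : policy M) s :
  \int[strategic p]_w expected_life (state s w) =
  \sum_(s <= t <oo) \int[strategic (switch_policy k_adm p s)]_w live (state t w).
Proof.
rewrite /expected_life integral_nneseries; last 3 first.
- exact: measurableT.
- move=> n; apply: (measurableT_comp _ (@measurable_state _ X A s)).
  by apply: measurable_chain_iter => //; exact: live_ge0.
- by move=> n w _; apply: chain_iter_ge0; exact: live_ge0.
transitivity (\sum_(0 <= n <oo)
    \int[strategic (switch_policy k_adm p s)]_w live (state (n + s) w)).
  apply: eq_eseriesr => n _.
  by rewrite (integral_switch_policy k_adm p s n (@live_ge0 R _ X D) mlive).
apply: (@nneseries_addn R (fun t => \int[strategic (switch_policy k_adm p s)]_w live (state t w))).
by move=> i; apply: integral_ge0 => w _; exact: live_ge0.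
Qed.

Lemma integral_expected_life_lty (p : policy M) s :
  \int[strategic p]_w expected_life (state s w) < +oo.
Proof.
rewrite integral_expected_life; apply: le_lt_trans (survival_lty absD (switch_policy k_adm p s)).
rewrite /survival (@nneseries_split _ _ 0 s) ?add0n ?leeDr//.
- by apply: sume_ge0 => t _; apply: integral_ge0 => w _; exact: live_ge0.
- by move=> t _; apply: integral_ge0 => w _; exact: live_ge0.
Qed.

End kernel.

Section mixture.
Variables (n : nat) (al : nat -> {nonneg R}) (p : nat -> policy M).
Hypothesis al1 : (\sum_(j < n) (al j)%:num = 1)%R.

Definition mixture : {measure set (X * borel A) -> \bar R} :=
  msum (fun j => mscale (al j) (occupation absD (p j))) n.

Lemma integral_mixture (F : X * borel A -> \bar R) : (forall z, 0 <= F z) ->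
  measurable_fun setT F ->
  \int[mixture]_z F z = \sum_(j < n) (al j)%:num%:E * \int[occupation absD (p j)]_z F z.
Proof.
move=> F0 mF; rewrite /mixture ge0_integral_measure_sum//.
by apply: eq_bigr => j _; rewrite ge0_integral_mscale.
Qed.

Lemma mixture_lty : mixture setT < +oo.
Proof.
rewrite /mixture/= /msum; apply: lte_sum_pinfty => j _; rewrite /mscale/=.
by rewrite lte_mul_pinfty// ?lee_fin// occupation_total survival_lty.
Qed.

Lemma mixture_null (F : X * borel A -> \bar R) : (forall z, 0 <= F z) ->
  measurable_fun setT F ->
  (forall q t, \int[strategic (M := M) q]_w (live (state t w) * F (state_action t w)) = 0) ->
  \int[mixture]_z F z = 0.
Proof.
move=> F0 mF Fq; rewrite integral_mixture// big1// => j _.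
by rewrite integral_occupation// eseries0 ?mule0// => t _ _; exact: Fq.
Qed.

Let m : {measure set X -> \bar R} := mpush mixture measurable_fst.

Let integral_m (F : X -> \bar R) : (forall x, 0 <= F x) -> measurable_fun setT F ->
  \int[m]_x F x = \int[mixture]_z F z.1.
Proof. by move=> F0 mF; rewrite integral_mpush. Qed.

Let K : set (X * borel A) := [set z | adm M z.1 z.2].

Let mK : measurable K. Proof. by case: mM. Qed.

Let policy_admissible q t : \int[strategic (M := M) q]_w (\1_(~` K) (state_action t w))%:E = 0.
Proof.
pose F (ha : H t * borel A) : \bar R := (\1_(~` K) (last_state ha.1, ha.2))%:E.
have mF : measurable_fun setT F.
  apply/measurable_EFinP; apply: (measurableT_comp (measurable_indic (measurableC mK))).
  apply: measurable_fun_pair => //=.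
  exact: (measurableT_comp (@measurable_last_state _ X A t) measurable_fst).
transitivity (\int[strategic q]_w F (history t w, action t w)).
  by apply: eq_integral => w _; rewrite /F last_state_history.
rewrite integral_action//; last by move=> z; rewrite lee_fin.
rewrite integral0_eq// => w _.
have mA := adm_measurable M (last_state (history t w)).
rewrite -(pker_setC_eq0 mA (pol_adm q (history t w))) measure_as_integral; last exact: measurableC.
by apply: eq_integral => a _; rewrite /F /K !indicE.
Qed.

(** Policies choose admissible actions almost surely, so the mixture does not charge inadmissible
    pairs, and its disintegration is admissible at almost every state. The measurable selector
    [theta] repairs the other states. *)
Lemma mixture_disintegration : exists k : R.-pker X ~> borel A,
  (forall x, k x (adm M x) = 1) /\
  forall F : X * borel A -> \bar R, (forall z, 0 <= F z) -> measurable_fun setT F ->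
    \int[mixture]_z F z = \int[m]_x \int[k x]_a F (x, a).
Proof.
have [k0 k0E] := disintegration bA cA mixture_lty.
have [_ [theta [mtheta Ktheta]]] := mM.
have [k kK kE] := @kernel_correction R _ _ X (borel A) k0 K theta mK mtheta Ktheta.
exists k; split; first exact: kK.
move=> F F0 mF.
have k0F (G : X * borel A -> \bar R) : (forall z, 0 <= G z) -> measurable_fun setT G ->
    \int[mixture]_z G z = \int[m]_x \int[k0 x]_a G (x, a).
  move=> G0 mG; rewrite (eq_integral_measure (m2 := mbind m (kgraph k0)))//.
  by rewrite integral_mbind//; apply: eq_integral => x _; rewrite integral_kgraph.
have mnK : measurable_fun setT (fun z => (\1_(~` K) z)%:E : \bar R).
  by apply/measurable_EFinP; apply: measurable_indic; exact: measurableC.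
have mix0 : \int[mixture]_z (\1_(~` K) z)%:E = 0.
  apply: mixture_null => // q t; apply/eqP; rewrite eq_le; apply/andP; split; last first.
    by apply: integral_ge0 => w _; rewrite mule_ge0// live_ge0.
  rewrite -(policy_admissible q t); apply: ge0_le_integral => //.
  - by move=> w _; rewrite mule_ge0// live_ge0.
  - exact: (measurable_live_mul absD t mnK).
  - exact: (measurableT_comp mnK (@measurable_state_action _ X A t)).
  - by move=> w _; rewrite gee_pMl ?live_le1// lee_fin.
have mk0 : measurable_fun setT (fun x => \int[k0 x]_a (\1_(~` K) (x, a))%:E).
  exact: (measurable_expected_action k0 (G := fun z => (\1_(~` K) z)%:E)).
have k0K : {ae m, forall x, k0 x [set y | K (x, y)] = 1}.
  have : ae_eq m setT (fun x => \int[k0 x]_a (\1_(~` K) (x, a))%:E) (cst 0).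
    apply/ae_eq_integral_abs => //; rewrite -[RHS]mix0 k0F//.
    by apply: eq_integral => x _; rewrite gee0_abs// integral_ge0.
  apply: filterS => x /(_ Logic.I) /= k0x.
  have mx : measurable [set y : borel A | K (x, y)].
    rewrite -[X in measurable X]setTI.
    exact: (@pair1_measurable _ _ X (borel A) x measurableT K mK).
  have k0xc : k0 x (~` [set y | K (x, y)]) = 0.
    rewrite measure_as_integral; last exact: measurableC.
    by rewrite -[RHS]k0x; apply: eq_integral => a _; rewrite !indicE.
  rewrite -(setCK [set y | K (x, y)]).
  by have := pker_setC_eq1 (measurableC mx) k0xc.
rewrite k0F//; apply: ge0_ae_eq_integral => //.
- exact: (measurable_expected_action k0 (G := F)).
- exact: (measurable_expected_action k (G := F)).
- by move=> x _; exact: integral_ge0.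
- by move=> x _; exact: integral_ge0.
- apply: filterS k0K => x /kE kx _; apply: eq_integral_measure => C _.
  by rewrite kx.
Qed.

Section chain.
Variable k : R.-pker X ~> borel A.
Hypothesis k_adm : forall x, k x (adm M x) = 1.
Hypothesis kE : forall F : X * borel A -> \bar R, (forall z, 0 <= F z) ->
  measurable_fun setT F -> \int[mixture]_z F z = \int[m]_x \int[k x]_a F (x, a).
Local Notation step := (chain_step M k).

Let balance F : (forall x, 0 <= F x) -> measurable_fun setT F -> (forall x, D x -> F x = 0) ->
  \int[m]_x F x = \int[init M]_x F x + \int[m]_x step F x.
Proof.
move=> F0 mF FD; have mF1 : measurable_fun setT (fun z : X * borel A => F z.1).
  exact: (measurableT_comp mF measurable_fst).
have mnF := measurable_expected_next M F0 mF.
have nF0 z : 0 <= expected_next M F z by exact: expected_next_ge0.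
rewrite integral_m// -(kE nF0 mnF) !integral_mixture//.
under eq_bigr do rewrite (occupation_balance absD)// ge0_muleDr ?integral_ge0//.
rewrite big_split/= -ge0_sume_distrl; last by move=> j _; rewrite lee_fin.
by rewrite sumEFin al1 mul1e.
Qed.

Let balance_iter F j : (forall x, 0 <= F x) -> measurable_fun setT F ->
  (forall x, D x -> F x = 0) ->
  \int[m]_x F x = \sum_(0 <= t < j) \int[init M]_x iter t step F x +
    \int[m]_x iter j step F x.
Proof.
move=> F0 mF FD; elim: j => [|j ih]; first by rewrite big_geq// add0e.
rewrite ih big_nat_recr//= -addeA; congr (_ + _); apply: balance.
- by move=> x; exact: chain_iter_ge0.
- exact: measurable_chain_iter.
- by move=> x Dx; exact: chain_iter_vanish.
Qed.

(** The measure [m] is built from laws of states of policies, and under each of these the expected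
    life is integrable, by switching to [k] at the time considered. *)
Let life_finite : {ae m, forall x, expected_life k x < +oo}.
Proof.
pose F x : \bar R := (\1_[set x | expected_life k x = +oo%E] x)%:E.
have mS : measurable [set x | expected_life k x = +oo%E].
  rewrite -[X in measurable X]setTI.
  exact: (measurable_expected_life k measurableT (emeasurable_set1 +oo%E)).
have mF : measurable_fun setT F by apply/measurable_EFinP; exact: measurable_indic.
exists [set x | expected_life k x = +oo%E]; split => //; last first.
  by move=> x /= /negP; rewrite -leNgt leye_eq => /eqP.
rewrite measure_as_integral// integral_m//.
apply: mixture_null.
- by move=> z; rewrite lee_fin.
- exact: (measurableT_comp mF measurable_fst).
move=> q t; apply/eqP; rewrite eq_le; apply/andP; split; last first.
  by apply: integral_ge0 => w _; rewrite mule_ge0 ?live_ge0// lee_fin.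
have mFt : measurable_fun [set: trajectory X A] (fun w => F (state t w)).
  exact: (measurableT_comp mF (@measurable_state _ X A t)).
apply: (@le_trans _ _ (\int[strategic q]_w F (state t w))).
  apply: ge0_le_integral => //.
  - by move=> w _; rewrite mule_ge0 ?live_ge0// lee_fin.
  - apply: (measurable_live_mul absD t (F := fun z => F z.1)).
    exact: (measurableT_comp mF measurable_fst).
  - by move=> w _; rewrite gee_pMl ?live_le1// lee_fin.
have : {ae strategic q, forall w, setT w -> expected_life k (state t w) \is a fin_num}.
  apply: integrable_ae => //; apply/integrableP; split.
    exact: (measurableT_comp (measurable_expected_life k) (@measurable_state _ X A t)).
  under eq_integral do rewrite gee0_abs ?expected_life_ge0//.
  exact: (integral_expected_life_lty k_adm).
move=> h; rewrite (@ge0_ae_eq_integral _ _ _ (strategic q) setT _ (cst 0)) ?integral0//.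
- by move=> w _; rewrite lee_fin.
- apply: filterS h => w /(_ Logic.I) fw _; rewrite /F indicE memNset//=.
  by move=> wE; move: fw; rewrite wE.
Qed.

(** Where the expected life is finite, the terms of its series tend to 0; they are dominated by
    [live], which is integrable because the mixture is finite. *)
Let iter_live_cvg0 : \int[m]_x iter j step live x @[j --> \oo] --> 0.
Proof.
have ml j : measurable_fun setT (iter j step live).
  by apply: measurable_chain_iter => //; exact: live_ge0.
have l0 j x : 0 <= iter j step live x by apply: chain_iter_ge0; exact: live_ge0.
have [|||_ _] := @dominated_convergence _ X R m setT measurableT (fun j => iter j step live)
  (cst 0) live ml (measurable_cst _); last by rewrite integral0; exact.
- apply: filterS life_finite => x lx _; exact: nneseries_cvg0.
- apply/integrableP; split => //.
  under eq_integral do rewrite gee0_abs ?live_ge0//.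
  rewrite integral_m//; last exact: live_ge0.
  apply: le_lt_trans mixture_lty; rewrite [leRHS]measure_as_integral//.
  apply: ge0_le_integral => //.
  + by move=> z _; exact: live_ge0.
  + exact: (measurableT_comp mlive measurable_fst).
  + by apply/measurable_EFinP.
  + by move=> z _; rewrite indicT live_le1.
- by apply: aeW => x j _; rewrite gee0_abs// chain_iter_live_le.
Qed.

Let renewal F : (forall x, 0 <= F x) -> measurable_fun setT F -> (forall x, F x <= live x) ->
  \sum_(0 <= t <oo) \int[init M]_x iter t step F x = \int[m]_x F x.
Proof.
move=> F0 mF Fl.
have FD x : D x -> F x = 0.
  by move=> Dx; apply/eqP; rewrite eq_le F0 andbT -(liveD R Dx).
have cvS : \sum_(0 <= t < j) \int[init M]_x iter t step F x @[j --> \oo] -->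
    \sum_(0 <= t <oo) \int[init M]_x iter t step F x.
  by apply: is_cvg_nneseries => t _ _; apply: integral_ge0 => x _; exact: chain_iter_ge0.
have cv0 : \int[m]_x iter j step F x @[j --> \oo] --> 0.
  apply: (squeeze_cvge _ (cvg_cst 0) iter_live_cvg0); apply: nearW => j.
  apply/andP; split; first by apply: integral_ge0 => x _; exact: chain_iter_ge0.
  apply: ge0_le_integral => //.
  - by move=> x _; exact: chain_iter_ge0.
  - exact: measurable_chain_iter.
  - by apply: measurable_chain_iter => //; exact: live_ge0.
  - by move=> x _; exact: chain_iter_le.
have : (fun j => \sum_(0 <= t < j) \int[init M]_x iter t step F x + \int[m]_x iter j step F x)
    @ \oo --> \sum_(0 <= t <oo) \int[init M]_x iter t step F x + 0.
  by apply: cvgeD => //; rewrite fin_num_adde_defl.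
rewrite adde0; under eq_fun do rewrite -(balance_iter _ F0 mF FD).
by move/cvg_lim => <- //; rewrite lim_cst.
Qed.

(* The state marginal [m] of the mixture solves [m = init + m step], and [m step^j live]
   tends to 0 by dominated convergence, so that [m] is the sum of the [init step^t] off [D]. *)
Lemma occupation_stationary G : measurable G ->
  occupation absD (stationary_policy k_adm) G = mixture G.
Proof.
move=> mG; have mi : measurable_fun setT (fun z => (\1_G z)%:E : \bar R).
  by apply/measurable_EFinP; exact: measurable_indic.
rewrite measure_as_integral// integral_occupation//.
pose F x := live x * \int[k x]_a (\1_G (x, a))%:E.
have kG0 x : 0 <= \int[k x]_a (\1_G (x, a))%:E :> \bar R by exact: integral_ge0.
have mkG : measurable_fun setT (fun x => \int[k x]_a (\1_G (x, a))%:E).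
  exact: (measurable_expected_action k (G := fun z => (\1_G z)%:E)).
have F0 x : 0 <= F x by rewrite mule_ge0// live_ge0.
have mF : measurable_fun setT F by exact: emeasurable_funM.
have Fl x : F x <= live x.
  rewrite -[leRHS]mule1 lee_wpmul2l ?live_ge0//.
  apply: (@le_trans _ _ (\int[k x]__ 1)); last by rewrite integral_cst// mul1e prob_kernel.
  apply: ge0_le_integral => //.
    exact: (measurableT_comp mi (@pair1_measurable _ _ _ _ x)).
  by move=> a _; rewrite lee_fin indicE; case: (_ \in _).
pose lG (z : X * borel A) := live z.1 * (\1_G z)%:E.
have lG0 z : 0 <= lG z by rewrite mule_ge0 ?live_ge0// lee_fin.
have mlG : measurable_fun setT lG.
  by apply: emeasurable_funM => //; exact: (measurableT_comp mlive measurable_fst).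
have FE x : F x = \int[k x]_a lG (x, a).
  rewrite /F /lG/= ge0_integralZl//; first exact: (measurableT_comp mi (@pair1_measurable _ _ _ _ x)).
  exact: live_ge0.
transitivity (\sum_(0 <= t <oo) \int[init M]_x iter t step F x).
  apply: eq_eseriesr => t _.
  have st := @stationary_policy_from _ _ _ _ _ _ _ k_adm.
  transitivity (\int[strategic (stationary_policy k_adm)]_w lG (state_action t w)) => //.
  rewrite (integral_kernel_action st)//.
  transitivity (\int[strategic (stationary_policy k_adm)]_w F (state (t + 0) w)).
    by rewrite addn0; apply: eq_integral => w _; rewrite FE.
  rewrite (integral_chain_iter t st)// integral_init//.
  - by move=> x; exact: chain_iter_ge0.
  - exact: measurable_chain_iter.
rewrite renewal// (eq_integral (fun x => \int[k x]_a lG (x, a))); last by move=> x _; exact: FE.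
rewrite -kE// measure_as_integral// !integral_mixture//.
apply: eq_bigr => j _; congr (_ * _); rewrite !integral_occupation//.
apply: eq_eseriesr => t _; apply: eq_integral => w _; rewrite /lG/= muleA.
congr (_ * _); have [Dw|nDw] := pselect (D (state t w)).
  by rewrite (liveD R Dw) mul0e.
by rewrite (liveN R nDw) mule1.
Qed.

End chain.

(** Serves twice: with a single policy it replaces that policy by a stationary one, and with [d.+1]
    deterministic policies it realizes their mixture. *)
Theorem stationarization :
  exists (k : R.-pker X ~> borel A) (k_adm : forall x, k x (adm M x) = 1),
  forall G, measurable G ->
  occupation absD (stationary_policy k_adm) G = mixture G.
Proof.
have [k [k_adm kE]] := mixture_disintegration.
by exists k, k_adm => G mG; exact: occupation_stationary.
Qed.

End mixture.

End stationarization.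

(** * Improvement by a deterministic policy *)

Section lexicographic_order.
Local Open Scope ereal_scope.
Context (R : realType).

(** The two sequences compared come as one sequence of pairs, since extended values cannot safely be
    subtracted and compared with 0. *)
Fixpoint lexle (s : seq (\bar R * \bar R)) : bool :=
  if s is x :: s' then (x.1 < x.2) || ((x.1 == x.2) && lexle s') else true.

Context d (T : measurableType d).

Lemma eq_ae_integral_le (m : {measure set T -> \bar R}) (f g : T -> \bar R) :
  (forall x, 0 <= f x) -> measurable_fun setT f ->
  (forall x, 0 <= g x) -> measurable_fun setT g ->
  {ae m, forall x, f x <= g x} -> \int[m]_x f x = \int[m]_x g x ->
  \int[m]_x g x < +oo -> {ae m, forall x, f x = g x}.
Proof.
move=> f0 mf g0 mg fg fgE gfin.
have ig : m.-integrable setT g.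
  by apply/integrableP; split => //; under eq_integral do rewrite gee0_abs//.
have if_ : m.-integrable setT f.
  by apply/integrableP; split => //; under eq_integral do rewrite gee0_abs//; rewrite fgE.
have ffin := integrable_ae measurableT if_.
have hfin := integrable_ae measurableT ig.
have mh : measurable_fun setT (fun x => g x - f x) by exact: emeasurable_funB.
have : \int[m]_x `|g x - f x| = 0.
  rewrite (@ae_eq_integral _ _ _ m setT (fun x => g x - f x))//.
  - rewrite integralB// fgE subee// ge0_fin_numE//.
    exact: integral_ge0.
  - exact: measurableT_comp.
  - apply: filterS2 fg ffin => x le /(_ Logic.I) fx _.
    by rewrite gee0_abs// sube_ge0// fx.
move/ae_eq_integral_abs => /(_ measurableT mh) h.
apply: filterS3 h ffin hfin => x /(_ Logic.I) + /(_ Logic.I) fx /(_ Logic.I) gx.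
by move/eqP; rewrite sube_eq// ?add0e ?fin_num_adde_defl// => /eqP ->.
Qed.

(** If the comparison fails almost everywhere, then [K i <= L i] almost everywhere for the first
    index; equal finite integrals force equality, and the failure passes to the remaining indices.
    With none left the comparison is true everywhere, which contradicts the positive mass. *)
Lemma ae_not_lexle (I : Type) (rs : seq I) (L K : I -> T -> \bar R)
    (m : {measure set T -> \bar R}) :
  (forall i x, 0 <= L i x) -> (forall i, measurable_fun setT (L i)) ->
  (forall i x, 0 <= K i x) -> (forall i, measurable_fun setT (K i)) ->
  (forall i, \int[m]_x L i x = \int[m]_x K i x) -> (forall i, \int[m]_x K i x < +oo) ->
  m setT != 0 -> ~ {ae m, forall x, ~~ lexle [seq (L i x, K i x) | i <- rs]}.
Proof.
move=> L0 mL K0 mK LK Kfin m0; elim: rs => [|i rs ih] h.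
  case: h => N [mN N0 sub]; case/eqP: m0; apply/eqP; rewrite -measure_le0 -N0.
  by apply: le_measure; rewrite ?inE// => x _; apply: sub => /=.
have eqLK : {ae m, forall x, K i x = L i x}.
  apply: eq_ae_integral_le => //; last by rewrite LK.
  by apply: filterS h => x /=; rewrite negb_or -leNgt => /andP[].
by apply: ih; apply: filterS2 h eqLK => x + E; rewrite /= E ltxx eqxx.
Qed.

Lemma measurable_lexle (I : Type) (rs : seq I) (L K : I -> T -> \bar R) :
  (forall i, measurable_fun setT (L i)) -> (forall i, measurable_fun setT (K i)) ->
  measurable [set x | lexle [seq (L i x, K i x) | i <- rs]].
Proof.
move=> mL mK; elim: rs => [|i rs ih] /=.
  rewrite [X in measurable X](_ : _ = setT)//.
  by apply/seteqP; split.
rewrite [X in measurable X](_ : _ = [set x | L i x < K i x] `|`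
  (~` ([set x | L i x < K i x] `|` [set x | K i x < L i x]) `&`
   [set x | lexle [seq (L i x, K i x) | i <- rs]])).
  have mlt f g : measurable_fun setT f -> measurable_fun setT g ->
      measurable [set x : T | f x < g x :> \bar R].
    by move=> mf mg; rewrite -[X in measurable X]setTI; exact: measurable_lte.
  by apply: measurableU; [exact: mlt|apply: measurableI => //];
    apply: measurableC; apply: measurableU; exact: mlt.
apply/seteqP; split => x /=; case: (ltgtP (L i x) (K i x)) => //= _.
- by left.
- by move=> h; right; split => // -[].
- by case=> // -[] h; case: h; right.
- by case=> // -[].
Qed.

End lexicographic_order.

Lemma cvg_fine_partial_sum (R : realType) (u : nat -> \bar R) :
  (forall n, 0 <= u n)%E -> (\sum_(0 <= n <oo) u n < +oo)%E ->
  \sum_(0 <= t < n) fine (u t) @[n --> \oo] --> fine (\sum_(0 <= n <oo) u n)%E.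
Proof.
move=> u0 ufin; have ut t : u t \is a fin_num.
  rewrite ge0_fin_numE//; apply: le_lt_trans ufin.
  by apply: (le_trans _ (@nneseries_lim_ge _ _ xpredT 0 t.+1 _)) => //;
    rewrite big_nat_recr//= leeDr// sume_ge0.
have -> : (fun n => \sum_(0 <= t < n) fine (u t)) =
    fine \o (fun n => \sum_(0 <= t < n) u t)%E.
  by apply/funext => n /=; rewrite sum_fine// => t _; exact: ut.
apply: fine_cvg; rewrite fineK; first by apply: is_cvg_nneseries.
by rewrite ge0_fin_numE// nneseries_ge0.
Qed.

Lemma nonneg_partial_sums_lim (R : realType) (u : nat -> R) (l : R) :
  (forall n, 0 <= u n) -> \sum_(0 <= t < n) u t @[n --> \oo] --> l ->
  0 <= l /\ (l = 0 -> forall n, u n = 0).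
Proof.
move=> u0 cv; have nd : {homo (fun n => \sum_(0 <= t < n) u t) : m n / (m <= n)%N >-> m <= n}.
  by apply/nondecreasing_seqP => n; rewrite big_nat_recr//= lerDl.
have le n : \sum_(0 <= t < n) u t <= l.
  rewrite -(cvg_lim _ cv)//; apply: (nondecreasing_cvgn_le nd).
  by apply/cvg_ex; exists l.
split=> [|l0 n]; first by apply: le_trans (le 0%N); rewrite big_geq.
apply/eqP; rewrite eq_le u0 andbT -l0; apply: le_trans (le n.+1).
by rewrite big_nat_recr//= lerDr sumr_ge0.
Qed.

Section value.
Local Open Scope ereal_scope.
Context (R : realType) (dX : measure_display) (X : measurableType dX)
  (A : ptopologicalType) (d : nat).
Variable M : control_model R X A d.
Variable D : set X.
Hypothesis absD : absorbing M D.
Hypothesis unif : uniformly_absorbing M D.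

Variable k : R.-pker X ~> borel A.
Hypothesis k_adm : forall x, k x (adm M x) = 1.

Local Notation live := (@live R _ X D).
Local Notation step := (chain_step M k).
Local Notation life := (expected_life M D k).
Local Notation gamma := (stationary_policy k_adm).

Let mlive : measurable_fun setT live. Proof. exact: (measurable_live absD). Qed.

(** Here uniform absorption enters. The integral is a tail of the survival series of the policy that
    switches from [q] to [k] at time [n]; that policy changes with [n], so the bound has to be
    uniform over policies. *)
Lemma life_cvg0 (q : policy M) :
  \int[strategic q]_w life (state n w) @[n --> \oo] --> 0.
Proof.
have [_ cv] := unif.
apply: (squeeze_cvge _ (cvg_cst 0) cv); apply: nearW => n; apply/andP; split.
  by apply: integral_ge0 => w _; exact: expected_life_ge0.
rewrite (integral_expected_life absD k_adm); apply: ereal_sup_ubound.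
exists (switch_policy k_adm q n) => //; apply: eq_eseriesr => t _.
exact: (strategic_alive absD).
Qed.

(** The shape of the positive and negative parts of a reward: bounded, and zero on [D]. The value is
    then at most a constant times the expected life. *)
Definition dominated (f : X * borel A -> \bar R) := [/\ forall z, 0 <= f z,
  measurable_fun setT f & exists2 c : R, (0 <= c)%R & forall z, f z <= c%:E * live z.1].

Definition value (f : X * borel A -> \bar R) (x : X) : \bar R :=
  \sum_(0 <= n <oo) iter n step (expected_action k f) x.

Section one_reward.
Variable f : X * borel A -> \bar R.
Hypothesis fdom : dominated f.
Let f0 z : 0 <= f z. Proof. by case: fdom. Qed.
Let mf : measurable_fun [set: X * borel A] f. Proof. by case: fdom. Qed.
Local Notation h := (expected_action k f).
Let h0 x : 0 <= h x. Proof. exact: expected_action_ge0. Qed.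
Let mh : measurable_fun setT h. Proof. exact: measurable_expected_action. Qed.
Let ih0 n x : 0 <= iter n step h x. Proof. exact: chain_iter_ge0. Qed.
Let mih n : measurable_fun setT (iter n step h). Proof. exact: measurable_chain_iter. Qed.

Lemma value_ge0 x : 0 <= value f x.
Proof. by apply: nneseries_ge0 => n _ _; exact: ih0. Qed.

Lemma measurable_value : measurable_fun setT (value f).
Proof. by apply: ge0_emeasurable_sum => n *. Qed.

Lemma value_bellman x : value f x = h x + step (value f) x.
Proof.
rewrite /value nneseries_shift//=; congr (_ + _).
transitivity (\int[k x]_a \sum_(0 <= n <oo) expected_next M (iter n step h) (x, a)).
  rewrite integral_nneseries; last 3 first.
  - exact: measurableT.
  - move=> n; apply: (measurableT_comp (measurable_expected_next M (ih0 n) (mih n))).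
    exact: (@pair1_measurable _ _ _ _ _).
  - by move=> n a _; exact: expected_next_ge0.
  by [].
apply: eq_integral => a _; rewrite /expected_next integral_nneseries; last 3 first.
- exact: measurableT.
- exact: mih.
- by move=> n y _; exact: ih0.
by [].
Qed.

Let bound_life : exists2 c : R, (0 <= c)%R & forall x, value f x <= c%:E * life x.
Proof.
have [_ _ [c c0 fc]] := fdom; exists c => // x.
have ilive0 n y : 0 <= iter n step live y by apply: chain_iter_ge0; exact: live_ge0.
have milive n : measurable_fun setT (iter n step live).
  by apply: measurable_chain_iter => //; exact: live_ge0.
have le n : forall y, iter n step h y <= c%:E * iter n step live y.
  elim: n => [|n ih] y /=.
    rewrite /expected_action; apply: (@le_trans _ _ (\int[k y]_a (c%:E * live y))).
      apply: ge0_le_integral => //.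
      exact: (measurableT_comp mf (@pair1_measurable _ _ _ _ y)).
    by rewrite integral_cst// [X in _ * X]prob_kernel mule1.
  apply: (@le_trans _ _ (step (fun y => c%:E * iter n step live y) y)).
    by apply: chain_step_le => //; exact: measurable_funeM.
  rewrite /chain_step/expected_action/expected_next.
  rewrite -ge0_integralZl//; last 2 first.
  - apply: (measurableT_comp (measurable_expected_next M (ilive0 n) (milive n))).
    exact: (@pair1_measurable _ _ _ _ _).
  - by move=> a _; exact: expected_next_ge0.
  rewrite (eq_integral (fun a => c%:E * \int[trans M (y, a)]_y0 iter n step live y0))//.
  by move=> a _; rewrite ge0_integralZl.
rewrite /value /expected_life -nneseriesZl//.
by apply: lee_nneseries => n _; [move=> _; exact: ih0|exact: le].
Qed.

Lemma value_lty x : life x < +oo -> value f x < +oo.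
Proof.
move=> lx; have [c c0 /(_ x) le] := bound_life; apply: le_lt_trans le _.
by rewrite lte_mul_pinfty ?expected_life_ge0.
Qed.

Let integral_value_le : exists c : R, forall q n,
  \int[strategic (M := M) q]_w value f (state n w) <= c%:E * \int[strategic q]_w life (state n w).
Proof.
have [c c0 le] := bound_life; exists c => q n.
have ml : measurable_fun [set: trajectory X A] (fun w => life (state n w)).
  exact: (measurableT_comp (measurable_expected_life absD k) (@measurable_state _ X A n)).
rewrite -ge0_integralZl//; last by move=> w _; exact: expected_life_ge0.
apply: ge0_le_integral => //.
- by move=> w _; exact: value_ge0.
- exact: (measurableT_comp measurable_value (@measurable_state _ X A n)).
- exact: measurable_funeM.
Qed.

Lemma integral_value_lty (q : policy M) n : \int[strategic q]_w value f (state n w) < +oo.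
Proof.
have [c /(_ q n) le] := integral_value_le; apply: le_lt_trans le _.
rewrite ltey_eq fin_numM// ge0_fin_numE; first exact: (integral_expected_life_lty absD k_adm).
by apply: integral_ge0 => w _; exact: expected_life_ge0.
Qed.

Lemma value_cvg0 (q : policy M) :
  \int[strategic q]_w value f (state n w) @[n --> \oo] --> 0.
Proof.
have [c le] := integral_value_le.
have cv : c%:E * \int[strategic q]_w life (state n w) @[n --> \oo] --> 0.
  by rewrite -(mule0 c%:E); apply: cvgeZl => //; exact: life_cvg0.
apply: (squeeze_cvge _ (cvg_cst 0) cv); apply: nearW => n; rewrite le andbT.
by apply: integral_ge0 => w _; exact: value_ge0.
Qed.

Lemma integral_dominated (q : policy M) :
  \int[occupation absD q]_z f z = \sum_(0 <= t <oo) \int[strategic q]_w f (state_action t w).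
Proof.
rewrite integral_occupation//; apply: eq_eseriesr => t _; apply: eq_integral => w _.
have [Dw|nDw] := pselect (D (state t w)); last by rewrite (liveN R nDw) mul1e.
rewrite (liveD R Dw) mul0e; apply/esym/eqP; rewrite eq_le f0 andbT.
by have [_ _ [c _ /(_ (state_action t w))]] := fdom; rewrite (liveD R Dw) mule0.
Qed.

Lemma integral_dominated_lty (q : policy M) : \int[occupation absD q]_z f z < +oo.
Proof.
have [_ _ [c c0 fc]] := fdom.
apply: (@le_lt_trans _ _ (\int[occupation absD q]_z c%:E)).
  apply: ge0_le_integral => // z _; apply: le_trans (fc z) _.
  by rewrite -[leRHS]mule1 lee_wpmul2l ?lee_fin// live_le1.
rewrite integral_cst// [X in _ * X]occupation_total lte_mul_pinfty ?survival_lty//.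
Qed.

(** At time 0 the state has law [init] under every policy, so [q] is arbitrary on the left although
    the right side concerns [gamma]. *)
Lemma integral_value_init (q : policy M) :
  \int[strategic q]_w value f (state 0 w) = \int[occupation absD gamma]_z f z.
Proof.
rewrite integral_dominated integral_init; [|exact: value_ge0|exact: measurable_value].
rewrite /value integral_nneseries; last 3 first.
- exact: measurableT.
- exact: mih.
- by move=> n x _; exact: ih0.
apply: eq_eseriesr => n _; rewrite (integral_kernel_action (stationary_policy_from k_adm))//.
have := integral_chain_iter n (stationary_policy_from k_adm) h0 mh.
by rewrite addn0 => ->; rewrite integral_init.
Qed.

End one_reward.

End value.

Section improvement.
Local Open Scope ereal_scope.
Context (R : realType) (dX : measure_display) (X : measurableType dX)
  (A : ptopologicalType) (d : nat).
Variable M : control_model R X A d.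
Variable D : set X.
Hypothesis absD : absorbing M D.
Hypothesis unif : uniformly_absorbing M D.

Variable k : R.-pker X ~> borel A.
Hypothesis k_adm : forall x, k x (adm M x) = 1.

Local Notation life := (expected_life M D k).
Local Notation gamma := (stationary_policy k_adm).
Local Notation value := (value M k).
Local Notation dominated := (@dominated R _ X A D).

(** The total expected reward of [p] for the reward [f - g]; the improvement over [gamma] is a
    difference of two such numbers. *)
Definition gain (p : policy M) (f g : X * borel A -> \bar R) : R :=
  (fine (\int[occupation absD p]_z f z) - fine (\int[occupation absD p]_z g z))%R.

(* For a reward [f - g] with [f, g >= 0], an action improves on [k] when
   [action_value f g <= action_value g f]; sums replace differences of possibly infinite values. *)
Definition action_value (f g : X * borel A -> \bar R) z :=
  value f z.1 + (g z + expected_next M (value g) z).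

Section one_reward.
Variables f g : X * borel A -> \bar R.
Hypotheses (fdom : dominated f) (gdom : dominated g).
Let g0 z : 0 <= g z. Proof. by case: gdom. Qed.
Let mg : measurable_fun setT g. Proof. by case: gdom. Qed.
Let Vf0 x : 0 <= value f x. Proof. exact: (value_ge0 M k fdom). Qed.
Let Vg0 x : 0 <= value g x. Proof. exact: (value_ge0 M k gdom). Qed.
Let mVf : measurable_fun setT (value f). Proof. exact: (measurable_value M k fdom). Qed.
Let mVg : measurable_fun setT (value g). Proof. exact: (measurable_value M k gdom). Qed.
Let mnVg := measurable_expected_next M Vg0 mVg.
Let nVg0 z : 0 <= expected_next M (value g) z. Proof. exact: expected_next_ge0. Qed.

Lemma action_value_ge0 z : 0 <= action_value f g z.
Proof. by apply: adde_ge0 => //; apply: adde_ge0. Qed.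

Lemma measurable_action_value : measurable_fun setT (action_value f g).
Proof.
by apply: emeasurable_funD; [exact: (measurableT_comp mVf measurable_fst)|exact: emeasurable_funD].
Qed.

(** The result is symmetric in [f] and [g]: under [k x] the two action values to be compared have
    the same average, as [ae_not_lexle] requires. *)
Lemma integral_action_value_kernel x :
  \int[k x]_a action_value f g (x, a) = value f x + value g x.
Proof.
have m1 (F : X * borel A -> \bar R) : measurable_fun setT F ->
    measurable_fun setT (fun a => F (x, a)).
  by move=> mF; exact: (measurableT_comp mF (@pair1_measurable _ _ _ _ x)).
rewrite /action_value/= ge0_integralD//; last 2 first.
- by move=> a _; rewrite adde_ge0.
- by apply: (m1 (fun z => g z + expected_next M (value g) z)); exact: emeasurable_funD.
rewrite integral_cst// [X in _ * X]prob_kernel mule1 ge0_integralD//; last 2 first.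
- exact: m1.
- exact: (m1 _ mnVg).
by rewrite [in RHS](value_bellman M k gdom).
Qed.

Lemma integral_action_value (q : policy M) t :
  \int[strategic q]_w action_value f g (state_action t w) =
  \int[strategic q]_w value f (state t w) +
  (\int[strategic q]_w g (state_action t w) + \int[strategic q]_w value g (state t.+1 w)).
Proof.
have msa := @measurable_state_action _ X A t.
rewrite /action_value/= ge0_integralD//; last 3 first.
- exact: (measurableT_comp mVf (@measurable_state _ X A t)).
- by move=> w _; rewrite adde_ge0.
- by apply: emeasurable_funD; exact: (measurableT_comp _ msa).
rewrite ge0_integralD//; last 2 first.
- exact: (measurableT_comp mg msa).
- exact: (measurableT_comp mnVg msa).
by rewrite integral_next.
Qed.

End one_reward.

(* The expected values of [action_value g f - action_value f g] along [q] telescope, up to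
   the vanishing expected value at time [n], to the gain of [q] over [gamma]. *)
Lemma gain_step (f g : X * borel A -> \bar R) (q : policy M) : dominated f -> dominated g ->
  (forall t, {ae strategic q, forall w,
     action_value f g (state_action t w) <= action_value g f (state_action t w)}) ->
  (0 <= gain q f g - gain gamma f g)%R /\
  ((gain q f g - gain gamma f g = 0)%R -> forall t, {ae strategic q, forall w,
     action_value f g (state_action t w) = action_value g f (state_action t w)}).
Proof.
have arith_le (a b a' b' a0 b0 : R) :
    (a0 + (b + b') <= b0 + (a + a') -> 0 <= a - b + (a' - b') - (a0 - b0))%R by lra.
have arith_eq (a b a' b' a0 b0 : R) :
    (a - b + (a' - b') - (a0 - b0) = 0 -> a0 + (b + b') = b0 + (a + a'))%R by lra.
move=> fdom gdom le.
have [V VE] : exists V, forall h n, dominated h ->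
    \int[strategic q]_w value h (state n w) = (V h n)%:E.
  exists (fun h n => fine (\int[strategic q]_w value h (state n w))) => h n hdom.
  rewrite fineK// ge0_fin_numE; first exact: (integral_value_lty absD k_adm hdom).
  by apply: integral_ge0 => w _; exact: (value_ge0 M k hdom).
have [r rE] : exists r, forall h n, dominated h ->
    \int[strategic q]_w h (state_action n w) = (r h n)%:E.
  exists (fun h n => fine (\int[strategic q]_w h (state_action n w))) => h n hdom.
  have [h0 mh _] := hdom.
  have i0 t : 0 <= \int[strategic q]_w h (state_action t w) by exact: integral_ge0.
  rewrite fineK// ge0_fin_numE//; apply: le_lt_trans (integral_dominated_lty absD hdom q).
  rewrite integral_dominated//.
  apply: (le_trans _ (@nneseries_lim_ge _ _ xpredT 0 n.+1 _)) => //.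
  by rewrite big_nat_recr//= leeDr// sume_ge0.
(* The expectation of [action_value g f - action_value f g] at time [t], written with finite
   numbers. *)
pose u t := (r f t - r g t + (V f t.+1 - V g t.+1) - (V f t - V g t))%R.
have avE h h' t : dominated h -> dominated h' ->
    \int[strategic q]_w action_value h h' (state_action t w) =
    (V h t + (r h' t + V h' t.+1))%:E.
  by move=> hdom h'dom; rewrite integral_action_value// !VE// rE.
have mav h h' t : dominated h -> dominated h' ->
    measurable_fun [set: trajectory X A] (fun w => action_value h h' (state_action t w)).
  move=> hdom h'dom.
  exact: (measurableT_comp (measurable_action_value hdom h'dom) (@measurable_state_action _ X A t)).
have u0 t : (0 <= u t)%R.
  have le_int : \int[strategic q]_w action_value f g (state_action t w) <=
      \int[strategic q]_w action_value g f (state_action t w).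
    apply: ae_ge0_le_integral.
    - exact: measurableT.
    - by move=> w _; exact: action_value_ge0.
    - exact: mav.
    - by move=> w _; exact: action_value_ge0.
    - exact: mav.
    - by apply: filterS (le t) => w.
  have lefin (a b : \bar R) x y : a = x%:E -> b = y%:E -> a <= b -> (x <= y)%R.
    by move=> -> ->; rewrite lee_fin.
  exact: (arith_le _ _ _ _ _ _ (lefin _ _ _ _ (avE f g t fdom gdom) (avE g f t gdom fdom) le_int)).
have cv : (\sum_(0 <= t < n) u t)%R @[n --> \oo] --> (gain q f g - gain gamma f g)%R.
  have -> : (fun n => \sum_(0 <= t < n) u t)%R = (fun n => \sum_(0 <= t < n) r f t -
      \sum_(0 <= t < n) r g t + (V f n - V g n) - (V f 0%N - V g 0%N))%R.
    apply/funext; elim=> [|n ih]; first by rewrite !big_geq//; lra.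
    by rewrite !big_nat_recr//= ih /u; lra.
  have gE h (hdom : dominated h) : \int[occupation absD gamma]_z h z = (V h 0%N)%:E.
    by apply: etrans (esym (integral_value_init absD k_adm hdom q)) _; exact: VE.
  have -> : gain gamma f g = (V f 0%N - V g 0%N)%R.
    by rewrite /gain (gE f fdom) (gE g gdom).
  have rcv h : dominated h -> (\sum_(0 <= t < n) r h t)%R @[n --> \oo] -->
      fine (\int[occupation absD q]_z h z).
    move=> hdom; have rEh n : r h n = fine (\int[strategic q]_w h (state_action n w)).
      by rewrite rE.
    under eq_fun do under eq_bigr do rewrite rEh.
    rewrite (integral_dominated absD hdom q); apply: cvg_fine_partial_sum.
      by move=> n; apply: integral_ge0 => w _; case: hdom.
    by rewrite -(integral_dominated absD hdom q); exact: integral_dominated_lty.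
  have Vcv h : dominated h -> V h n @[n --> \oo] --> 0%R.
    move=> hdom; have := value_cvg0 absD unif k_adm hdom q.
    by under eq_fun do rewrite VE//; exact: fine_cvg.
  apply: cvgB; last exact: cvg_cst.
  have := cvgD (cvgB (rcv f fdom) (rcv g gdom)) (cvgB (Vcv f fdom) (Vcv g gdom)).
  by rewrite subr0 addr0; apply; exact: eventually_filter.
have [ge0 eq0] := nonneg_partial_sums_lim u0 cv; split=> // /eq0 uE t.
apply: eq_ae_integral_le.
- by move=> w; exact: action_value_ge0.
- exact: mav.
- by move=> w; exact: action_value_ge0.
- exact: mav.
- exact: le.
- apply: etrans (avE f g t fdom gdom) _; apply: etrans _ (esym (avE g f t gdom fdom)).
  by apply: (congr1 EFin); apply: arith_eq; exact: uE.
- by rewrite (avE g f t gdom fdom) ltry.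
Qed.

(** If the improvement is zero for the first reward, the action values for it agree almost surely at
    all times along [q], so the comparison is decided by the remaining rewards. *)
Lemma gain_lexge (I : Type) (rs : seq I) (f g : I -> X * borel A -> \bar R) (q : policy M) :
  (forall i, dominated (f i)) -> (forall i, dominated (g i)) ->
  (forall t, {ae strategic q, forall w, lexle [seq (action_value (f i) (g i) (state_action t w),
     action_value (g i) (f i) (state_action t w)) | i <- rs]}) ->
  lexge [seq (gain q (f i) (g i) - gain gamma (f i) (g i))%R | i <- rs].
Proof.
move=> fdom gdom; elim: rs => [//|i rs ih] le /=.
have [|ge0 eq0] := @gain_step (f i) (g i) q (fdom i) (gdom i).
  by move=> t; apply: filterS (le t) => w /= /orP[/ltW//|/andP[/eqP -> _]].
rewrite lt_neqAle ge0 andbT eq_sym; case: eqVneq => //= d0; apply: ih => t.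
by apply: filterS2 (le t) (eq0 d0 t) => w + E; rewrite /= E ltxx eqxx.
Qed.

Hypothesis bA : borel_space R A.
Hypothesis cA : compact [set: A].
Hypothesis mM : measurability_conditions M.

Theorem deterministic_improvement (I : Type) (rs : seq I) (f g : I -> X * borel A -> \bar R) :
  (forall i, dominated (f i)) -> (forall i, dominated (g i)) ->
  exists2 q, deterministic (M := M) q &
    lexge [seq (gain q (f i) (g i) - gain gamma (f i) (g i))%R | i <- rs].
Proof.
move=> fdom gdom.
pose le_set := [set z : X * borel A |
  lexle [seq (action_value (f i) (g i) z, action_value (g i) (f i) z) | i <- rs]].
have mle : measurable le_set.
  by apply: measurable_lexle => i; apply: measurable_action_value.
pose K : set (X * borel A) := [set z | adm M z.1 z.2].
have mK : measurable K by case: mM.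
pose finite_life := [set z : X * borel A | life z.1 < +oo].
have mlife : measurable_fun setT life by exact: (measurable_expected_life absD k).
have mfl : measurable finite_life.
  rewrite -[X in measurable X]setTI.
  apply: emeasurable_fun_infty_o => //; exact: (measurableT_comp mlife measurable_fst).
(* Where the expected life is infinite the values need not be finite and the averaging argument
   fails; there every admissible action is accepted. *)
pose B : set (X * borel A) := K `&` (~` finite_life `|` le_set).
have mB : measurable B.
  by apply: measurableI => //; apply: measurableU => //; exact: measurableC.
have msec x (E : set (X * borel A)) : measurable E -> measurable [set a | E (x, a)].
  by move=> mE; have := @pair1_measurable _ _ X (borel A) x measurableT _ mE; rewrite setTI.
have Bpos x : 0 < k x [set a | B (x, a)].
  have [lx|lx] := pselect (life x < +oo); last first.
    rewrite (_ : [set a | B (x, a)] = adm M x) ?k_adm//.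
    by apply/seteqP; split => a; [case|split => //; left].
  (* Were [B] null at [x], the comparison would fail for almost every action drawn from [k x],
     although both sides have the same finite average. *)
  rewrite lt0e measure_ge0 andbT; apply/eqP => B0.
  have hK := pker_setC_eq0 (adm_measurable M x) (k_adm x).
  apply: (@ae_not_lexle R _ (borel A) I rs (fun i a => action_value (f i) (g i) (x, a))
    (fun i a => action_value (g i) (f i) (x, a)) (k x)).
  - by move=> i a; exact: action_value_ge0.
  - move=> i; apply: (measurableT_comp (measurable_action_value (fdom i) (gdom i))).
    exact: (@pair1_measurable _ _ _ _ x).
  - by move=> i a; exact: action_value_ge0.
  - move=> i; apply: (measurableT_comp (measurable_action_value (gdom i) (fdom i))).
    exact: (@pair1_measurable _ _ _ _ x).
  - move=> i; apply: etrans (integral_action_value_kernel (fdom i) (gdom i) x) _.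
    by apply: etrans _ (esym (integral_action_value_kernel (gdom i) (fdom i) x)); rewrite addeC.
  - move=> i; rewrite (integral_action_value_kernel (gdom i) (fdom i) x).
    by rewrite lte_add_pinfty//; [exact: (value_lty absD (gdom i))|exact: (value_lty absD (fdom i))].
  - by rewrite [X in X != _]prob_kernel oner_neq0.
  exists ([set a | B (x, a)] `|` ~` adm M x); split.
  - by apply: measurableU; [exact: msec|apply: measurableC; exact: adm_measurable].
  - apply: null_set_setU => //; first exact: msec.
    by apply: measurableC; exact: adm_measurable.
  - move=> a /= /negP; rewrite negbK => lea.
    have [Ka|] := pselect (adm M x a); last by right.
    by left; split => //; right.
have [s ms sB] := positive_selection bA cA mB Bpos.
have s_adm x : kdirac ms x (adm M x) = 1 :> \bar R.
  by rewrite /kdirac/= diracE mem_set//; case: (sB x).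
pose q := stationary_policy s_adm; exists q.
  exists s; split => // x; by case: (sB x).
apply: gain_lexge => // t.
have mB1 : measurable_fun setT (fun z => (\1_(~` B) z)%:E : \bar R).
  by apply/measurable_EFinP; apply: measurable_indic; exact: measurableC.
have inB : {ae strategic q, forall w, (\1_(~` B) (state_action t w))%:E = 0 :> \bar R}.
  have : \int[strategic q]_w (\1_(~` B) (state_action t w))%:E = 0 :> \bar R.
    rewrite (integral_kernel_action (stationary_policy_from s_adm)
      (G := fun z => (\1_(~` B) z)%:E))//.
    rewrite integral0_eq// => w _; rewrite /expected_action integral_dirac//.
      by rewrite indicE memNset ?mule0//=; apply; exact: sB.
    exact: (measurableT_comp mB1 (@pair1_measurable _ _ _ _ _)).
  move=> i0; have [] := ae_eq_integral_abs (strategic q) measurableT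
    (measurableT_comp mB1 (@measurable_state_action _ X A t)).
  case/(_ _); last first.
    by move=> N [mN N0 sub]; exists N; split => // w /= nw; apply: sub => /(_ Logic.I).
  by rewrite -[RHS]i0; apply: eq_integral => w _ /=; rewrite ger0_norm.
(* Almost surely [q] visits only states of finite expected life under [k], since following [q] and
   then [k] is a policy. So the action selected satisfies the comparison. *)
have finl : {ae strategic q, forall w, setT w -> life (state t w) \is a fin_num}.
  apply: integrable_ae => //; apply/integrableP; split.
    exact: (measurableT_comp mlife (@measurable_state _ X A t)).
  under eq_integral do rewrite gee0_abs ?expected_life_ge0//.
  exact: (integral_expected_life_lty absD k_adm).
apply: filterS2 inB finl => w Bw /(_ Logic.I) lw.
have [_ []//] : B (state_action t w).
  by apply: contrapT => nB; move: Bw; rewrite indicE mem_set// => -[] /eqP; rewrite oner_eq0.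
by case; rewrite /finite_life/= ltey_eq lw.
Qed.

End improvement.

(** * Performance vectors *)

(* Holds without convergence: [limn] of a divergent sequence is the junk value [point]. *)
Lemma measurable_fun_limn d (T : measurableType d) (R : realType) (f : nat -> T -> \bar R) :
  (forall n, measurable_fun setT (f n)) -> measurable_fun setT (fun x => limn (f ^~ x)).
Proof.
move=> mf.
have msup := measurable_fun_limn_esup mf.
have minf : measurable_fun setT (fun x => limn_einf (f ^~ x)).
  rewrite /limn_einf; apply: measurableT_comp => //.
  by apply: measurable_fun_limn_esup => n; apply: measurableT_comp.
rewrite (_ : (fun x => _) = fun x =>
    if limn_einf (f ^~ x) == limn_esup (f ^~ x) then limn_esup (f ^~ x) else point).
  by apply: measurable_fun_ifT => //; exact: measurable_fun_eqe.
apply/funext => x; case: eqVneq => [eq|neq].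
  apply/cvg_lim => //.
  apply: (@squeeze_cvge _ _ _ _ (einfs (f ^~ x)) _ (esups (f ^~ x))).
  - apply: nearW => n; apply/andP; split.
      by apply: ereal_inf_lbound; exists n => /=.
    by apply: ereal_sup_ubound; exists n => /=.
  - by rewrite -eq limn_einf_lim; exact: is_cvg_einfs.
  - by rewrite limn_esup_lim; exact: is_cvg_esups.
apply: dvgP => cv; move: neq; rewrite is_cvg_limn_einfE// is_cvg_limn_esupE//.
by rewrite eqxx.
Qed.

Section performance.
Local Open Scope ereal_scope.
Context (R : realType) (dX : measure_display) (X : measurableType dX)
  (A : ptopologicalType) (d : nat).
Variable M : control_model R X A d.
Variable D : set X.
Hypothesis absD : absorbing M D.

Section one_reward.
Variable r : X * borel A -> R.
Hypothesis mr : measurable_fun setT r.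
Hypothesis r_bounded : exists C, forall z, (`|r z| <= C)%R.
Hypothesis rD : forall z, D z.1 -> r z = 0%R.

Let mEr : measurable_fun setT (EFin \o r). Proof. exact/measurable_EFinP. Qed.

Lemma dominated_funepos : dominated D (EFin \o r)^\+.
Proof.
split=> [z||]; [exact: funepos_ge0|exact: measurable_funepos|].
have [C rC] := r_bounded; exists (Num.max C 0)%R => [|z]; first by rewrite le_max lexx orbT.
rewrite funepos.unlock; have [Dz|nDz] := pselect (D z.1).
  by rewrite (liveD R Dz) mule0/= rD// maxxx.
rewrite (liveN R nDz) mule1 /= -EFin_max lee_fin.
rewrite ge_max le_max (le_trans (ler_norm _) (rC z))/= le_max lexx orbT//.
Qed.

Lemma dominated_funeneg : dominated D (EFin \o r)^\-.
Proof.
split=> [z||]; [exact: funeneg_ge0|exact: measurable_funeneg|].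
have [C rC] := r_bounded; exists (Num.max C 0)%R => [|z]; first by rewrite le_max lexx orbT.
rewrite funeneg.unlock; have [Dz|nDz] := pselect (D z.1).
  by rewrite (liveD R Dz) mule0/= rD// oppr0 maxxx.
rewrite (liveN R nDz) mule1 /= -EFin_max lee_fin.
by rewrite ge_max le_max (le_trans (ler_norm _))/= ?normrN// le_max lexx orbT.
Qed.

Lemma integrable_reward p : (occupation absD p).-integrable setT (EFin \o r).
Proof.
apply: measurable_bounded_integrable => //.
  by rewrite occupation_total survival_lty.
have [C rC] := r_bounded; exists C; split; first exact: num_real.
by move=> y Cy z _; apply: le_trans (rC z) _; exact: ltW.
Qed.

Lemma gain_funeposneg p :
  gain absD p (EFin \o r)^\+ (EFin \o r)^\- = (\int[occupation absD p]_z r z)%R.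
Proof.
rewrite /gain /Rintegral [in RHS]integralE [in RHS]fineB => [//||].
  rewrite ge0_fin_numE; first exact: (integral_dominated_lty absD dominated_funepos).
  by apply: integral_ge0 => z _; exact: funepos_ge0.
rewrite ge0_fin_numE; first exact: (integral_dominated_lty absD dominated_funeneg).
by apply: integral_ge0 => z _; exact: funeneg_ge0.
Qed.

(** The series along a trajectory may diverge on a null set. Elsewhere it is the difference of the
    series of the positive and negative parts, which have finite integrals and hence finite sums
    almost surely. *)
Lemma integral_total_reward p :
  \int[strategic p]_w \sum_(0 <= t <oo) (r (state_action t w))%:E =
  \int[occupation absD p]_z (r z)%:E.
Proof.
pose S (f : X * borel A -> \bar R) (w : trajectory X A) :=
  \sum_(0 <= t <oo) f (state_action t w).
have S0 f : dominated D f -> forall w, 0 <= S f w.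
  by case=> f0 mf _ w; apply: nneseries_ge0 => t _ _; exact: f0.
have mft f t : measurable_fun setT f ->
    measurable_fun [set: trajectory X A] (fun w => f (state_action t w) : \bar R).
  by move=> mf; exact: (measurableT_comp mf (@measurable_state_action _ X A t)).
have mS f : dominated D f -> measurable_fun setT (S f).
  case=> f0 mf _; apply: ge0_emeasurable_sum => t *; first exact: f0.
  exact: mft.
have intS f : dominated D f -> \int[strategic p]_w S f w = \int[occupation absD p]_z f z.
  move=> fdom; have [f0 mf _] := fdom; rewrite (integral_dominated absD fdom p) /S.
  rewrite integral_nneseries; last 3 first.
  - exact: measurableT.
  - by move=> t; exact: mft.
  - by move=> t w _; exact: f0.
  by [].
have iS f : dominated D f -> (strategic p).-integrable setT (S f).
  move=> fdom; apply/integrableP; split; first exact: mS.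
  under eq_integral do rewrite gee0_abs ?S0//.
  by rewrite intS//; exact: (integral_dominated_lty absD fdom).
have [pdom ndom] := (dominated_funepos, dominated_funeneg).
rewrite [RHS]integralE -(intS _ pdom) -(intS _ ndom) -integralB//; last 2 first.
- exact: iS.
- exact: iS.
apply: ae_eq_integral => //.
- apply: measurable_fun_limn => n; apply: emeasurable_sum => t.
  exact: (mft (EFin \o r)).
- by apply: emeasurable_funB; exact: mS.
apply: filterS2 (integrable_ae measurableT (iS _ pdom)) (integrable_ae measurableT (iS _ ndom)).
move=> w /(_ Logic.I) fp /(_ Logic.I) fn _.
apply/cvg_lim => //.
rewrite (_ : (fun n => _) = (fun n => \sum_(0 <= t < n) (EFin \o r)^\+ (state_action t w) -
   \sum_(0 <= t < n) (EFin \o r)^\- (state_action t w))).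
  apply: cvgeB; first by rewrite fin_num_adde_defr// fin_numN.
  - by apply: is_cvg_nneseries => t _ _; exact: funepos_ge0.
  - by apply: is_cvg_nneseries => t _ _; exact: funeneg_ge0.
apply/funext => n; rewrite -fin_num_sumeN -?big_split/=.
  apply: eq_bigr => t _.
  by have := congr1 (fun F => F (state_action t w)) (funeposneg (EFin \o r)).
by move=> t _; rewrite funeneg.unlock/= -EFin_max.
Qed.

End one_reward.

Let rew_vanish z : D z.1 -> rew M z = 0%R.
Proof. by case: z => x a Dx; have [_ /(_ x a Dx)[]] := absD. Qed.

Let rew_bound i : exists C, forall z, (`|rew M z ord0 i| <= C)%R.
Proof. by have [C rC] := rew_bounded M; exists C => z. Qed.

Let rew_integrable p i : (occupation absD p).-integrable setT (fun z => (rew M z ord0 i)%:E).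
Proof.
apply: (@integrable_reward (fun z => rew M z ord0 i)) => //.
exact: rew_measurable.
Qed.

Lemma performanceE p i : performance M p ord0 i = (\int[occupation absD p]_z rew M z ord0 i)%R.
Proof.
rewrite mxE /Rintegral; congr fine.
apply: (@integral_total_reward (fun z => rew M z ord0 i)) => //.
  exact: rew_measurable.
by move=> z Dz; rewrite rew_vanish// mxE.
Qed.

Definition weighted_reward (c : 'cV[R]_d) z : R := (rew M z *m c)%R ord0 ord0.

Lemma measurable_weighted_reward c : measurable_fun setT (weighted_reward c).
Proof.
rewrite (_ : weighted_reward c = fun z => \sum_i rew M z ord0 i * c i ord0)%R.
  by apply: measurable_sum => i; apply: measurable_funM => //; exact: rew_measurable.
by apply/funext => z; rewrite /weighted_reward mxE.
Qed.

Lemma weighted_reward_bounded c : exists C, forall z, (`|weighted_reward c z| <= C)%R.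
Proof.
have [C rC] := rew_bounded M; exists (\sum_(i < d) C * `|c i ord0|)%R => z.
rewrite /weighted_reward mxE (le_trans (ler_norm_sum _ _ _))//.
by apply: ler_sum => i _; rewrite normrM ler_wpM2r.
Qed.

Lemma weighted_reward_vanish c z : D z.1 -> weighted_reward c z = 0%R.
Proof. by move=> Dz; rewrite /weighted_reward rew_vanish// mul0mx mxE. Qed.

Lemma performance_weighted p c :
  ((performance M p *m c) ord0 ord0)%R = (\int[occupation absD p]_z weighted_reward c z)%R.
Proof.
have int i : (occupation absD p).-integrable setT (EFin \o (fun z => rew M z ord0 i * c i ord0)%R).
  apply: integrable_reward.
  - by apply: measurable_funM => //; exact: rew_measurable.
  - have [C rC] := rew_bounded M; exists (C * `|c i ord0|)%R => z.
    by rewrite normrM ler_wpM2r.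
rewrite mxE; transitivity (\sum_i fine (\int[occupation absD p]_z (rew M z ord0 i * c i ord0)%:E))%R.
  apply: eq_bigr => i _; rewrite performanceE mulrC -RintegralZl//.
    by apply: eq_Rintegral => z _; rewrite mulrC.
  exact: rew_integrable.
rewrite /Rintegral sum_fine => [|i _]; last exact: (integrable_fin_num measurableT (int i)).
congr fine; rewrite -(integral_sum measurableT int); apply: eq_integral => z _.
by rewrite sumEFin /weighted_reward mxE.
Qed.

Lemma performance_mixture n al (q : nat -> policy M) p :
  (forall G, measurable G -> occupation absD p G = mixture absD n al q G) ->
  (performance M p = \sum_(j < n) (al j)%:num *: performance M (q j))%R.
Proof.
move=> pE; apply/rowP => i; rewrite summxE performanceE.
have mr := rew_measurable M i.
have rD z : D z.1 -> rew M z ord0 i = 0%R by move=> Dz; rewrite rew_vanish// mxE.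
have fineE f : dominated D f -> fine (\int[occupation absD p]_z f z) =
    (\sum_(j < n) (al j)%:num * fine (\int[occupation absD (q j)]_z f z))%R.
  move=> fdom; have [f0 mf _] := fdom.
  have fE j : \int[occupation absD (q j)]_z f z = (fine (\int[occupation absD (q j)]_z f z))%:E.
    rewrite fineK// ge0_fin_numE; first exact: (integral_dominated_lty absD fdom).
    exact: integral_ge0.
  apply: etrans (congr1 fine (eq_integral_measure f pE)) _.
  rewrite (integral_mixture absD n al q f0 mf).
  by under eq_bigr do rewrite fE -EFinM; rewrite sumEFin.
have pdom := dominated_funepos mr (rew_bound i) rD.
have ndom := dominated_funeneg mr (rew_bound i) rD.
rewrite -(gain_funeposneg mr (rew_bound i) rD).
apply: etrans (congr2 (fun a b => a - b)%R (fineE _ pdom) (fineE _ ndom)) _.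
rewrite -sumrB; apply: eq_bigr => j _.
by rewrite mxE performanceE -(gain_funeposneg mr (rew_bound i) rD) -mulrBr.
Qed.

End performance.

(** * Sufficiency of finite mixtures *)

Section sufficiency.
Context (R : realType) (dX : measure_display) (X : measurableType dX)
  (A : ptopologicalType) (d : nat).
Variable M : control_model R X A d.
Variable D : set X.
Hypothesis bA : borel_space R A.
Hypothesis cA : compact [set: A].
Hypothesis mM : measurability_conditions M.
Hypothesis absD : absorbing M D.
Hypothesis unif : uniformly_absorbing M D.

Lemma stationary_same_performance (p : policy M) :
  exists (k : R.-pker X ~> borel A) (k_adm : forall x, k x (adm M x) = 1%E),
    performance M (stationary_policy k_adm) = performance M p.
Proof.
have al1 : \sum_(j < 1) (1%:nng : {nonneg R})%:num = 1 by rewrite big_ord1.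
have [k [k_adm kE]] := @stationarization _ _ _ _ _ _ _ absD bA cA mM 1 (fun=> 1%:nng) (fun=> p) al1.
by exists k, k_adm; rewrite (performance_mixture kE) big_ord1 scale1r.
Qed.

Lemma performance_hull (k : R.-pker X ~> borel A) (k_adm : forall x, k x (adm M x) = 1%E) :
  hull (performance M) (@deterministic _ _ _ _ _ M) (performance M (stationary_policy k_adm)).
Proof.
set v := performance M _; apply: contrapT => vN.
(* The hull translated so that [v] becomes the origin, from which it is separated. *)
pose C := [set u | hull (performance M) (@deterministic _ _ _ _ _ M) (u + v)].
have [||cs csP] := @lexicographic_separation R d C.
- move=> u u' t Cu Cu' t0 t1; rewrite /C/=.
  have -> : t *: u + (1 - t) *: u' + v = t *: (u + v) + (1 - t) *: (u' + v).
    by rewrite !scalerDr addrACA -scalerDl [(t + _)%R]addrC subrK scale1r.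
  exact: convex_hull.
- by rewrite /C/= add0r.
pose f c := (EFin \o weighted_reward M c)^\+%E.
pose g c := (EFin \o weighted_reward M c)^\-%E.
have mw := measurable_weighted_reward M.
have bw := weighted_reward_bounded M.
have vw := weighted_reward_vanish absD.
have fdom c : dominated D (f c) by exact: (dominated_funepos (mw c) (bw c) (vw c)).
have gdom c : dominated D (g c) by exact: (dominated_funeneg (mw c) (bw c) (vw c)).
(* Each functional in [cs] turns the vector reward into a scalar one. For this list [q] is
   lexicographically at least as good as the stationary policy, whereas its performance, a point of
   the hull, is separated from [v] the other way. *)
have [q qdet] := deterministic_improvement absD unif k_adm bA cA mM cs fdom gdom.
apply/negP; rewrite (_ : [seq _ | c <- cs] = [seq ((performance M q - v) *m c) 0 0 | c <- cs]).
  apply: csP; rewrite /C/= subrK; exists 1%N, (fun=> q), (fun=> 1).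
  by split => //; split; rewrite ?big_ord1 ?scale1r.
apply: eq_map => c; rewrite mulmxBl mxE [X in _ = _ + X]mxE.
have gE p := etrans (gain_funeposneg absD (mw c) (bw c) (vw c) p)
  (esym (performance_weighted absD p c)).
exact: (congr2 (fun a b => a - b) (gE q) (gE (stationary_policy k_adm))).
Qed.

Lemma finite_mixtures_sufficient (p : policy M) :
  exists2 g, finite_mixtures M D d.+1 g & performance M g = performance M p.
Proof.
have [k [k_adm <-]] := stationary_same_performance p.
have [x [a [xdet [a0 a1 ->]]]] := caratheodory (performance_hull k_adm).
(* A mixture is indexed by natural numbers; [inord] extends the given families, and only indices
   below [d.+1] are summed. *)
pose al j : {nonneg R} := NngNum (a0 (inord j : 'I_d.+1)).
pose q j := x (inord j : 'I_d.+1).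
have al1 : \sum_(j < d.+1) (al j)%:num = 1.
  by rewrite -[RHS]a1; apply: eq_bigr => j _; rewrite /= inord_val.
have [k' [k'_adm kE]] := stationarization absD bA cA mM q al1.
exists (stationary_policy k'_adm); last first.
  rewrite (performance_mixture kE).
  by apply: eq_bigr => j _; rewrite /q /= inord_val.
split; first exact: stationary_policyP.
exists a, x; split => // G mG.
rewrite (occupationE absD)// kE// measure_as_integral// integral_mixture//; last first.
  by apply/measurable_EFinP; exact: measurable_indic.
apply: eq_bigr => j _.
by rewrite (occupationE absD)// /q /= inord_val -measure_as_integral.
Qed.

End sufficiency.

Theorem theorem4p4 (R : realType) (dX : measure_display)
    (X : measurableType dX) (A : ptopologicalType) (d : nat)
    (M : control_model R X A d) (Delta : set X) :
  borel_space R A -> compact [set: A] -> (1 <= d)%N ->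
  measurability_conditions M ->
  uniformly_absorbing M Delta ->
  performance M @` finite_mixtures M Delta d.+1
  = performance M @` [set: policy M].
Proof.
move=> bA cA _ mM unif; have [absD _] := unif.
apply/seteqP; split => [v [p _ <-]|v [p _ <-]]; first by exists p.
have [g gF gp] := finite_mixtures_sufficient bA cA mM absD unif p.
by exists g.
Qed.
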